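(* Let $d,q,l\ge 1$, let $C$ be a $d\times d$ positive definite matrix, let $A_{ij}$ ($i=1,\dots,q$, $j=1,\dots,l$) be real $d\times d$ matrices, and let $((M_t,Q_t):t\in\mathbb{Z})$ be the i.i.d. sequence associated with them as in the context. Suppose that the top Lyapunov exponent $$\gamma=\inf_{n\in\mathbb{N}} n^{-1}\,\mathbb{E}\big[\log\Vert M_1\cdots M_n\Vert\big]$$ satisfies $\gamma<0$. Then there exists an almost surely unique strictly stationary ergodic causal solution $(V_t)$ to the stochastic recurrence equation $$V_t=M_tV_{t-1}+Q_t,\qquad t\in\mathbb{Z}.$$ In particular, there exists a strictly stationary ergodic solution $(X_t)$ to the BEKK-ARCH process $$X_t=H_t^{1/2}Z_t,\qquad H_t=C+\sum_{i=1}^{q}\sum_{j=1}^{l}A_{ij}X_{t-i}X_{t-i}'A_{ij}',$$ with $(Z_t)$ i.i.d., $Z_t\sim N(0,I_d)$.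
   Context: For $i=1,\dots,q$ and $j=1,\dots,l$ let $(m_{i,j,t}:t\in\mathbb{Z})$ be i.i.d. sequences of univariate standard normal variables, mutually independent for different pairs $(i,j)$. Let $(B_t:t\in\mathbb{Z})$ be i.i.d. with $B_t\sim N(0,C)$, independent of all the $(m_{i,j,t})$. Put $M_{i,t}=\sum_{j=1}^{l}m_{i,j,t}A_{ij}$ and $$M_t=\begin{pmatrix} M_{1,t}&M_{2,t}&\cdots&M_{q,t}\\ I_d&&&0\\ &\ddots&&\vdots\\ &&I_d&0\end{pmatrix}\in\mathbb{R}^{dq\times dq},\qquad Q_t=(B_t',0',\dots,0')'\in\mathbb{R}^{dq}$$ (so $M_t=M_{1,t}$, $Q_t=B_t$ if $q=1$). By Gaussianity of $Z_t$, the BEKK-ARCH process has the representation $V_t=M_tV_{t-1}+Q_t$ with $V_t=(X_t',X_{t-1}',\dots,X_{t-(q-1)}')'$. Here $I_d$ is the identity matrix, $'$ denotes transpose, $\Vert\cdot\Vert$ is the operator norm induced by a vector norm, and $\mathbb{N}=\{1,2,\dots\}$. A solution $(V_t)$ is causal if $V_t$ is a measurable function of $(M_s,Q_s)_{s\le t}$. *)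

(* Defs.v *)
From HB Require Import structures.
From mathcomp Require Import all_boot all_order all_algebra.
From mathcomp Require Import all_classical all_reals all_analysis.

Set Implicit Arguments.
Unset Strict Implicit.
Unset Printing Implicit Defensive.

Import Order.TTheory GRing.Theory Num.Theory.
Import numFieldNormedType.Exports.

Local Open Scope classical_set_scope.
Local Open Scope ring_scope.

(* The sigma-algebra generated by an arbitrary family of maps; the library's
   [g_sigma_preimage] is restricted to families indexed by ['I_n]. *)
Definition g_sigma_family d (T : measurableType d) (I aT : Type)
    (f : I -> aT -> T) : set (set aT) :=
  <<s \bigcup_i preimage_set_system setT (f i) measurable >>.

Definition mx_display : measure_display -> measure_display.
Proof. exact. Qed.

Section matrix_measurable.
Context d (T : measurableType d).
Variables m n : nat.

(* Product sigma-algebra of the entries; for real entries this is the Borel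
   sigma-algebra of R^(m * n). *)
Let entries (ij : 'I_m * 'I_n) (A : 'M[T]_(m, n)) : T := A ij.1 ij.2.

Let mx_set0 : g_sigma_family entries set0.
Proof. exact: sigma_algebra0. Qed.

Let mx_setC A : g_sigma_family entries A -> g_sigma_family entries (~` A).
Proof. exact: sigma_algebraC. Qed.

Let mx_bigcup (F : (set 'M[T]_(m, n))^nat) :
  (forall k, g_sigma_family entries (F k)) ->
  g_sigma_family entries (\bigcup_k F k).
Proof. exact: sigma_algebra_bigcup. Qed.

HB.instance Definition _ := @isMeasurable.Build (mx_display d)
  'M[T]_(m, n) (g_sigma_family entries) mx_set0 mx_setC mx_bigcup.

End matrix_measurable.

Definition path_space d (I : Type) (T : measurableType d) :=
  g_sigma_algebraType
    (g_sigma_family (fun (i : I) (x : I -> T) => x i)).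

Section independence.
Context d (Omega : measurableType d) (R : realType) (P : probability Omega R).

Definition mutually_independent (I : eqType) (F : I -> set (set Omega)) : Prop :=
  forall (s : seq I) (E : I -> set Omega), uniq s ->
    (forall i, i \in s -> F i (E i)) ->
    P (\bigcap_(i in [set` s]) E i) = (\prod_(i <- s) P (E i))%E.

Definition independent (F G : set (set Omega)) : Prop :=
  forall A B, F A -> G B -> P (A `&` B) = (P A * P B)%E.

End independence.

Section processes.
Context d (Omega : measurableType d) (R : realType) (P : probability Omega R).
Context d' (T : measurableType d').
Implicit Types X : int -> Omega -> T.

Definition strictly_stationary X : Prop :=
  forall (k : nat) (ts : k.-tuple int) (h : int) (E : set (k.-tuple T)),
    measurable E ->
    P [set w | E [tuple X (tnth ts i + h) w | i < k]] =
    P [set w | E [tuple X (tnth ts i) w | i < k]].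

(* Every shift-invariant event of the path space has probability 0 or 1. *)
Definition ergodic X : Prop :=
  forall E : set (path_space int T), measurable E ->
    (forall x : int -> T, E (fun t => x (t + 1)) <-> E x) ->
    P [set w | E (X^~ w)] = 0%E \/ P [set w | E (X^~ w)] = 1%E.

Definition causal d'' (S : measurableType d'')
    (Y : int -> Omega -> S) X : Prop :=
  forall t : int,
    exists f : path_space {s : int | (s <= t)%R} S -> T,
      measurable_fun setT f /\
      forall w, X t w = f (fun s => Y (sval s) w).

End processes.

Section linear_algebra.
Variable R : realType.

Definition quad_form n (A : 'M[R]_n) (x : 'cV[R]_n) : R :=
  (x^T *m A *m x) 0 0.

Definition positive_definite n (A : 'M[R]_n) : Prop :=
  A^T = A /\ forall x, x != 0 -> 0 < quad_form A x.

Definition positive_semidefinite n (A : 'M[R]_n) : Prop :=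
  A^T = A /\ forall x, 0 <= quad_form A x.

(* The positive semidefinite square root H^(1/2); it exists and is unique
   when H is positive semidefinite, and the value is irrelevant otherwise. *)
Definition sqrtmx n (H : 'M[R]_n) : 'M[R]_n :=
  xget 0 [set S | positive_semidefinite S /\ S *m S = H].

Definition vector_norm n (N : 'cV[R]_n -> R) : Prop :=
  [/\ forall x y, N (x + y) <= N x + N y,
      forall a x, N (a *: x) = `|a| * N x
    & forall x, N x = 0 -> x = 0].

Definition opnorm n (N : 'cV[R]_n -> R) (A : 'M[R]_n) : R :=
  sup [set N (A *m x) | x in [set x | N x <= 1]].

End linear_algebra.

Section normal_laws.
Context d (Omega : measurableType d) (R : realType) (P : probability Omega R).

(* N(mu, v) parametrised by its variance; the library's [normal_prob] takes the
   standard deviation, and is not a point mass when that parameter is 0. *)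
Definition normal_law (mu v : R) : set R -> \bar R :=
  if v == 0 then \d_mu else normal_prob mu (Num.sqrt v).

Definition has_normal_law (mu v : R) (X : Omega -> R) : Prop :=
  measurable_fun setT X /\
  forall E, measurable E -> P (X @^-1` E) = normal_law mu v E.

(* X ~ N(0, C): all linear forms u'X are N(0, u'Cu). *)
Definition has_centered_normal_law n (C : 'M[R]_n)
    (X : Omega -> 'cV[R]_n) : Prop :=
  measurable_fun setT X /\
  forall u : 'cV[R]_n,
    has_normal_law 0 (quad_form C u) (fun w => (u^T *m X w) 0 0).

End normal_laws.

Section recurrence.
Context d (Omega : measurableType d) (R : realType) (P : probability Omega R).
Variable n : nat.
Variables (M : int -> Omega -> 'M[R]_n) (Q : int -> Omega -> 'cV[R]_n).

(* [lne 0 = -oo], so the value -oo is allowed both for the expectations and for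
   the infimum. *)
Definition top_lyapunov (N : 'cV[R]_n -> R) : \bar R :=
  ereal_inf
    [set ((k%:R^-1)%:E *
          \int[P]_w lne (opnorm N (\prod_(1 <= i < k.+1) M i%:Z w))%:E)%E
    | k in [set k : nat | (0 < k)%N]].

Definition sre_solution (V : int -> Omega -> 'cV[R]_n) : Prop :=
  {ae P, forall w, forall t, V t w = M t w *m V (t - 1) w + Q t w}.

Definition stationary_causal_sre_solution
    (V : int -> Omega -> 'cV[R]_n) : Prop :=
  [/\ sre_solution V, strictly_stationary P V, ergodic P V
    & causal (fun t w => (M t w, Q t w)) V].

End recurrence.

Section bekk.
Context d0 (Omega : measurableType d0) (R : realType) (P : probability Omega R).
Variables d q l : nat.
Variables (C : 'M[R]_d) (A : 'I_q -> 'I_l -> 'M[R]_d).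

Record bekk_noise (m : 'I_q -> 'I_l -> int -> Omega -> R)
    (B : int -> Omega -> 'cV[R]_d) : Prop := {
  m_law : forall i j t, has_normal_law P 0 1 (m i j t);
  m_indep : forall i j,
    mutually_independent P (fun t => g_sigma_algebra_preimage (m i j t));
  m_indep_pairs :
    mutually_independent P
      (fun ij : 'I_q * 'I_l => g_sigma_family (m ij.1 ij.2));
  B_law : forall t, has_centered_normal_law P C (B t);
  B_indep : mutually_independent P (fun t => g_sigma_algebra_preimage (B t));
  B_indep_m :
    independent P (g_sigma_family B)
      (g_sigma_family
         (fun ijt : 'I_q * 'I_l * int => m ijt.1.1 ijt.1.2 ijt.2))
}.

(* The dq x dq companion matrix with first block row (M_1, ..., M_q); blocks
   are numbered from 0. *)
Definition companion (M : 'I_q -> 'M[R]_d) : 'M[R]_(\sum_(i < q) d) :=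
  \mxblock_(i < q, j < q)
    (if i == 0%N :> nat then M j
     else if i == j.+1 :> nat then 1%:M else 0).

Definition bekk_M (m : 'I_q -> 'I_l -> int -> Omega -> R) (t : int) (w : Omega)
    : 'M[R]_(\sum_(i < q) d) :=
  companion (fun i => \sum_(j < l) m i j t w *: A i j).

Definition bekk_Q (B : int -> Omega -> 'cV[R]_d) (t : int) (w : Omega)
    : 'cV[R]_(\sum_(i < q) d) :=
  \mxcol_(i < q) (if i == 0%N :> nat then B t w else 0).

(* The lag of the i-th term is i.+1 because ['I_q] starts at 0. *)
Definition bekk_H (x : int -> 'cV[R]_d) (t : int) : 'M[R]_d :=
  C + \sum_(i < q) \sum_(j < l)
        (A i j *m x (t - i.+1%:Z) *m (x (t - i.+1%:Z))^T *m (A i j)^T).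

(* As for any ARCH model, the innovation Z_t is independent of the past of X,
   so that H_t is the conditional covariance matrix of X_t. *)
Record bekk_arch (X Z : int -> Omega -> 'cV[R]_d) : Prop := {
  X_meas : forall t, measurable_fun setT (X t);
  Z_law : forall t, has_centered_normal_law P 1%:M (Z t);
  Z_indep : mutually_independent P (fun t => g_sigma_algebra_preimage (Z t));
  Z_indep_past : forall t,
    independent P (g_sigma_algebra_preimage (Z t))
      (g_sigma_family (fun s : {s : int | (s < t)%R} => X (sval s)));
  bekk_eq :
    {ae P, forall w, forall t,
       X t w = sqrtmx (bekk_H (X^~ w) t) *m Z t w}
}.

End bekk.

(* Main.v *)
Require Import Defs.
From mathcomp Require Import all_boot all_order all_algebra.
From mathcomp Require Import all_classical all_reals all_analysis.
From mathcomp Require Import measurable_realfun.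
From mathcomp Require Import ring lra zify.

Set Implicit Arguments.
Unset Strict Implicit.
Unset Printing Implicit Defensive.

Import Order.TTheory GRing.Theory Num.Theory.
Import numFieldNormedType.Exports.
Local Open Scope classical_set_scope.
Local Open Scope ring_scope.

(** Substituting the recurrence into itself expresses V_t as a partial sum of
    Q_t + M_t Q_(t-1) + M_t M_(t-1) Q_(t-2) + ... plus a remainder, so the point
    is to sum this series. If gamma < 0 then E log |M_1 ... M_p| < 0 for some p,
    and since (x^s - 1) / s tends to log x as s tends to 0, some s in (0, 1] has
    E |M_1 ... M_p|^s < 1 ([lne_moment_lt1]); the first moments that this needs
    are finite because the coefficients are Gaussian. By independence
    k |-> E |M_1 ... M_k|^s is submultiplicative, hence summable
    ([summable_moments]). So the s-th powers of the norms of the terms of the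
    series are almost surely summable, and as s <= 1 so are the norms
    themselves ([past_sre_cvg]).

    The sum is one measurable function applied to the shifted path of the
    coefficients. It is therefore causal, it is stationary because the law of an
    i.i.d. path is invariant under the shift, and it is ergodic because
    invariant events of an i.i.d. path have probability 0 or 1
    ([path_shift_invariant01]). Two stationary solutions differ by a stationary
    process D with D_t = M_t ... M_(t-k+1) D_(t-k); the product tends to 0 in
    probability and D_(t-k) is tight, so D_t = 0 ([sre_series_unique]).

    For the BEKK process, let X_t be the first block of V_t. Then
    X_t = sum_ij m_ijt A_ij X_(t-i) + B_t, the other blocks are the lagged values
    of X, and given the past X_t is centered normal with covariance H_t. As
    H_t >= C is positive definite, Z_t = H_t^(-1/2) X_t makes sense, and given the
    past its law is N(0, I) whatever the past is. This single fact yields the law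
    of Z_t, its independence of the past of X and the mutual independence of the
    Z_t ([bekk_Z_conditional_law]). It uses two tools: a normal law, prescribed
    through linear forms, is determined by them ([cramer_wold]), and the square
    root of a positive definite matrix depends measurably on the matrix, being the
    limit of an explicit iteration ([measurable_sqrtmx]). *)

(** * Generated sigma-algebras and measurability of matrix operations *)

Lemma g_sigma_family_measurable (I : Type) d' (Omega : measurableType d') d
    (T : measurableType d) (f : I -> Omega -> T) :
  (forall i, measurable_fun setT (f i)) -> g_sigma_family f `<=` measurable.
Proof.
move=> mf; apply: smallest_sub; first exact: sigma_algebra_measurable.
by move=> _ [i _ [B mB <-]]; exact: mf.
Qed.

Lemma preimage_g_sigma_family (I aT bT : Type) d (T : measurableType d)
    (f : I -> aT -> T) (g : bT -> aT) A :
  g_sigma_family f A -> g_sigma_family (fun i => f i \o g) (g @^-1` A).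
Proof.
pose H : set (set aT) := [set A | g_sigma_family (fun i => f i \o g) (g @^-1` A)].
suff : g_sigma_family f `<=` H by apply.
apply: smallest_sub.
  split => [|B|F HF]; rewrite /H/=.
  - by rewrite preimage_set0; exact: sigma_algebra0.
  - by rewrite setTD => hB; rewrite preimage_setC -setTD; exact: sigma_algebraCD.
  - by rewrite preimage_bigcup; exact: sigma_algebra_bigcup.
move=> _ [i _ [B mB <-]]; rewrite setTI.
by apply: sub_sigma_algebra; exists i => //; exists B => //; rewrite setTI.
Qed.

Lemma g_sigma_bigcap_seq (aT : pointedType) (I : choiceType) (G : set (set aT)) (s : seq I)
    (E : I -> set aT) :
  (forall i, i \in s -> <<s G >> (E i)) -> <<s G >> (\bigcap_(i in [set` s]) E i).
Proof.
move=> GE; rewrite bigcap_seq big_seq.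
by apply: (@bigsetI_measurable _ (g_sigma_algebraType G)) => i /GE.
Qed.

Section matrix_measurability.
Context d (Omega : measurableType d).

Lemma measurable_entry d' (T : measurableType d') m n (i : 'I_m) (j : 'I_n) :
  measurable_fun setT (fun A : 'M[T]_(m, n) => A i j).
Proof. by move=> _ B mB; apply: sub_sigma_algebra; exists (i, j) => //; exists B. Qed.

Lemma measurable_mx d' (T : measurableType d') m n (f : Omega -> 'M[T]_(m, n)) :
  (forall i j, measurable_fun setT (fun w => f w i j)) -> measurable_fun setT f.
Proof.
move=> mf _ A mA; rewrite setTI.
have := preimage_g_sigma_family (g := f) mA; apply: g_sigma_family_measurable.
by move=> [i j]; exact: mf.
Qed.

Lemma measurable_mxP d' (T : measurableType d') m n (f : Omega -> 'M[T]_(m, n)) i j :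
  measurable_fun setT f -> measurable_fun setT (fun w => f w i j).
Proof. by move=> mf; exact: (measurableT_comp (@measurable_entry _ _ _ _ i j) mf). Qed.

Variable R : realType.

Lemma measurable_addmx m n (f g : Omega -> 'M[R]_(m, n)) :
  measurable_fun setT f -> measurable_fun setT g ->
  measurable_fun setT (fun w => f w + g w).
Proof.
move=> mf mg; apply: measurable_mx => i j; under eq_fun do rewrite mxE.
by apply: measurable_funD; exact: measurable_mxP.
Qed.

Lemma measurable_scalemx m n (a : Omega -> R) (f : Omega -> 'M[R]_(m, n)) :
  measurable_fun setT a -> measurable_fun setT f ->
  measurable_fun setT (fun w => a w *: f w).
Proof.
move=> ma mf; apply: measurable_mx => i j; under eq_fun do rewrite mxE.
by apply: measurable_funM => //; exact: measurable_mxP.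
Qed.

Lemma measurable_trmx m n (f : Omega -> 'M[R]_(m, n)) :
  measurable_fun setT f -> measurable_fun setT (fun w => (f w)^T).
Proof.
move=> mf; apply: measurable_mx => i j; under eq_fun do rewrite mxE.
exact: measurable_mxP.
Qed.

Lemma measurable_mulmx m n p (f : Omega -> 'M[R]_(m, n)) (g : Omega -> 'M[R]_(n, p)) :
  measurable_fun setT f -> measurable_fun setT g ->
  measurable_fun setT (fun w => f w *m g w).
Proof.
move=> mf mg; apply: measurable_mx => i j; under eq_fun do rewrite mxE.
by apply: measurable_sum => k; apply: measurable_funM; exact: measurable_mxP.
Qed.

Lemma measurable_summx m n (I : Type) (s : seq I) (f : I -> Omega -> 'M[R]_(m, n)) :
  (forall i, measurable_fun setT (f i)) ->
  measurable_fun setT (fun w => \sum_(i <- s) f i w).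
Proof.
move=> mf; elim: s => [|i s IH]; first by under eq_fun do rewrite big_nil; exact: measurable_cst.
by under eq_fun do rewrite big_cons; exact: measurable_addmx.
Qed.

End matrix_measurability.

Section dot_product.
Variables (R : realType) (n : nat).
Implicit Types u x : 'cV[R]_n.

Definition dot u x : R := (u^T *m x) 0 0.

Lemma dotE u x : dot u x = \sum_i u i 0 * x i 0.
Proof. by rewrite /dot mxE; apply: eq_bigr => i _; rewrite mxE. Qed.

Lemma dotDl u v x : dot (u + v) x = dot u x + dot v x.
Proof. by rewrite /dot linearD/= mulmxDl mxE. Qed.

Lemma dotBl u v x : dot (u - v) x = dot u x - dot v x.
Proof. by rewrite /dot linearB/= mulmxBl !mxE. Qed.

Lemma dotZl a u x : dot (a *: u) x = a * dot u x.
Proof. by rewrite /dot linearZ/= -scalemxAl mxE. Qed.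

Lemma dot0l x : dot 0 x = 0. Proof. by rewrite /dot linear0 mul0mx mxE. Qed.

Lemma dot_delta i x : dot (delta_mx i 0) x = x i 0.
Proof.
rewrite dotE (bigD1 i)//= mxE !eqxx mul1r big1 ?addr0// => j ji.
by rewrite mxE (negbTE ji) mul0r.
Qed.

Lemma measurable_dot u : measurable_fun setT (dot u).
Proof.
by apply: measurable_mxP; exact: measurable_mulmx.
Qed.

End dot_product.

(** * Norms of vectors and matrices *)

Section entrywise_norm.
Variables (R : realType) (m n : nat).
Implicit Types A B : 'M[R]_(m, n).

Definition mx1norm A : R := \sum_i \sum_j `|A i j|.

Lemma mx1norm_ge0 A : 0 <= mx1norm A.
Proof. by apply: sumr_ge0 => i _; exact: sumr_ge0. Qed.

Lemma mx1normB A B : mx1norm (A - B) = mx1norm (B - A).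
Proof.
by apply: eq_bigr => i _; apply: eq_bigr => j _; rewrite !mxE distrC.
Qed.

Lemma mx1norm_entry A i j : `|A i j| <= mx1norm A.
Proof.
rewrite /mx1norm (bigD1 i)//= (bigD1 j)//= -addrA lerDl addr_ge0//.
  exact: sumr_ge0.
by apply: sumr_ge0 => k _; exact: sumr_ge0.
Qed.

Lemma measurable_mx1norm : measurable_fun setT mx1norm.
Proof.
apply: measurable_sum => i; apply: measurable_sum => j.
by apply: measurableT_comp => //; exact: measurable_entry.
Qed.

Lemma rat_mx_approx A (e : R) : 0 < e ->
  exists q : 'M[rat]_(m, n), mx1norm (A - map_mx ratr q) < e.
Proof.
move=> e0; pose K := (m * n)%N.+1%:R : R.
have eK : 0 < e / K by rewrite divr_gt0.
have h (ij : 'I_m * 'I_n) : exists q : rat, `|A ij.1 ij.2 - ratr q| < e / K.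
  have /rat_in_itvoo[q] : A ij.1 ij.2 < A ij.1 ij.2 + e / K by rewrite ltrDl.
  rewrite in_itv/= => /andP[q1 q2]; exists q.
  by rewrite distrC gtr0_norm ?subr_gt0// ltrBlDl.
have [q hq] := choice h.
exists (\matrix_(i, j) q (i, j)).
apply: (@le_lt_trans _ _ (\sum_(i < m) \sum_(j < n) e / K)).
  apply: ler_sum => i _; apply: ler_sum => j _; rewrite !mxE ltW//.
  exact: (hq (i, j)).
rewrite !sumr_const !card_ord -mulrnA -mulr_natr mulrAC ltr_pdivrMr//.
by rewrite ltr_pM2l// ltr_nat mulnC ltnS.
Qed.

(** The sigma-algebra on matrices is generated by the entries, so measurability
    of a continuous function is not immediate. For a Lipschitz function the set
    {f < c} is the countable union, over rational matrices r, of the sets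
    {A : f r + L |A - r| < c}. *)
Lemma measurable_lipschitz (f : 'M[R]_(m, n) -> R) (L : R) : 0 <= L ->
  (forall A B, `|f A - f B| <= L * mx1norm (A - B)) -> measurable_fun setT f.
Proof.
move=> L0 lip; apply: (measurability _ (RGenInftyO.measurableE R)).
move=> _ [_ [c ->] <-]; rewrite setTI.
pose g q A := f (map_mx ratr q) + L * mx1norm (A - map_mx ratr q).
have mg q : measurable_fun setT (g q).
  apply: measurable_funD => //; apply: measurable_funM => //.
  apply: measurableT_comp; first exact: measurable_mx1norm.
  exact: measurable_addmx.
rewrite (_ : _ @^-1` _ = \bigcup_(q : 'M[rat]_(m, n)) (g q @^-1` `]-oo, c[)).
  apply: countable_bigcupT_measurable => [|q]; first exact: countableP.
  by rewrite -[X in measurable X]setTI; exact: mg.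
apply/seteqP; split => A /=; rewrite in_itv/=.
  move=> fc; have e0 : 0 < (c - f A) / (2 * L + 1).
    by rewrite divr_gt0 ?subr_gt0// ltr_wpDl// mulr_ge0.
  have [q hq] := rat_mx_approx A e0; exists q => //=; rewrite in_itv/= /g.
  have := lip (map_mx ratr q) A; rewrite mx1normB => /(le_trans (ler_norm _)).
  move: hq; rewrite ltr_pdivlMr; last by rewrite ltr_wpDl// mulr_ge0.
  have := mx1norm_ge0 (A - map_mx ratr q).
  nra.
move=> [q _]; rewrite /= in_itv/= /g; apply: le_lt_trans.
by rewrite -lerBlDl (le_trans (ler_norm _)).
Qed.

End entrywise_norm.

Section vector_norm_theory.
Variables (R : realType) (n : nat) (N : 'cV[R]_n -> R).
Hypothesis hN : vector_norm N.
Implicit Types x y : 'cV[R]_n.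

Lemma vnormD x y : N (x + y) <= N x + N y. Proof. by case: hN. Qed.

Lemma vnormZ a x : N (a *: x) = `|a| * N x. Proof. by case: hN. Qed.

Lemma vnorm0 : N 0 = 0. Proof. by rewrite -(scale0r 0) vnormZ normr0 mul0r. Qed.

Lemma vnormN x : N (- x) = N x.
Proof. by rewrite -scaleN1r vnormZ normrN1 mul1r. Qed.

Lemma vnorm_ge0 x : 0 <= N x.
Proof. by have := vnormD x (- x); rewrite subrr vnorm0 vnormN -mulr2n pmulrn_lge0. Qed.

Lemma vnorm_sum (I : Type) (s : seq I) (F : I -> 'cV[R]_n) :
  N (\sum_(i <- s) F i) <= \sum_(i <- s) N (F i).
Proof.
elim: s => [|i s IH]; first by rewrite !big_nil vnorm0.
by rewrite !big_cons (le_trans (vnormD _ _))// lerD2l.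
Qed.

Lemma vnorm_dist x y : `|N x - N y| <= N (x - y).
Proof.
have h a b : N a - N b <= N (a - b) by rewrite lerBlDr -{1}(subrK b a) vnormD.
rewrite ler_norml h andbT lerNl opprB.
by rewrite -(vnormN (x - y)) opprB h.
Qed.

Definition vnorm_max : R := \sum_i N (delta_mx i 0).

Lemma vnorm_max_ge0 : 0 <= vnorm_max.
Proof. by apply: sumr_ge0 => i _; exact: vnorm_ge0. Qed.

Lemma vnorm_le x : N x <= vnorm_max * mx1norm x.
Proof.
rewrite {1}(matrix_sum_delta x) (le_trans (vnorm_sum _ _))// /vnorm_max mulr_suml.
apply: ler_sum => i _; rewrite big_ord1 vnormZ mulrC ler_wpM2l ?vnorm_ge0//.
exact: mx1norm_entry.
Qed.

Lemma measurable_vnorm : measurable_fun setT N.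
Proof.
apply: (@measurable_lipschitz _ _ _ _ vnorm_max vnorm_max_ge0) => x y.
by rewrite (le_trans (vnorm_dist _ _))// vnorm_le.
Qed.

(** N is bounded below by its positive minimum on the compact unit sphere of the
    l1 norm; with [vnorm_le] this is the equivalence of norms. *)
Lemma vnorm_lower : exists2 c, 0 < c & forall x, mx1norm x <= c * N x.
Proof.
have [x0|nx0] := pselect (forall x : 'cV[R]_n, x = 0).
  by exists 1 => // x; rewrite (x0 x) /mx1norm big1 ?mul1r ?vnorm_ge0// => i _;
    rewrite big1// => j _; rewrite mxE normr0.
have /existsNP[z /eqP z0] := nx0.
pose S : set 'rV[R]_n := [set v | mx1norm v^T = 1].
pose f (v : 'rV[R]_n) := N v^T.
have l1_le (v : 'rV[R]_n) : mx1norm v^T <= n%:R * `|v|.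
  rewrite /mx1norm; under eq_bigr do rewrite big_ord1 mxE.
  rewrite mulr_natl -[X in _ *+ X]card_ord -sumr_const; apply: ler_sum => i _.
  rewrite -[leRHS]/(mx_norm v) mx_normrE.
  by apply/bigmax_geP; right => /=; exists (0, i).
have lip_cont (g : 'rV[R]_n -> R) (L : R) : 0 <= L ->
    (forall v w, `|g v - g w| <= L * mx1norm (v - w)^T) -> continuous g.
  move=> L0 lip v; have ? : Filter (nbhs v) by exact: (@nbhs_filter _ v).
  apply/cvgrPdist_le => e e0.
  pose K := L * n%:R + 1; have K0 : 0 < K by rewrite ltr_wpDl// mulr_ge0.
  near=> w.
  apply: (le_trans (lip v w)); apply: (@le_trans _ _ (L * (n%:R * `|v - w|))).
    by rewrite ler_wpM2l.
  rewrite mulrA (@le_trans _ _ (K * `|v - w|))//.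
    by rewrite ler_wpM2r// lerDl.
  rewrite -ler_pdivlMl// mulrC.
  near: w; apply: cvgr_dist_le; first exact: cvg_id.
  by rewrite divr_gt0.
have cf : continuous f.
  apply: (lip_cont _ vnorm_max vnorm_max_ge0) => v w.
  by rewrite (le_trans (vnorm_dist _ _))// linearB/= vnorm_le.
have cl1 : continuous (fun v : 'rV[R]_n => mx1norm v^T).
  apply: (lip_cont _ 1 ler01) => v w; rewrite mul1r.
  rewrite /mx1norm -sumrB (le_trans (ler_norm_sum _ _ _))//; apply: ler_sum => i _.
  by rewrite !big_ord1 !mxE ler_dist_dist.
have cS : compact S.
  apply: bounded_closed_compact.
    exists 1; split; first exact: num_real.
    move=> M M1 v Sv; apply: le_trans (ltW M1); rewrite -Sv.
    rewrite -[leLHS]/(mx_norm v) mx_normrE; apply/bigmax_leP; split.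
      exact: mx1norm_ge0.
    move=> [i j] _ /=; rewrite ord1.
    by have := mx1norm_entry v^T j 0; rewrite mxE.
  rewrite (_ : S = (fun v : 'rV[R]_n => mx1norm v^T) @^-1` [set 1])//.
  by apply: closed_comp; [move=> v _; exact: cl1|exact: closed_eq].
have mxZ a (x : 'cV[R]_n) : mx1norm (a *: x) = `|a| * mx1norm x.
  rewrite /mx1norm mulr_sumr; apply: eq_bigr => i _.
  by rewrite mulr_sumr; apply: eq_bigr => j _; rewrite mxE normrM.
have mx_gt0 (x : 'cV[R]_n) : x != 0 -> 0 < mx1norm x.
  move=> xn0; rewrite lt_neqAle mx1norm_ge0 andbT eq_sym; apply: contra xn0 => /eqP x0.
  apply/eqP/matrixP => i j; apply/eqP; rewrite mxE -normr_le0 -x0.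
  exact: mx1norm_entry.
have S1 (x : 'cV[R]_n) : x != 0 -> S ((mx1norm x)^-1 *: x)^T.
  move=> xn0; rewrite /S/= trmxK mxZ normfV ger0_norm ?mx1norm_ge0// mulVf//.
  by rewrite gt_eqF// mx_gt0.
have S0 : S !=set0 by eexists; exact: (S1 z).
have [v Sv minv] := EVT_min_rV S0 cS (continuous_subspaceT cf).
have fv0 : 0 < f v.
  rewrite lt_neqAle vnorm_ge0 andbT eq_sym; apply/eqP => fv0.
  have [_ _ /(_ _ fv0) v0] := hN.
  move: Sv; rewrite inE /S/= v0 /mx1norm big1 => [/esym/eqP|i _]; first by rewrite oner_eq0.
  by rewrite big1// => j _; rewrite mxE normr0.
exists (f v)^-1; first by rewrite invr_gt0.
move=> x; rewrite mulrC ler_pdivlMr//.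
have [->|xn0] := eqVneq x 0.
  by rewrite vnorm0 /mx1norm big1 ?mul0r// => i _; rewrite big1// => j _; rewrite mxE normr0.
have := minv _ (mem_set (S1 x xn0)); rewrite /f trmxK vnormZ normfV ger0_norm ?mx1norm_ge0//.
by rewrite -ler_pdivrMl ?invr_gt0 ?mx_gt0// invrK.
Unshelve. all: by end_near. Qed.

End vector_norm_theory.

Section operator_norm.
Variables (R : realType) (n : nat) (N : 'cV[R]_n -> R).
Hypothesis hN : vector_norm N.
Implicit Types (A B : 'M[R]_n) (x : 'cV[R]_n).

Lemma mx1normM A x : mx1norm (A *m x) <= mx1norm A * mx1norm x.
Proof.
rewrite /mx1norm mulr_suml; apply: ler_sum => i _; rewrite big_ord1 mxE.
rewrite (le_trans (ler_norm_sum _ _ _))// mulr_suml; apply: ler_sum => j _.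
by rewrite normrM ler_wpM2l//; exact: mx1norm_entry.
Qed.

Lemma vnorm_mulmx_le : exists2 K, 0 <= K &
  forall A x, N (A *m x) <= K * mx1norm A * N x.
Proof.
have [c c0 hc] := vnorm_lower hN.
have v0 := vnorm_max_ge0 hN.
exists (vnorm_max N * c); first by rewrite mulr_ge0// ltW.
move=> A x; rewrite (le_trans (vnorm_le hN _))// -!mulrA ler_wpM2l//.
rewrite mulrCA (le_trans (mx1normM _ _))// ler_wpM2l ?mx1norm_ge0//.
Qed.

Let image A := [set N (A *m x) | x in [set x | N x <= 1]].

Let image_ub A : has_sup (image A).
Proof.
have [K K0 hK] := vnorm_mulmx_le.
split; first by exists (N (A *m 0)), 0 => //=; rewrite (vnorm0 hN).
exists (K * mx1norm A) => _ [x /= Nx <-]; rewrite (le_trans (hK _ _))//.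
by rewrite ler_piMr// mulr_ge0// mx1norm_ge0.
Qed.

Lemma opnorm_le A K : 0 <= K -> (forall x, N (A *m x) <= K * N x) ->
  opnorm N A <= K.
Proof.
move=> K0 h; apply: ge_sup; first by case: (image_ub A).
by move=> _ [x /= Nx <-]; rewrite (le_trans (h x))// ler_piMr.
Qed.

Lemma opnorm_ge0 A : 0 <= opnorm N A.
Proof.
rewrite -(vnorm0 hN); apply: sup_upper_bound (image_ub A) _ _.
by exists 0; rewrite ?mulmx0//= (vnorm0 hN).
Qed.

Lemma opnorm_ub A x : N (A *m x) <= opnorm N A * N x.
Proof.
have [x0|xn0] := eqVneq (N x) 0.
  by rewrite x0 mulr0; have [_ _ /(_ _ x0) ->] := hN; rewrite mulmx0 (vnorm0 hN).
have x_gt0 : 0 < N x by rewrite lt_neqAle eq_sym xn0 (vnorm_ge0 hN).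
rewrite -ler_pdivrMr// mulrC; apply: sup_upper_bound (image_ub A) _ _.
exists ((N x)^-1 *: x) => /=.
  by rewrite (vnormZ hN) normfV ger0_norm ?(ltW x_gt0)// mulVf.
by rewrite -scalemxAr (vnormZ hN) normfV ger0_norm ?(ltW x_gt0).
Qed.

Lemma opnormM A B : opnorm N (A *m B) <= opnorm N A * opnorm N B.
Proof.
apply: opnorm_le => [|x]; first by rewrite mulr_ge0// opnorm_ge0.
rewrite -mulmxA (le_trans (opnorm_ub _ _))// -mulrA ler_wpM2l ?opnorm_ge0//.
exact: opnorm_ub.
Qed.

Lemma opnormD A B : opnorm N (A + B) <= opnorm N A + opnorm N B.
Proof.
apply: opnorm_le => [|x]; first by rewrite addr_ge0// opnorm_ge0.
by rewrite mulmxDl (le_trans (vnormD hN _ _))// mulrDl lerD// opnorm_ub.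
Qed.

Lemma opnormZ_le a A : opnorm N (a *: A) <= `|a| * opnorm N A.
Proof.
apply: opnorm_le => [|x]; first by rewrite mulr_ge0// opnorm_ge0.
by rewrite -scalemxAl (vnormZ hN) -mulrA ler_wpM2l// opnorm_ub.
Qed.

Lemma opnorm_mx1norm : exists2 K, 0 <= K & forall A, opnorm N A <= K * mx1norm A.
Proof.
have [K K0 hK] := vnorm_mulmx_le; exists K => // A.
by apply: opnorm_le => // ; rewrite mulr_ge0// mx1norm_ge0.
Qed.

Lemma measurable_opnorm : measurable_fun setT (opnorm N).
Proof.
have [K K0 hK] := opnorm_mx1norm; apply: (@measurable_lipschitz _ _ _ _ K K0) => A B.
have h C D : opnorm N C - opnorm N D <= K * mx1norm (C - D).
  by rewrite lerBlDr -{1}(subrK D C) (le_trans (opnormD _ _))// lerD2r.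
by rewrite ler_norml lerNl opprB mx1normB h mx1normB h.
Qed.

End operator_norm.

(** * Quadratic forms and the positive definite square root *)

Section quadratic_form.
Variables (R : realType) (n : nat).
Implicit Types (H S : 'M[R]_n) (x y : 'cV[R]_n).

Lemma dotC x y : dot x y = dot y x.
Proof. by rewrite !dotE; apply: eq_bigr => i _; rewrite mulrC. Qed.

Lemma dotDr x y z : dot x (y + z) = dot x y + dot x z.
Proof. by rewrite dotC dotDl !(dotC _ x). Qed.

Lemma dotBr x y z : dot x (y - z) = dot x y - dot x z.
Proof. by rewrite dotC dotBl !(dotC _ x). Qed.

Lemma dotZr a x y : dot x (a *: y) = a * dot x y.
Proof. by rewrite dotC dotZl dotC. Qed.

Lemma dot_ge0 x : 0 <= dot x x.
Proof. by rewrite dotE sumr_ge0// => i _; rewrite -expr2 sqr_ge0. Qed.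

Lemma dot_eq0 x : dot x x = 0 -> x = 0.
Proof.
rewrite dotE => /eqP; rewrite psumr_eq0 => [/allP h|i _]; last by rewrite -expr2 sqr_ge0.
apply/matrixP => i j; rewrite ord1 mxE; apply/eqP.
by have := h i (mem_index_enum _); rewrite mulf_eq0 orbb.
Qed.

Lemma dot_trmx H x y : dot x (H *m y) = dot (H^T *m x) y.
Proof. by rewrite /dot trmx_mul trmxK mulmxA. Qed.

Lemma quad_formE H x : quad_form H x = dot x (H *m x).
Proof. by rewrite /quad_form /dot mulmxA. Qed.

(** The discriminant argument: the form is nonnegative at x - t y for all t. *)
Lemma quad_cauchy_schwarz H x y : positive_semidefinite H ->
  dot x (H *m y) ^+ 2 <= quad_form H x * quad_form H y.
Proof.
move=> [sH pH]; rewrite !quad_formE.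
have hC : dot y (H *m x) = dot x (H *m y) by rewrite dot_trmx sH dotC.
set a := dot x _; set b := dot x _; set c := dot y _.
have q t : 0 <= b - 2 * t * a + t ^+ 2 * c.
  have := pH (x - t *: y); rewrite quad_formE mulmxBr -scalemxAr dotBl !dotBr !dotZl !dotZr.
  by rewrite hC -/a -/b -/c; congr (0 <= _); ring.
have c0 : 0 <= c by rewrite /c -quad_formE.
have b0 : 0 <= b by rewrite /b -quad_formE.
have [c00|cn0] := eqVneq c 0.
  rewrite c00 mulr0; have := q ((b + 1) / (2 * a)); rewrite c00 mulr0 addr0.
  have [->|an0] := eqVneq a 0; first by rewrite expr0n.
  have -> : b - 2 * ((b + 1) / (2 * a)) * a = -1 by field.
  lra.
have cgt : 0 < c by rewrite lt_neqAle eq_sym cn0.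
have := q (a / c); rewrite (_ : _ - _ + _ = (b * c - a ^+ 2) / c); last by field.
by rewrite pmulr_lge0 ?invr_gt0// subr_ge0.
Qed.

Lemma posdef_semidef H : positive_definite H -> positive_semidefinite H.
Proof.
move=> [sH pH]; split=> // x; have [->|/pH/ltW//] := eqVneq x 0.
by rewrite quad_formE dot0l.
Qed.

Lemma quad_form_norm H : positive_definite H ->
  vector_norm (fun x => Num.sqrt (quad_form H x)).
Proof.
move=> pH; have [sH p0] := posdef_semidef pH; split.
- move=> x y; rewrite -(@ler_pXn2r _ 2)// ?nnegrE ?sqrtr_ge0 ?addr_ge0 ?sqrtr_ge0//.
  rewrite sqrrD !sqr_sqrtr// !quad_formE mulmxDr dotDl !dotDr.
  have -> : dot y (H *m x) = dot x (H *m y) by rewrite dot_trmx sH dotC.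
  suff : dot x (H *m y) <= Num.sqrt (dot x (H *m x)) * Num.sqrt (dot y (H *m y)).
    rewrite mulr2n; lra.
  apply: le_trans (ler_norm _) _; rewrite -sqrtr_sqr -sqrtrM -?quad_formE//.
  by rewrite ler_wsqrtr// quad_cauchy_schwarz//; exact: posdef_semidef.
- move=> a x; rewrite quad_formE -scalemxAr dotZl dotZr mulrA -expr2.
  by rewrite sqrtrM ?sqr_ge0// sqrtr_sqr quad_formE.
- move=> x /eqP; rewrite sqrtr_eq0 => qx; apply/eqP; apply: contraTT qx => xn0.
  by rewrite -ltNge; exact: pH.2.
Qed.

Lemma posdef1 : positive_definite (1%:M : 'M[R]_n).
Proof.
split; first by rewrite trmx1.
move=> x xn0; rewrite quad_formE mul1mx lt_neqAle dot_ge0 andbT eq_sym.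
by apply: contra xn0 => /eqP/dot_eq0 ->.
Qed.

(** The square root of a positive definite form is a norm, so [vnorm_lower]
    bounds it below. *)
Lemma posdef_lower H : positive_definite H ->
  exists2 k, 0 < k & forall x, k * dot x x <= quad_form H x.
Proof.
move=> pH; have [c c0 hc] := vnorm_lower (quad_form_norm pH).
exists (c ^- 2); first by rewrite invr_gt0 exprn_gt0.
move=> x; rewrite ler_pdivrMl ?exprn_gt0//.
have q0 : 0 <= quad_form H x by exact: (posdef_semidef pH).2.
rewrite -(sqr_sqrtr q0) -exprMn; apply: (@le_trans _ _ (mx1norm x ^+ 2)).
  rewrite dotE expr2 {1}/mx1norm mulr_suml; apply: ler_sum => i _.
  rewrite big_ord1 (le_trans (ler_norm _))// normrM ler_wpM2l//.
  exact: mx1norm_entry.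
by rewrite ler_pXn2r ?nnegrE ?mx1norm_ge0 ?mulr_ge0 ?sqrtr_ge0 ?(ltW c0)//; exact: hc.
Qed.

Lemma quad_form_upper H x : quad_form H x <= mx1norm H * dot x x.
Proof.
rewrite quad_formE dotE /mx1norm mulr_suml; apply: ler_sum => i _.
rewrite mxE mulr_sumr mulr_suml; apply: ler_sum => j _.
apply: le_trans (ler_norm _) _; rewrite !normrM mulrCA ler_wpM2l//.
have e k : x k 0 ^+ 2 <= dot x x.
  rewrite dotE (bigD1 k)//= -expr2 lerDl sumr_ge0// => m _.
  by rewrite -expr2 sqr_ge0.
have := e i; have := e j.
rewrite -(real_normK (num_real (x i 0))) -(real_normK (num_real (x j 0))).
have := sqr_ge0 (`|x i 0| - `|x j 0|); nra.
Qed.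

(** With D := S - T one has S D = - D T, so the traces of D S D and D T D are
    opposite; both are nonnegative, hence zero, and S D = 0 forces D = 0. *)
Lemma sqrt_unique S T : positive_definite S -> positive_semidefinite T ->
  S *m S = T *m T -> S = T.
Proof.
move=> pS [sT pT] eST; have [sS _] := pS.
pose D := S - T.
have sD : D^T = D by rewrite linearB/= sS sT.
have SD : S *m D = - (D *m T).
  by rewrite /D mulmxBr mulmxBl opprB eST.
have tr_form (A : 'M[R]_n) : \tr (D *m A *m D) = \sum_i quad_form A (col i D).
  apply: eq_bigr => i _; rewrite /quad_form.
  by rewrite tr_col sD -row_mul -row_mul !mxE; apply: eq_bigr => j _; rewrite !mxE.
have e : \tr (D *m S *m D) = - \tr (D *m T *m D).
  by rewrite -mulmxA SD mulmxN linearN/= [in RHS]mxtrace_mulC.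
have [S0|] := pselect (forall i, quad_form S (col i D) = 0).
  apply/eqP; rewrite -subr_eq0 -/D; apply/eqP/matrixP => i j; rewrite mxE.
  have : col j D = 0.
    by apply/eqP; apply: contraT => /pS.2; rewrite S0 ltxx.
  by move=> /matrixP/(_ i 0); rewrite !mxE.
move=> /existsNP[i /eqP Si]; exfalso.
have pS' := (posdef_semidef pS).2.
have : 0 < \tr (D *m S *m D).
  rewrite tr_form (bigD1 i)//= ltr_pwDl ?sumr_ge0// lt_neqAle eq_sym Si.
  exact: pS'.
by rewrite e oppr_gt0 ltNge tr_form sumr_ge0.
Qed.

End quadratic_form.

Section geometric_convergence.
Variable R : realType.

Lemma geometric_cvg (u : nat -> R) (K r : R) : 0 <= r < 1 ->
  (forall k, `|u k.+1 - u k| <= K * r ^+ k) -> cvgn u.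
Proof.
move=> /andP[r0 r1] hu.
have cs : cvgn (series (fun k => u k.+1 - u k)).
  apply: normed_cvg; apply: (series_le_cvg (v_ := geometric K r)) => //.
  - by move=> k /=.
  - by move=> k; apply: le_trans (hu k).
  - by apply: is_cvg_geometric_series; rewrite ger0_norm.
have -> : u = (fun k => u 0%N + series (fun k => u k.+1 - u k) k).
  by apply/funext => k; rewrite /series/= telescope_sumr// addrC subrK.
by apply: is_cvgD => //; exact: is_cvg_cst.
Qed.

Lemma cvg_finite_sum (I : Type) (s : seq I) (u : I -> nat -> R) (l : I -> R) :
  (forall i, u i k @[k --> \oo] --> l i) ->
  \sum_(i <- s) u i k @[k --> \oo] --> \sum_(i <- s) l i.
Proof.
move=> ul; elim: s => [|i s IH].
  by under eq_fun do rewrite big_nil; rewrite big_nil; exact: cvg_cst.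
under eq_fun do rewrite big_cons; rewrite big_cons.
exact: cvgD (ul i) IH.
Qed.

End geometric_convergence.

Section square_root.
Variables (R : realType) (n : nat).
Implicit Types (H B Y S : 'M[R]_n) (x y : 'cV[R]_n).

Definition norm2 x : R := Num.sqrt (quad_form 1%:M x).

Lemma norm2_norm : vector_norm norm2.
Proof. exact: quad_form_norm (posdef1 _ _). Qed.

Lemma norm2_ge0 x : 0 <= norm2 x. Proof. exact: sqrtr_ge0. Qed.

Lemma norm2_sqr x : norm2 x ^+ 2 = dot x x.
Proof. by rewrite /norm2 quad_formE mul1mx sqr_sqrtr ?dot_ge0. Qed.

Lemma dot_norm2 x y : `|dot x y| <= norm2 x * norm2 y.
Proof.
rewrite -sqrtr_sqr /norm2 -sqrtrM; last by rewrite quad_formE mul1mx dot_ge0.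
rewrite ler_wsqrtr//; have := quad_cauchy_schwarz x y (posdef_semidef (posdef1 R n)).
by rewrite mul1mx.
Qed.

Lemma entry_opnorm Y i j : `|Y i j| <= opnorm norm2 Y.
Proof.
have -> : Y i j = dot (delta_mx i 0) (Y *m delta_mx j 0).
  by rewrite dot_delta -colE mxE.
have nd (k : 'I_n) : norm2 (delta_mx k 0) = 1.
  by rewrite /norm2 quad_formE mul1mx dot_delta mxE !eqxx sqrtr1.
rewrite (le_trans (dot_norm2 _ _))// nd mul1r.
by have := opnorm_ub norm2_norm Y (delta_mx j 0); rewrite nd mulr1.
Qed.

(** Polarization: with y = B x, the value of the form at (|y| / |x|) x + y minus
    its value at (|y| / |x|) x - y is 4 |y|^3 / |x|, while the bound and the
    parallelogram identity give at most 4 r |y|^2. *)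
Lemma opnorm_symmetric B (r : R) : 0 <= r -> B^T = B ->
  (forall x, `|quad_form B x| <= r * dot x x) -> opnorm norm2 B <= r.
Proof.
move=> r0 sB hB; apply: (opnorm_le norm2_norm) => // x.
have [->|y0] := eqVneq (B *m x) 0.
  by rewrite (vnorm0 norm2_norm) mulr_ge0// norm2_ge0.
set y := B *m x in y0 *.
have a0 : 0 < norm2 y.
  rewrite lt_neqAle norm2_ge0 andbT eq_sym; apply: contra y0 => /eqP y00.
  by have [_ _ /(_ _ y00) ->] := norm2_norm.
set a := norm2 y in a0 *; set b := norm2 x.
have b0 : 0 < b.
  rewrite lt_neqAle norm2_ge0 andbT eq_sym; apply: contra y0 => /eqP b00.
  by have [_ _ /(_ _ b00) x0] := norm2_norm; rewrite /y x0 mulmx0.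
have aE : dot y y = a ^+ 2 by rewrite -norm2_sqr.
have bE : dot x x = b ^+ 2 by rewrite -norm2_sqr.
have pol u v : quad_form B (u + v) - quad_form B (u - v) = 4 * dot v (B *m u).
  rewrite !quad_formE mulmxBr mulmxDr !dotBl !dotBr !dotDl !dotDr.
  have -> : dot u (B *m v) = dot v (B *m u) by rewrite dot_trmx sB dotC.
  by ring.
have := pol ((a / b) *: x) y; rewrite -scalemxAr dotZr -/y aE => e.
have h1 := hB ((a / b) *: x + y); have h2 := hB ((a / b) *: x - y).
have e1 : dot ((a / b) *: x + y) ((a / b) *: x + y) +
   dot ((a / b) *: x - y) ((a / b) *: x - y) = 4 * a ^+ 2.
  rewrite !dotBl !dotBr !dotDl !dotDr !dotZl !dotZr aE bE.
  by rewrite (_ : a / b * (a / b * b ^+ 2) = a ^+ 2); [ring|field; rewrite gt_eqF].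
have h : 4 * (a / b * a ^+ 2) <= r * (4 * a ^+ 2).
  rewrite -e -e1 mulrDr; apply: le_trans (ler_norm _) _.
  by rewrite (le_trans (ler_normB _ _))// lerD.
have a20 : 0 < a ^+ 2 by rewrite exprn_gt0.
rewrite -ler_pdivrMr// -(ler_pM2r a20).
by move: h; lra.
Qed.

(** The limit Y solves Y = (B + Y^2) / 2, that is (1 - Y)^2 = 1 - B. This
    iteration gives the square root as a limit of polynomials, whence both its
    existence and its measurable dependence on the matrix. *)
Fixpoint sqrt_iter B k : 'M[R]_n :=
  if k is k'.+1 then 2^-1 *: (B + sqrt_iter B k' *m sqrt_iter B k') else 0.

Section iteration.
Variables (B : 'M[R]_n) (r : R).
Hypothesis r01 : 0 <= r < 1.
Hypothesis Br : opnorm norm2 B <= r.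

Let rho : R := (1 + r) / 2.

Let rho01 : 0 <= rho < 1. Proof. by have /andP[? ?] := r01; rewrite /rho; lra. Qed.

Let op := opnorm norm2.

Let iter_bound k : op (sqrt_iter B k) <= rho.
Proof.
elim: k => [|k IH] /=.
  have /andP[rho0 _] := rho01; apply: (opnorm_le norm2_norm) => // x.
  by rewrite mul0mx (vnorm0 norm2_norm) mulr_ge0// norm2_ge0.
rewrite (le_trans (opnormZ_le norm2_norm _ _))// ger0_norm//.
have h1 := opnormD norm2_norm B (sqrt_iter B k *m sqrt_iter B k).
have h2 := opnormM norm2_norm (sqrt_iter B k) (sqrt_iter B k).
have h3 := opnorm_ge0 norm2_norm (sqrt_iter B k).
have h4 : op (sqrt_iter B k) * op (sqrt_iter B k) <= rho * rho by apply: ler_pM.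
have h5 : r + rho * rho <= 2 * rho by have /andP[? ?] := r01; rewrite /rho; nra.
by rewrite ler_pdivrMl//; move: h1 h2 h4 Br h5; rewrite -/op; lra.
Qed.

(* On the ball of radius rho the map Y |-> (B + Y^2) / 2 is a contraction of
   ratio rho, because X^2 - Y^2 = X (X - Y) + (X - Y) Y. *)
Let iter_step k : op (sqrt_iter B k.+1 - sqrt_iter B k) <= rho ^+ k.
Proof.
elim: k => [|k IH].
  rewrite subr0 expr0 (le_trans (iter_bound 1))// ltW//.
  by case/andP: rho01.
set Y' := sqrt_iter B k.+1 in IH *; set Y := sqrt_iter B k in IH *.
have -> : sqrt_iter B k.+2 - Y' = 2^-1 *: (Y' *m (Y' - Y) + (Y' - Y) *m Y).
  rewrite [in LHS]/= -/Y' {2}/Y'/= -/Y -scalerBr; congr (_ *: _).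
  rewrite mulmxBr mulmxBl addrA subrK.
  by rewrite opprD addrACA subrr add0r.
rewrite (le_trans (opnormZ_le norm2_norm _ _))// ger0_norm//.
have h1 := opnormD norm2_norm (Y' *m (Y' - Y)) ((Y' - Y) *m Y).
have h2 := opnormM norm2_norm Y' (Y' - Y).
have h3 := opnormM norm2_norm (Y' - Y) Y.
have p1 := opnorm_ge0 norm2_norm Y'; have p2 := opnorm_ge0 norm2_norm Y.
have p3 := opnorm_ge0 norm2_norm (Y' - Y).
have b1 : op Y' <= rho := iter_bound k.+1; have b2 : op Y <= rho := iter_bound k.
have h4 : op Y' * op (Y' - Y) <= rho * rho ^+ k by apply: ler_pM.
have h5 : op (Y' - Y) * op Y <= rho ^+ k * rho by apply: ler_pM.
rewrite exprS ler_pdivrMl//; move: h1 h2 h3 h4 h5; rewrite -/op; lra.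
Qed.

Lemma sqrt_iter_cvg i j : cvgn (fun k => sqrt_iter B k i j).
Proof.
apply: (geometric_cvg (K := 1) rho01) => k; rewrite mul1r.
apply: le_trans (iter_step k); have := entry_opnorm (sqrt_iter B k.+1 - sqrt_iter B k) i j.
by rewrite !mxE.
Qed.

Definition sqrt_iter_lim : 'M[R]_n := \matrix_(i, j) limn (fun k => sqrt_iter B k i j).

Let lim_cvg i j : sqrt_iter B k i j @[k --> \oo] --> sqrt_iter_lim i j.
Proof. by rewrite mxE; exact: sqrt_iter_cvg. Qed.

Let lim_eq : 2 *: sqrt_iter_lim = B + sqrt_iter_lim *m sqrt_iter_lim.
Proof.
apply/matrixP => i j; rewrite [LHS]mxE [RHS]mxE [X in _ = _ + X]mxE.
have h1 : 2 * sqrt_iter B k.+1 i j @[k --> \oo] --> 2 * sqrt_iter_lim i j.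
  apply: cvgM; first exact: cvg_cst.
  by move: (@lim_cvg i j); rewrite -(cvg_shiftS (fun k => sqrt_iter B k i j)).
have h2 : B i j + \sum_l sqrt_iter B k i l * sqrt_iter B k l j @[k --> \oo] -->
    B i j + \sum_l sqrt_iter_lim i l * sqrt_iter_lim l j.
  apply: cvgD; first exact: cvg_cst.
  by apply: cvg_finite_sum => l; apply: cvgM; exact: lim_cvg.
have e : (fun k => 2 * sqrt_iter B k.+1 i j) =
    (fun k => B i j + \sum_l sqrt_iter B k i l * sqrt_iter B k l j).
  apply/funext => k /=; rewrite !mxE mulrA divff ?mul1r//.
by rewrite e in h1; exact: cvg_unique _ h1 h2.
Qed.

Lemma sqrt_lim_sqr : (1%:M - sqrt_iter_lim) *m (1%:M - sqrt_iter_lim) = 1%:M - B.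
Proof.
rewrite mulmxBl mul1mx mulmxBr mulmx1 opprB addrA.
have -> : sqrt_iter_lim *m sqrt_iter_lim = 2 *: sqrt_iter_lim - B by rewrite lim_eq addrC addKr.
by move: sqrt_iter_lim => Y; apply/matrixP => i j; rewrite !mxE; ring.
Qed.

Lemma sqrt_lim_sym : B^T = B -> sqrt_iter_lim^T = sqrt_iter_lim.
Proof.
move=> sB; apply/matrixP => i j; rewrite !mxE; congr (limn _); apply/funext => k.
have : (sqrt_iter B k)^T = sqrt_iter B k.
  elim: k => [|k IH] /=; first by rewrite trmx0.
  by rewrite linearZ/= linearD/= trmx_mul IH sB.
by move=> /matrixP/(_ i j); rewrite mxE.
Qed.

Lemma sqrt_lim_posdef : B^T = B -> positive_definite (1%:M - sqrt_iter_lim).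
Proof.
move=> sB; split; first by rewrite linearB/= trmx1 sqrt_lim_sym.
move=> x xn0.
have x0 : 0 < dot x x by have := (posdef1 R n).2 x xn0; rewrite quad_formE mul1mx.
rewrite quad_formE mulmxBl mul1mx dotBr subr_gt0.
apply: (@le_lt_trans _ _ (rho * dot x x)); last first.
  by rewrite gtr_pMl//; case/andP: rho01.
have cv : dot x (sqrt_iter B k *m x) @[k --> \oo] --> dot x (sqrt_iter_lim *m x).
  have dE Y : dot x (Y *m x) = \sum_i x i 0 * \sum_l Y i l * x l 0.
    by rewrite dotE; apply: eq_bigr => i _; rewrite mxE.
  rewrite dE (_ : (fun k => _) = fun k => \sum_i x i 0 * \sum_l sqrt_iter B k i l * x l 0).
    apply: cvg_finite_sum => i; apply: cvgM; first exact: cvg_cst.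
    apply: cvg_finite_sum => l; apply: cvgM; last exact: cvg_cst.
    exact: lim_cvg.
  by apply/funext => k; rewrite dE.
rewrite -(cvg_lim _ cv)//; apply: limr_le; first by apply/cvg_ex; eexists; exact: cv.
apply: nearW => k.
rewrite (le_trans (ler_norm _))// (le_trans (dot_norm2 _ _))//.
rewrite -norm2_sqr expr2 mulrCA ler_wpM2l ?norm2_ge0//.
rewrite (le_trans (opnorm_ub norm2_norm _ _))// ler_wpM2r ?norm2_ge0//.
Qed.

End iteration.

(** For H positive definite and c at least the norm of H, B = 1 - H / c has norm
    less than 1, and sqrt c (1 - Y) is the square root of H. *)
Definition sqrt_scale H : R := mx1norm H + 1.

Let Bof H := 1%:M - (sqrt_scale H)^-1 *: H.

Lemma sqrtmx_lim H : positive_definite H ->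
  [/\ forall i j, cvgn (fun k => sqrt_iter (Bof H) k i j),
     sqrtmx H = Num.sqrt (sqrt_scale H) *: (1%:M - sqrt_iter_lim (Bof H)),
     positive_definite (sqrtmx H) & sqrtmx H *m sqrtmx H = H].
Proof.
move=> pH; have [sH _] := pH; set c := sqrt_scale H.
have c0 : 0 < c by rewrite ltr_wpDl// mx1norm_ge0.
have sB : (Bof H)^T = Bof H by rewrite /Bof linearB/= trmx1 linearZ/= sH.
have [k k0 hk] := posdef_lower pH.
pose k' := Num.min k 1.
have k'0 : 0 < k' by rewrite lt_min k0 ltr01.
have k'c : k' <= c.
  by rewrite (@le_trans _ _ 1)// ?ge_min ?lexx ?orbT// lerDr mx1norm_ge0.
pose r := 1 - k' / c.
have r01 : 0 <= r < 1.
  by rewrite subr_ge0 ler_pdivrMr// mul1r k'c gtrBl divr_gt0.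
have Br : opnorm norm2 (Bof H) <= r.
  apply: opnorm_symmetric => // [|x]; first by case/andP: r01.
  have e : quad_form (Bof H) x = dot x x - c^-1 * quad_form H x.
    by rewrite !quad_formE /Bof mulmxBl mul1mx -scalemxAl dotBr dotZr.
  have up := quad_form_upper H x; have lo := hk x; have d0 := dot_ge0 x.
  have lo' : k' * dot x x <= quad_form H x.
    by rewrite (le_trans _ lo)// ler_wpM2r// ge_min lexx.
  rewrite e ger0_norm.
    rewrite /r mulrBl mul1r lerD2l lerN2 mulrAC [_ * c^-1]mulrC.
    by rewrite ler_wpM2l// invr_ge0 ltW.
  rewrite subr_ge0 ler_pdivrMl//; apply: le_trans up _.
  by rewrite ler_wpM2r// lerDl.
set S := Num.sqrt c *: (1%:M - sqrt_iter_lim (Bof H)).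
have pS : positive_definite S.
  have [s1 p1] := sqrt_lim_posdef r01 Br sB; split; first by rewrite linearZ/= s1.
  move=> x xn0; rewrite quad_formE -scalemxAl dotZr -quad_formE mulr_gt0 ?p1//.
  by rewrite sqrtr_gt0.
have SS : S *m S = H.
  rewrite -scalemxAl -scalemxAr scalerA -expr2 sqr_sqrtr ?(ltW c0)//.
  rewrite (sqrt_lim_sqr r01 Br) /Bof opprB addrCA subrr addr0.
  by rewrite scalerA divff ?gt_eqF// scale1r.
have e : sqrtmx H = S.
  have [pT TT] : [set S | positive_semidefinite S /\ S *m S = H] (sqrtmx H).
    by apply: xgetPex; exists S; split => //; exact: posdef_semidef.
  by apply/esym/sqrt_unique => //; rewrite SS TT.
split; rewrite ?e//; move=> i j; exact: sqrt_iter_cvg r01 Br i j.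
Qed.

Lemma sqrtmx_posdef H : positive_definite H -> positive_definite (sqrtmx H).
Proof. by case/sqrtmx_lim. Qed.

Lemma sqrtmx_sqr H : positive_definite H -> sqrtmx H *m sqrtmx H = H.
Proof. by case/sqrtmx_lim. Qed.

Lemma posdef_unit H : positive_definite H -> H \in unitmx.
Proof.
move=> pH; rewrite -row_free_unit -kermx_eq0; apply/eqP.
apply/row_matrixP => i; rewrite row0; set v := row i _.
have vH : v *m H = 0 by rewrite -row_mul mulmx_ker row0.
apply: (can_inj trmxK); rewrite trmx0; apply/eqP; apply: contraT => /pH.2.
by rewrite /quad_form trmxK vH mul0mx mxE ltxx.
Qed.

Lemma measurable_sqrtmx d (Omega : measurableType d) (H : Omega -> 'M[R]_n) :
  measurable_fun setT H -> (forall w, positive_definite (H w)) ->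
  measurable_fun setT (fun w => sqrtmx (H w)).
Proof.
move=> mH pH.
have mc : measurable_fun setT (fun w => sqrt_scale (H w)).
  apply: measurable_funD => //; exact: (measurableT_comp (@measurable_mx1norm _ _ _)).
have mcV : measurable_fun setT (fun w => (sqrt_scale (H w))^-1).
  rewrite (_ : (fun w => _) = fun w => (sqrt_scale (H w)) `^ (-1)).
    exact: (measurableT_comp (measurable_powR (-1)) mc).
  by apply/funext => w; rewrite powR_inv1// addr_ge0// mx1norm_ge0.
have mB : measurable_fun setT (fun w => Bof (H w)).
  rewrite /Bof; under eq_fun do rewrite -scaleNr.
  apply: measurable_addmx => //; apply: measurable_scalemx => //.
  exact: measurable_funN.
have mI k : measurable_fun setT (fun w => sqrt_iter (Bof (H w)) k).
  elim: k => [|k IH] /=; first exact: measurable_cst.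
  apply: measurable_scalemx => //; apply: measurable_addmx => //.
  exact: measurable_mulmx.
have -> : (fun w => sqrtmx (H w)) = (fun w => Num.sqrt (sqrt_scale (H w)) *:
    (1%:M + (-1) *: sqrt_iter_lim (Bof (H w)))).
  apply/funext => w; have [_ -> _ _] := sqrtmx_lim (pH w).
  by rewrite scaleN1r.
apply: measurable_scalemx; first by apply: (measurableT_comp _ mc); exact: (continuous_measurable_fun (@sqrt_continuous R)).
apply: measurable_addmx => //; apply: measurable_scalemx => //.
apply: measurable_mx => i j; under eq_fun do rewrite mxE.
apply: (measurable_fun_cvg (h := fun k w => sqrt_iter (Bof (H w)) k i j)).
  by move=> k; exact: measurable_mxP.
by move=> w _; have [] := sqrtmx_lim (pH w).
Qed.

End square_root.

Section inverse_matrix.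
Context d (Omega : measurableType d) (R : realType).

Lemma measurable_det n (f : Omega -> 'M[R]_n) : measurable_fun setT f ->
  measurable_fun setT (fun w => \det (f w)).
Proof.
move=> mf; rewrite /determinant; apply: measurable_sum => s.
apply: measurable_funM => //; apply: measurable_prod => i _.
exact: measurable_mxP.
Qed.

(** Since 0^-1 = 0, x^-1 = x |x|^-2 holds for every x, and the powers of |x| are
    measurable. *)
Lemma measurable_realV (f : Omega -> R) : measurable_fun setT f ->
  measurable_fun setT (fun w => (f w)^-1).
Proof.
move=> mf; rewrite (_ : (fun w => _) = fun w => f w * (`|f w| `^ (-1)) ^+ 2).
  apply: measurable_funM => //; apply: measurable_funX.
  apply: (measurableT_comp (measurable_powR (-1))).
  exact: measurableT_comp mf.
apply/funext => w; rewrite powR_inv1// exprVn real_normK ?num_real//.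
have [->|f0] := eqVneq (f w) 0; first by rewrite invr0 mul0r.
by field.
Qed.

Lemma measurable_invmx n (f : Omega -> 'M[R]_n) : measurable_fun setT f ->
  (forall w, f w \in unitmx) -> measurable_fun setT (fun w => invmx (f w)).
Proof.
move=> mf uf; under eq_fun do rewrite /invmx uf.
apply: measurable_scalemx; first exact/measurable_realV/measurable_det.
apply: measurable_mx => i j; under eq_fun do rewrite mxE.
rewrite /cofactor; apply: measurable_funM => //; apply: measurable_det.
apply: measurable_mx => a b; under eq_fun do rewrite !mxE.
exact: measurable_mxP.
Qed.

End inverse_matrix.

(** * Independence and laws of paths *)

Section law.
Context d d' (T : measurableType d) (T' : measurableType d') (R : realType).
Variables (P : probability T R) (X : T -> T').
Hypothesis mX : measurable_fun setT X.

Definition law : probability T' R := distribution P (mfun_Sub (mem_set mX)).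

Lemma lawE A : law A = P (X @^-1` A). Proof. by []. Qed.

Lemma integral_law (f : T' -> \bar R) :
  measurable_fun setT f -> (forall y, 0 <= f y)%E ->
  (\int[law]_y f y = \int[P]_x f (X x))%E.
Proof. by move=> mf f0; exact: (@ge0_integral_distribution _ _ _ _ R P (mfun_Sub (mem_set mX)) f). Qed.

End law.

Section measure_agree.
Context d (T : measurableType d) (R : realType).
Variables (m1 m2 : {measure set T -> \bar R}) (G : set (set T)).
Hypothesis Gm : G `<=` measurable.
Hypothesis GI : setI_closed G.
Hypothesis GT : G setT.
Hypothesis fin : (m1 setT < +oo)%E.
Hypothesis m12 : forall A, G A -> m1 A = m2 A.

Lemma measure_agree A : <<s G >> A -> m1 A = m2 A.
Proof.
move=> GA; apply: (@g_sigma_algebra_measure_unique _ _ _ G Gm (fun=> setT)) => //.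
by apply/seteqP; split => // x _; exists 0%N.
Qed.

End measure_agree.

Section independence_theory.
Context d (Omega : measurableType d) (R : realType) (P : probability Omega R).

Lemma independent_sub (F G F' G' : set (set Omega)) :
  F' `<=` F -> G' `<=` G -> independent P F G -> independent P F' G'.
Proof. by move=> FF GG i A B /FF FA /GG GB; exact: i. Qed.

Lemma independent_sym (F G : set (set Omega)) :
  independent P F G -> independent P G F.
Proof. by move=> i A B GA FB; rewrite setIC muleC; exact: i. Qed.

Let gm (G : set (set Omega)) : G `<=` measurable -> <<s G >> `<=` measurable.
Proof.
by move=> Gm; apply: smallest_sub => //; exact: sigma_algebra_measurable.
Qed.

(** For B in G, both sides are finite measures of A and agree on the pi-system
    F. *)
Lemma independent_g_sigmal (F G : set (set Omega)) :
  F `<=` measurable -> G `<=` measurable -> setI_closed F -> F setT ->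
  independent P F G -> independent P <<s F >> G.
Proof.
move=> Fm Gm FI FT iFG A B FA GB.
have mB := Gm _ GB.
pose p : {nonneg R} := NngNum (fine_ge0 (measure_ge0 P B)).
have -> : (P A * P B = mscale p P A)%E.
  by rewrite /mscale/= fineK ?fin_num_measure// muleC.
rewrite -/(mrestr P mB A).
apply: (@measure_agree _ _ _ (mrestr P mB) _ F) => //.
- by rewrite /= /mrestr setTI ltey_eq fin_num_measure.
- move=> C FC; rewrite /= /mrestr /mscale/= fineK ?fin_num_measure//.
  by rewrite iFG// muleC.
Qed.

Lemma independent_g_sigma (F G : set (set Omega)) :
  F `<=` measurable -> G `<=` measurable ->
  setI_closed F -> setI_closed G -> F setT -> G setT ->
  independent P F G -> independent P <<s F >> <<s G >>.
Proof.
move=> Fm Gm FI GI FT GT iFG.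
apply: independent_g_sigmal => //; first exact: gm.
apply: independent_sym; apply: independent_g_sigmal => //.
exact: independent_sym.
Qed.

End independence_theory.

Section independent_laws.
Context d d1 d2 (Omega : measurableType d) (T1 : measurableType d1)
  (T2 : measurableType d2) (R : realType) (P : probability Omega R).
Variables (X : Omega -> T1) (Y : Omega -> T2).
Hypothesis mX : measurable_fun setT X.
Hypothesis mY : measurable_fun setT Y.
Hypothesis iXY : independent P (g_sigma_algebra_preimage X)
  (g_sigma_algebra_preimage Y).

Let mXY : measurable_fun setT (fun w => (X w, Y w)).
Proof. exact: measurable_fun_pair. Qed.

Lemma independent_joint_law (E : set (T1 * T2)) : measurable E ->
  P [set w | E (X w, Y w)] = (law P mX \x law P mY)%E E.
Proof.
move=> mE; apply/esym.
rewrite -[RHS]/(law P mXY E).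
apply: product_measure_unique => // A B mA mB.
apply: (iXY (A := X @^-1` A) (B := Y @^-1` B)).
- by exists A => //; rewrite setTI.
- by exists B => //; rewrite setTI.
Qed.

Lemma independent_integral (f : T1 * T2 -> \bar R) :
  measurable_fun setT f -> (forall z, 0 <= f z)%E ->
  (\int[P]_w f (X w, Y w) = \int[law P mX]_x \int[law P mY]_y f (x, y))%E.
Proof.
move=> mf f0.
rewrite -(fubini_tonelli1 _ mf f0) -(integral_law _ mXY mf f0).
apply: eq_measure_integral => /= A mA _.
exact: independent_joint_law.
Qed.

Lemma independent_integralM (f : T1 -> \bar R) (g : T2 -> \bar R) :
  measurable_fun setT f -> measurable_fun setT g ->
  (forall x, 0 <= f x)%E -> (forall y, 0 <= g y)%E ->
  (\int[P]_w (f (X w) * g (Y w)) =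
   (\int[P]_w f (X w)) * (\int[P]_w g (Y w)))%E.
Proof.
move=> mf mg f0 g0.
rewrite (@independent_integral (fun z => f z.1 * g z.2)%E); last 2 first.
- apply: emeasurable_funM.
    exact: (measurableT_comp mf measurable_fst).
  exact: (measurableT_comp mg measurable_snd).
- by move=> z; exact: mule_ge0.
rewrite -(integral_law P mX mf f0) -(integral_law P mY mg g0).
rewrite -ge0_integralZr//; last exact: integral_ge0.
by apply: eq_integral => x _ /=; rewrite ge0_integralZl.
Qed.

End independent_laws.

(** If h(x, Y) has the same law mu for every fixed x, then h(X, Y) has law mu and
    is independent of X: integrate first over Y. *)
Lemma independent_conditional_law d d1 d2 d3 (Omega : measurableType d)
    (T1 : measurableType d1) (T2 : measurableType d2) (S : measurableType d3)
    (R : realType) (P : probability Omega R) (X : Omega -> T1) (Y : Omega -> T2)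
    (h : T1 * T2 -> S) (mu : set S -> \bar R) :
  measurable_fun setT X -> measurable_fun setT Y -> measurable_fun setT h ->
  independent P (g_sigma_algebra_preimage X) (g_sigma_algebra_preimage Y) ->
  (forall x E, measurable E -> P [set w | E (h (x, Y w))] = mu E) ->
  forall E F, measurable E -> measurable F ->
  P [set w | E (h (X w, Y w)) /\ F (X w)] = (mu E * P (X @^-1` F))%E.
Proof.
move=> mX mY mh iXY hmu E F mE mF.
pose A : set (T1 * T2) := (h @^-1` E) `&` (fst @^-1` F).
have mA : measurable A.
  apply: measurableI; first by rewrite -[X in measurable X]setTI; exact: mh.
  by rewrite -[X in measurable X]setTI; exact: measurable_fst.
have m0 : (0 <= mu E)%E by rewrite -(hmu point E mE).
transitivity (\int[P]_w (\1_A (X w, Y w))%:E)%E.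
  rewrite -[LHS]/(P ((fun w => (X w, Y w)) @^-1` A)).
  rewrite -[in LHS](setIT (_ @^-1` _)) -integral_indic//.
  by rewrite -[X in measurable X]setTI; exact: measurable_fun_pair.
rewrite (independent_integral mX mY iXY (f := fun z => (\1_A z)%:E)); last 2 first.
- by apply/measurable_EFinP; exact: measurable_indic.
- by move=> z; rewrite lee_fin.
transitivity (\int[law P mX]_x (mu E * (\1_F x)%:E))%E.
  apply: eq_integral => x _.
  have [Fx|Fx] := pselect (F x).
    rewrite [\1_F x]indicE mem_set// mule1 -(hmu x E mE).
    rewrite -[RHS]/(law P mY [set y | E (h (x, y))]).
    rewrite -[in RHS](setIT [set y | _]) -integral_indic//.
      apply: eq_integral => y _; rewrite !indicE; congr (_%:R%:E).
      congr nat_of_bool; apply/idP/idP; first by move=> /set_mem[Eh _]; apply/mem_set.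
      by move=> /set_mem Eh; apply/mem_set.
    rewrite -[X in measurable X]setTI.
    have mhx : measurable_fun setT (fun y => h (x, y)).
      by apply: (measurableT_comp mh); exact: measurable_fun_pair.
    exact: mhx.
  rewrite [\1_F x]indicE memNset// mule0.
  apply: integral0_eq => y _; rewrite indicE memNset// => -[_]; exact: Fx.
rewrite ge0_integralZl//; last first.
- by apply/measurable_EFinP; exact: measurable_indic.
by rewrite integral_indic// setIT.
Qed.

Section rectangles.
Context (I : choiceType) (Omega : Type) d' (T : measurableType d').
Variable Y : I -> Omega -> T.
Implicit Types (J : set I) (E : I -> set T).

(** Cylinder sets; those of finite base inside J form a pi-system that generates
    the sigma-algebra of the variables indexed by J. *)
Definition rect E : set Omega := [set w | forall i, E i (Y i w)].

Definition rect_base J E := (forall i, measurable (E i)) /\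
  exists s : seq I, [/\ uniq s, forall i, i \in s -> J i
                     & forall i, i \notin s -> E i = setT].

Definition rects J : set (set Omega) := [set rect E | E in rect_base J].

Lemma rectI E F : rect E `&` rect F = rect (fun i => E i `&` F i).
Proof.
by apply/seteqP; split => w /= => [[h1 h2] i//|h]; split => i; case: (h i).
Qed.

Lemma rects_setI J : setI_closed (rects J).
Proof.
move=> _ _ [E [mE [s [us sJ sE]]] <-] [F [mF [r [ur rJ rF]]] <-].
exists (fun i => E i `&` F i); last by rewrite rectI.
split; first by move=> i; exact: measurableI.
exists (undup (s ++ r)); split; first exact: undup_uniq.
  by move=> i; rewrite mem_undup mem_cat => /orP[/sJ|/rJ].
by move=> i; rewrite mem_undup mem_cat negb_or => /andP[/sE-> /rF->]; rewrite setTI.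
Qed.

Lemma rects_setT J : rects J setT.
Proof.
exists (fun=> setT); last by apply/seteqP; split.
by split => //; exists [::].
Qed.

Lemma rect_bigcap E (s : seq I) : (forall i, i \notin s -> E i = setT) ->
  rect E = \bigcap_(i in [set` s]) (Y i @^-1` E i).
Proof.
move=> sE; apply/seteqP; split => w /= h i; first by move=> _; exact: h.
by have [/h//|/sE->] := boolP (i \in s).
Qed.

End rectangles.

Lemma g_sigma_family_rects (I : choiceType) (Omega : pointedType) d'
    (T : measurableType d') (Y : I -> Omega -> T) (J : set I) :
  g_sigma_family (fun j : {i | J i} => Y (sval j)) = <<s rects Y J >>.
Proof.
apply/seteqP; split.
  apply: smallest_sub; first exact: smallest_sigma_algebra.
  move=> _ [[j Jj] _ [B mB <-]]; apply: sub_sigma_algebra; rewrite setTI/=.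
  exists (fun i => if i == j then B else setT); last first.
    apply/seteqP; split => w /=; first by move/(_ j); rewrite eqxx.
    by move=> Bw i; case: eqP => // ->.
  split; first by move=> i; case: ifP.
  exists [:: j]; split => // i; rewrite inE; first by move/eqP->.
  by move/negbTE->.
apply: smallest_sub; first exact: smallest_sigma_algebra.
move=> _ [E [mE [s [us sJ sE]]] <-]; rewrite (rect_bigcap Y sE).
rewrite bigcap_seq big_seq /g_sigma_family.
set G := \bigcup_i _.
apply: (@bigsetI_measurable _ (g_sigma_algebraType G)) => i /sJ Ji.
apply: sub_sigma_algebra; exists (exist _ i Ji) => //=.
by exists (E i) => //; rewrite setTI.
Qed.

Lemma g_sigma_family_sub (I K aT : Type) d (T : measurableType d)
    (f : I -> aT -> T) (g : K -> aT -> T) :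
  (forall i, exists k, f i = g k) -> g_sigma_family f `<=` g_sigma_family g.
Proof.
move=> fg; apply: sub_smallest2r; first exact: smallest_sigma_algebra.
move=> A [i _ iA].
by have [k fk] := fg i; exists k => //; rewrite -fk.
Qed.

Section path_space_theory.
Context (I : Type) d (Omega : measurableType d) d' (T : measurableType d').

Lemma path_spaceE : @measurable _ (path_space I T) =
  g_sigma_family (fun (i : I) (x : I -> T) => x i).
Proof. exact/sigma_algebra_id/smallest_sigma_algebra. Qed.

Lemma measurable_coord (i : I) :
  measurable_fun setT (fun x : path_space I T => x i).
Proof.
move=> _ B mB; rewrite path_spaceE; apply: sub_sigma_algebra.
by exists i => //; exists B.
Qed.

Lemma measurable_path (f : Omega -> path_space I T) :
  (forall i, measurable_fun setT (fun w => f w i)) -> measurable_fun setT f.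
Proof.
move=> mf _ A mA; rewrite setTI.
apply: (g_sigma_family_measurable mf).
rewrite path_spaceE in mA.
by apply: (@preimage_g_sigma_family _ _ _ _ _ (fun i (x : I -> T) => x i)).
Qed.

Lemma path_preimage_sub d'' (S : measurableType d'') (Y : I -> Omega -> T)
    (f : path_space I T -> S) : measurable_fun setT f ->
  g_sigma_algebra_preimage (fun w => f (fun i => Y i w)) `<=` g_sigma_family Y.
Proof.
move=> mf _ [B mB <-]; rewrite setTI.
have := mf measurableT _ mB; rewrite setTI path_spaceE => /preimage_g_sigma_family.
by move=> /(_ _ (fun w i => Y i w)).
Qed.

(** This lets product measures handle events of an infinite past. *)
Lemma g_sigma_family_path (Y : I -> Omega -> T) F : g_sigma_family Y F ->
  exists2 F' : set (path_space I T), measurable F' & F = [set w | F' (fun i => Y i w)].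
Proof.
pose H : set (set Omega) := [set F | exists2 F' : set (path_space I T),
  measurable F' & F = [set w | F' (fun i => Y i w)]].
suff : g_sigma_family Y `<=` H by apply.
apply: smallest_sub.
  split => [|A [F' mF' ->]|A HA].
  - by exists set0.
  - by exists (~` F'); [exact: measurableC|rewrite setTD].
  - have /choice[F' hF'] : forall k, exists F' : set (path_space I T),
        measurable F' /\ A k = [set w | F' (fun i => Y i w)].
      by move=> k; have [F' ? ?] := HA k; exists F'.
    exists (\bigcup_k F' k); first by apply: bigcup_measurable => k _; case: (hF' k).
    apply/seteqP; split => w [k _].
      by have [_ ->] := hF' k => ?; exists k.
    by move=> h; exists k => //; have [_ ->] := hF' k.
move=> _ [i _ [B mB <-]]; exists ((fun y => y i) @^-1` B).
  by rewrite -[X in measurable X]setTI; exact: measurable_coord.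
by rewrite setTI.
Qed.

End path_space_theory.

Lemma path_space_rects (I : choiceType) d' (T : measurableType d') : @measurable _ (path_space I T) =
  <<s rects (fun i (x : path_space I T) => x i) setT >>.
Proof.
rewrite path_spaceE -g_sigma_family_rects; apply/seteqP; split.
  by apply: g_sigma_family_sub => i; exists (exist _ i Logic.I).
by apply: g_sigma_family_sub => -[i ?]; exists i.
Qed.

(** * Processes with independent and identically distributed values *)

Section iid.
Context (I : choiceType) d (Omega : measurableType d) d' (T : measurableType d')
  (R : realType).

(** Mutual independence and identical distribution in a single product rule. *)
Definition iid_law (P : probability Omega R) (Y : I -> Omega -> T)
    (nu : set T -> \bar R) :=
  (forall i, measurable_fun setT (Y i)) /\
  forall (E : I -> set T) (s : seq I), (forall i, measurable (E i)) -> uniq s ->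
    P (\bigcap_(i in [set` s]) (Y i @^-1` E i)) = (\prod_(i <- s) nu (E i))%E.

Variables (P : probability Omega R) (Y : I -> Omega -> T) (nu : set T -> \bar R).
Hypothesis iidY : iid_law P Y nu.

Lemma iid_rect (E : I -> set T) (s : seq I) :
  (forall i, measurable (E i)) -> uniq s -> (forall i, i \notin s -> E i = setT) ->
  P (rect Y E) = (\prod_(i <- s) nu (E i))%E.
Proof. by move=> mE us sE; rewrite (rect_bigcap Y sE) iidY.2. Qed.

Lemma rects_measurable J : rects Y J `<=` measurable.
Proof.
move=> _ [E [mE [s [us sJ sE]]] <-]; rewrite (rect_bigcap Y sE) bigcap_seq.
by apply: bigsetI_measurable => i _; rewrite -[X in measurable X]setTI; exact: iidY.1.
Qed.

Lemma iid_independent (J K : set I) : J `&` K = set0 ->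
  independent P (g_sigma_family (fun j : {i | J i} => Y (sval j)))
    (g_sigma_family (fun j : {i | K i} => Y (sval j))).
Proof.
move=> JK; rewrite !g_sigma_family_rects.
apply: independent_g_sigma; try exact: rects_measurable;
  try exact: rects_setI; try exact: rects_setT.
move=> _ _ [E [mE [s [us sJ sE]]] <-] [F [mF [r [ur rJ rF]]] <-].
have sr i : i \in s -> i \in r -> False.
  by move=> /sJ ? /rJ ?; have : (J `&` K) i by []; rewrite JK.
rewrite rectI (@iid_rect _ (s ++ r)); last 3 first.
- by move=> i; exact: measurableI.
- rewrite cat_uniq us ur andbT; apply/hasPn => i ir /=; apply/negP => is_.
  exact: (sr i).
- by move=> i; rewrite mem_cat negb_or => /andP[/sE-> /rF->]; rewrite setTI.
rewrite big_cat/= (iid_rect mE us sE) (iid_rect mF ur rF); congr (_ * _)%E.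
  rewrite big_seq [RHS]big_seq; apply: eq_bigr => i is_.
  by rewrite rF ?setIT//; apply/negP => /(sr i is_).
rewrite big_seq [RHS]big_seq; apply: eq_bigr => i ir.
by rewrite sE ?setTI//; apply/negP => /sr/(_ ir).
Qed.

End iid.

Section iid_transfer.
Context (I K : choiceType) d (Omega : measurableType d) d' (T : measurableType d')
  (R : realType).

Lemma iid_reindex (P : probability Omega R) (Y : I -> Omega -> T) nu (f : K -> I) :
  injective f -> iid_law P Y nu -> iid_law P (Y \o f) nu.
Proof.
move=> fI [mY iY]; split=> [k|E s mE us]; first exact: mY.
case: (pselect (exists k : K, k \in s)) => [[k0 k0s]|nos]; last first.
  case: s us nos => [|k s] _ nos; last by exfalso; apply: nos; exists k; rewrite inE eqxx.
  rewrite big_nil -(probability_setT P); congr (P _).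
  by apply/seteqP; split => w.
pose E' i := if pselect (exists2 k, k \in s & f k = i) is left h
             then E (projT1 (cid2 h)) else setT.
have E'f k : k \in s -> E' (f k) = E k.
  move=> ks; rewrite /E'; case: pselect => [h|[]]; last by exists k.
  by case: (cid2 h) => /= k' k's /fI->.
have mE' i : measurable (E' i) by rewrite /E'; case: pselect.
have := iY E' (map f s) mE'; rewrite map_inj_uniq// => /(_ us).
rewrite big_map [in RHS]big_seq (eq_bigr (fun k => nu (E k))); last first.
  by move=> k /E'f->.
rewrite -big_seq => <-; congr (P _); apply/seteqP; split => w /= h.
  by move=> _ /= /mapP[k ks ->]; rewrite /= E'f//; exact: h.
by move=> k /= ks; rewrite -E'f//; apply: h; rewrite /= map_f.
Qed.

Lemma iid_map d'' (T'' : measurableType d'') (P : probability Omega R)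
    (Y : I -> Omega -> T) nu (g : T -> T'') :
  measurable_fun setT g -> iid_law P Y nu ->
  iid_law P (fun i w => g (Y i w)) (fun E => nu (g @^-1` E)).
Proof.
move=> mg [mY iY]; split=> [i|E s mE us]; first exact: measurableT_comp.
rewrite -(iY (fun i => g @^-1` E i) s)// => i.
by rewrite -[X in measurable X]setTI; exact: mg.
Qed.

End iid_transfer.

Section iid_path_law.
Context (I : choiceType) d1 d2 (Omega1 : measurableType d1)
  (Omega2 : measurableType d2) d' (T : measurableType d') (R : realType).
Variables (P1 : probability Omega1 R) (P2 : probability Omega2 R).
Variables (Y1 : I -> Omega1 -> T) (Y2 : I -> Omega2 -> T) (nu : set T -> \bar R).

Lemma iid_path_law : iid_law P1 Y1 nu -> iid_law P2 Y2 nu ->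
  forall A : set (path_space I T), measurable A ->
  P1 [set w | A (fun i => Y1 i w)] = P2 [set w | A (fun i => Y2 i w)].
Proof.
move=> iid1 iid2 A mA.
have m1 : measurable_fun setT (fun w => (fun i => Y1 i w) : path_space I T).
  by apply: measurable_path => i; exact: iid1.1.
have m2 : measurable_fun setT (fun w => (fun i => Y2 i w) : path_space I T).
  by apply: measurable_path => i; exact: iid2.1.
pose c (i : I) (x : path_space I T) := x i.
apply: (@measure_agree _ _ _ (law P1 m1) (law P2 m2) (rects c setT)).
- by rewrite path_space_rects; exact: sub_sigma_algebra.
- exact: rects_setI.
- exact: rects_setT.
- by rewrite /= probability_setT ltry.
- move=> _ [E [mE [s [us _ sE]]] <-].
  transitivity (P1 (rect Y1 E)) => //; transitivity (P2 (rect Y2 E)) => //.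
  by rewrite (iid_rect iid1 mE us sE) (iid_rect iid2 mE us sE).
- by rewrite -path_space_rects.
Qed.

End iid_path_law.

Section iid_zero_one.
Context d' (T : measurableType d') (R : realType).

Definition path_shift (k : int) (x : path_space int T) : path_space int T := fun t => x (t + k).

Lemma measurable_path_shift k : measurable_fun setT (path_shift k).
Proof. by apply: measurable_path => i; exact: measurable_coord. Qed.

Variables (mu : probability (path_space int T) R) (nu : set T -> \bar R).
Let coord (i : int) (x : path_space int T) := x i.
Hypothesis iid_mu : iid_law mu coord nu.

Let window (n : nat) : set int := [set i | (`|i| <= n%:Z)%R].
Let F n := g_sigma_family (fun j : {i | window n i} => coord (sval j)).

Let m (A : set (path_space int T)) : R := fine (mu A).

Let mD A B : measurable A -> measurable B -> A `<=` B ->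
  m (B `\` A) = m B - m A.
Proof.
move=> mA mB AB; rewrite /m measureD//; last by rewrite ltey_eq fin_num_measure.
by rewrite setIidr// fineB// fin_num_measure.
Qed.

Let mle A B : measurable A -> measurable B -> A `<=` B -> m A <= m B.
Proof.
by move=> mA mB AB; rewrite /m fine_le ?fin_num_measure// le_measure ?inE.
Qed.

Let m_ge0 A : 0 <= m A. Proof. exact: fine_ge0. Qed.

Let m_le1 A : measurable A -> m A <= 1.
Proof.
move=> mA; rewrite -[leRHS]/(fine 1%E) /m fine_le ?fin_num_measure//.
exact: probability_le1.
Qed.

Let F_measurable n : F n `<=` measurable.
Proof. by apply: g_sigma_family_measurable => i; exact: iid_mu.1. Qed.

Let F_mono n k : (n <= k)%N -> F n `<=` F k.
Proof.
move=> nk; apply: g_sigma_family_sub => -[i wi].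
have wi' : window k i by rewrite /window/= (le_trans wi)// lez_nat.
by exists (exist _ i wi').
Qed.

(* Events approximable by events about finitely many coordinates. The
   approximation is required inside every event D, which makes the property
   stable under proper differences. *)
Let approx : set (set (path_space int T)) := [set A | measurable A /\
  forall e : R, 0 < e -> exists n C, F n C /\
    forall D, measurable D -> `|m (A `&` D) - m (C `&` D)| <= e].

Let approxP A : measurable A -> approx A.
Proof.
move=> mA; move: (mA); rewrite path_space_rects.
suff : <<s rects coord setT >> `<=` approx by apply.
move=> {A mA}; apply: lambda_system_subset => //; first exact: rects_setI; last first.
- move=> _ [E [mE [s [us _ sE]]] <-]; split.
    by apply: (rects_measurable iid_mu (J := setT)); exists E => //; split => //; exists s.
  move=> e e0; exists (\max_(i <- s) `|i|%N)%N, (rect coord E); split; last first.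
    by move=> D _; rewrite subrr normr0 ltW.
  rewrite /F g_sigma_family_rects; apply: sub_sigma_algebra.
  exists E => //; split => //; exists s; split => // i is_.
  rewrite /window/= -abszE lez_nat.
  exact: leq_bigmax_seq.
- split.
  + by [].
  + split => // e e0; exists 0%N, setT; split.
      by rewrite -[setT]setC0 -setTD; apply: sigma_algebraCD; exact: sigma_algebra0.
    by move=> D _; rewrite subrr normr0 ltW.
  + move=> B A AB [mB aB] [mA' aA]; split; first exact: measurableD.
    move=> e e0; have e20 : 0 < e / 3%:R by rewrite divr_gt0.
    have [n1 [C1 [FC1 h1]]] := aB _ e20.
    have [n2 [C2 [FC2 h2]]] := aA _ e20.
    have {}FC1 : F (maxn n1 n2) C1 by exact: (F_mono (leq_maxl _ _)).
    have {}FC2 : F (maxn n1 n2) C2 by exact: (F_mono (leq_maxr _ _)).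
    have mC1 := F_measurable FC1; have mC2 := F_measurable FC2.
    exists (maxn n1 n2), (C1 `\` C2); split.
      exact: (@measurableD _ (g_sigma_algebraType (\bigcup_(j : {i | window (maxn n1 n2) i}) preimage_set_system setT (coord (sval j)) measurable))).
    move=> D mD'.
    have -> : (B `\` A) `&` D = (B `&` D) `\` (A `&` (B `&` D)).
      apply/seteqP; split => x /=.
        by move=> [[Bx nAx] Dx]; split => // -[].
      by move=> [[Bx Dx] h]; do !split => //; move=> Ax; apply: h.
    have -> : (C1 `\` C2) `&` D = (C1 `&` D) `\` (C1 `&` (C2 `&` D)).
      apply/seteqP; split => x /=.
        by move=> [[Bx nAx] Dx]; split => // -[_ []].
      by move=> [[Bx Dx] h]; do !split => //; move=> Ax; apply: h.
    rewrite !mD; try by do ?apply: measurableI.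
    - have hB := h1 _ mD'.
      have hA := h2 _ (measurableI _ _ mB mD').
      have hC := h1 _ (measurableI _ _ mC2 mD').
      rewrite (setICA B) in hC.
      rewrite (_ : _ - _ = (m (B `&` D) - m (C1 `&` D))
        - (m (A `&` (B `&` D)) - m (C2 `&` (B `&` D)))
        - (m (C2 `&` (B `&` D)) - m (C1 `&` (C2 `&` D)))); last by ring.
      have -> : e = e / 3%:R + e / 3%:R + e / 3%:R by field.
      rewrite (le_trans (ler_normB _ _))// lerD//.
      by rewrite (le_trans (ler_normB _ _))// lerD.
    - by move=> x [Cx [_ Dx]].
  + move=> A ndA aA; split; first by apply: bigcupT_measurable => k; exact: (aA k).1.
    have mA' k : measurable (A k) := (aA k).1.
    have mU : measurable (\bigcup_k A k) by exact: bigcupT_measurable.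
    move=> e e0; have e20 : 0 < e / 2%:R by rewrite divr_gt0.
    have : m \o A @ \oo --> m (\bigcup_k A k).
      apply: fine_cvg; rewrite fineK ?fin_num_measure//.
      exact: nondecreasing_cvg_mu.
    move=> /cvgrPdist_le /(_ _ e20)[k _ /(_ k (leqnn _))] /= hk.
    have [n [C [FC h]]] := (aA k).2 _ e20.
    exists n, C; split => // D mD'.
    have AU : A k `<=` \bigcup_k A k by exact: bigcup_sup.
    rewrite (_ : _ - _ = (m ((\bigcup_k A k) `&` D) - m (A k `&` D)) +
      (m (A k `&` D) - m (C `&` D))); last by ring.
    rewrite (splitr e) (le_trans (ler_normD _ _))// lerD//; last exact: h.
    apply: le_trans hk; rewrite -!mD//; try exact: measurableI; last exact: setSI.
    rewrite !ger0_norm//; apply: mle; try by do ?[apply: measurableD|apply: measurableI].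
    by move=> x [[Ux Dx] nx]; split => // Ax; apply: nx.
Qed.

Let m_indep (J K : set int) A B : J `&` K = set0 ->
  g_sigma_family (fun j : {i | J i} => coord (sval j)) A ->
  g_sigma_family (fun j : {i | K i} => coord (sval j)) B ->
  m (A `&` B) = m A * m B.
Proof.
move=> JK sA sB; rewrite /m (iid_independent iid_mu JK sA sB) fineM//.
  apply: fin_num_measure; apply: g_sigma_family_measurable sA => i.
  exact: iid_mu.1.
apply: fin_num_measure; apply: g_sigma_family_measurable sB => i.
exact: iid_mu.1.
Qed.

Let m_shift k (A : set (path_space int T)) : measurable A -> m (path_shift k @^-1` A) = m A.
Proof.
move=> mA; rewrite /m; congr fine.
have iid2 := iid_reindex (f := fun t : int => t + k) (addIr k) iid_mu.
exact: (iid_path_law iid2 iid_mu mA).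
Qed.

(** Let C, depending on the coordinates of a finite window, approximate the
    invariant event A. A shifted copy of C depends on disjoint coordinates, so it
    is independent of C, and it approximates A equally well; hence
    mu A = (mu A)^2. *)
Lemma path_shift_invariant01 (A : set (path_space int T)) : measurable A -> (forall x, A (path_shift 1 x) <-> A x) ->
  mu A = 0%E \/ mu A = 1%E.
Proof.
move=> mA invA.
have invk (k : nat) : path_shift k%:Z @^-1` A = A.
  elim: k => [|k IH].
    by apply/seteqP; split => x; rewrite /= /path_shift; under eq_fun do rewrite addr0.
  rewrite -[RHS]IH; apply/seteqP; split => x /=.
    move=> h; apply/invA; rewrite /path_shift.
    by rewrite (_ : (fun t => _) = path_shift k.+1%:Z x)//; apply/funext => t; rewrite /path_shift -addrA -PoszD.
  move=> h; rewrite (_ : path_shift _ _ = path_shift 1 (path_shift k%:Z x)); first exact/invA.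
  by apply/funext => t; rewrite /path_shift -addrA -PoszD.
suff h : m A = m A ^+ 2.
  have : m A * (m A - 1) = 0 by rewrite mulrBr mulr1 -expr2 -h subrr.
  move=> /eqP; rewrite mulf_eq0 subr_eq0 => /orP[/eqP h0|/eqP h1]; [left|right].
    by rewrite -[LHS]fineK ?fin_num_measure// -/(m A) h0.
  by rewrite -[LHS]fineK ?fin_num_measure// -/(m A) h1.
apply/eqP; rewrite -subr_eq0 -normr_eq0 eq_le normr_ge0 andbT.
apply/ler_addgt0Pr => e e0; rewrite add0r.
have e40 : 0 < e / 4%:R by rewrite divr_gt0.
have [_ /(_ _ e40)[n [C [FC hC]]]] := approxP mA.
have mC := F_measurable FC.
(* the windows [-n, n] and [n + 1, 3 n + 1] are disjoint *)
pose k : int := (2 * n + 1)%N.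
pose Ck := path_shift k @^-1` C.
have mCk : measurable Ck.
  by rewrite -[X in measurable X]setTI; exact: measurable_path_shift.
pose W' : set int := [set i | window n (i - k)].
have FCk : g_sigma_family (fun j : {i | W' i} => coord (sval j)) Ck.
  have := preimage_g_sigma_family (g := path_shift k) FC; apply: g_sigma_family_sub.
  move=> [i wi]; have wi' : W' (i + k) by rewrite /W'/= addrK.
  by exists (exist _ (i + k) wi').
have disj : window n `&` W' = set0.
  apply/seteqP; split => // i []; rewrite /W' /window /k/= => h1 h2.
  by exfalso; lia.
have hind : m (C `&` Ck) = m C * m C.
  by rewrite (m_indep disj FC FCk) m_shift.
have h1 := hC _ mA; rewrite setIid in h1.
have h2 := hC _ measurableT; rewrite !setIT in h2.
have h3 := hC _ mCk; rewrite hind in h3.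
have eACk : m (A `&` Ck) = m (C `&` A).
  rewrite -(m_shift k (measurableI _ _ mC mA)) preimage_setI.
  by rewrite [path_shift k @^-1` A](invk (2 * n + 1)%N) setIC.
rewrite eACk in h3.
have h4 : `|m A - m C * m C| <= e / 4%:R + e / 4%:R.
  rewrite (_ : _ - _ = (m A - m (C `&` A)) + (m (C `&` A) - m C * m C)); last by ring.
  by rewrite (le_trans (ler_normD _ _))// lerD.
have h5 : `|m C * m C - m A ^+ 2| <= e / 4%:R + e / 4%:R.
  rewrite (_ : _ - _ = (m C - m A) * (m C + m A)); last by ring.
  rewrite normrM distrC; apply: (@le_trans _ _ (e / 4%:R * 2%:R)); last by rewrite mulr_natr mulr2n.
  apply: ler_pM => //; rewrite ger0_norm ?addr_ge0//.
  by rewrite -[2%:R]/(1 + 1) lerD//; exact: m_le1.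
rewrite (_ : _ - _ = (m A - m C * m C) + (m C * m C - m A ^+ 2)); last by ring.
rewrite (le_trans (ler_normD _ _))//.
have -> : e = (e / 4%:R + e / 4%:R) + (e / 4%:R + e / 4%:R) by field.
exact: lerD.
Qed.

End iid_zero_one.

Section iid_generator.
Context (I : choiceType) d (Omega : measurableType d) d' (T : measurableType d')
  (R : realType).
Variables (P : probability Omega R) (Y : I -> Omega -> T) (nu : probability T R).
Variable G : set (set T).
Hypothesis GE : @measurable _ T = <<s G >>.
Hypothesis GI : setI_closed G.
Hypothesis GT : G setT.
Hypothesis mY : forall i, measurable_fun setT (Y i).
Hypothesis prodG : forall (E : I -> set T) (s : seq I), (forall i, G (E i)) ->
  uniq s -> P (\bigcap_(i in [set` s]) (Y i @^-1` E i)) = (\prod_(i <- s) nu (E i))%E.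

Let Gm : G `<=` measurable. Proof. by rewrite GE; exact: sub_sigma_algebra. Qed.

Let marginal i A : measurable A -> P (Y i @^-1` A) = nu A.
Proof.
move=> mA; apply: (@measure_agree _ _ _ (law P (mY i)) nu G) => //.
- by rewrite /= probability_setT ltry.
- move=> B GB; have := prodG (E := fun=> B) (s := [:: i]) (fun=> GB) isT.
  by rewrite bigcap_seq !big_seq1.
- by rewrite -GE.
Qed.

Let capS (E : I -> set T) i s : \bigcap_(j in [set` i :: s]) (Y j @^-1` E j) =
  Y i @^-1` (E i) `&` \bigcap_(j in [set` s]) (Y j @^-1` E j).
Proof. by rewrite !bigcap_seq big_cons. Qed.

Let cap_perm (E : I -> set T) (s1 s2 : seq I) : perm_eq s1 s2 ->
  \bigcap_(j in [set` s1]) (Y j @^-1` E j) = \bigcap_(j in [set` s2]) (Y j @^-1` E j).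
Proof.
by move=> s12; rewrite !bigcap_seq; exact: perm_big.
Qed.

Let prod_mixed (s1 s2 : seq I) (E : I -> set T) : uniq (s1 ++ s2) ->
  (forall i, measurable (E i)) -> (forall i, i \notin s1 -> G (E i)) ->
  P (\bigcap_(i in [set` s1 ++ s2]) (Y i @^-1` E i)) =
  (\prod_(i <- s1 ++ s2) nu (E i))%E.
Proof.
elim: s1 s2 E => [|i s1 IH] s2 E /=.
  by move=> us _ GEs; apply: prodG => // i; exact: GEs.
move=> /andP[nis us] mE GEs.
set rest := \bigcap_(j in [set` s1 ++ s2]) (Y j @^-1` E j).
have nis1 : i \notin s1 by apply: contra nis; rewrite mem_cat => ->.
pose F A j := if j == i then A else E j.
have restE A : \bigcap_(j in [set` s1 ++ s2]) (Y j @^-1` F A j) = rest.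
  apply: eq_bigcapr => j js; rewrite /F; case: eqP => // ji.
  by move: nis; rewrite -ji js.
have prodE A : (\prod_(j <- s1 ++ s2) nu (F A j) = \prod_(j <- s1 ++ s2) nu (E j))%E.
  rewrite big_seq [RHS]big_seq; apply: eq_bigr => j js; rewrite /F.
  by case: eqP => // ji; move: nis; rewrite -ji js.
have key A : G A -> P (Y i @^-1` A `&` rest) = (nu A * \prod_(j <- s1 ++ s2) nu (E j))%E.
  move=> GA; have pe : perm_eq (s1 ++ i :: s2) (i :: (s1 ++ s2)).
    by rewrite -cat1s perm_catCA.
  have := IH (i :: s2) (F A); rewrite (perm_uniq pe) /= nis us => /(_ isT).
  rewrite (cap_perm _ pe) (perm_big _ pe) capS big_cons restE prodE.
  have -> : F A i = A by rewrite /F eqxx.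
  apply.
    by move=> j; rewrite /F; case: ifP => // _; exact: Gm.
  move=> j js; rewrite /F; case: ifPn => // ji; apply: GEs.
  by rewrite inE negb_or ji js.
have Prest : P rest = (\prod_(j <- s1 ++ s2) nu (E j))%E.
  by have := key _ GT; rewrite preimage_setT setTI probability_setT mul1e.
rewrite capS big_cons -Prest -/rest -(marginal i (mE i)).
have mrest : measurable rest.
  rewrite /rest bigcap_seq; apply: bigsetI_measurable => j _.
  by rewrite -[X in measurable X]setTI; exact: mY.
pose FF := preimage_set_system setT (Y i) G.
have FFE A : G A -> FF (Y i @^-1` A) by move=> GA; exists A => //; rewrite setTI.
apply: (@independent_g_sigmal _ _ _ P FF [set rest]).
- by move=> _ [A GA <-]; apply: mY => //; exact: Gm.
- by move=> _ ->.
- by move=> _ _ [A GA <-] [B GB <-]; rewrite !setTI -preimage_setI; apply: FFE; exact: GI.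
- by rewrite -(preimage_setT (Y i)); exact: FFE.
- move=> _ _ [A GA <-] ->; rewrite setTI key// marginal ?Prest//; exact: Gm.
- rewrite /FF g_sigma_preimageE; exists (E i); first by rewrite -[X in X _]GE.
  by rewrite setTI.
- by [].
Qed.

(** The product rule extends from a generating pi-system to all measurable sets,
    one coordinate at a time: [prod_mixed] allows arbitrary measurable sets in
    the coordinates of s1. *)
Lemma iid_law_generator : iid_law P Y nu.
Proof.
split=> // E s mE us.
pose E' i := if i \in s then E i else setT.
have := @prod_mixed s [::] E'; rewrite cats0 => /(_ us) h.
transitivity (P (\bigcap_(i in [set` s]) Y i @^-1` E' i)).
  by congr (P _); apply: eq_bigcapr => i /= is_; rewrite /E' is_.
rewrite h.
- by rewrite big_seq [RHS]big_seq; apply: eq_bigr => i is_; rewrite /E' is_.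
- by move=> i; rewrite /E'; case: ifP.
- by move=> i is_; rewrite /E' (negbTE is_).
Qed.

End iid_generator.

(** * The Cramer-Wold theorem *)

Section trig_polynomial.
Variables (R : realType) (n : nat).

(** The trigonometric polynomials. Their integrals depend only on the laws of
    linear forms, and they form an algebra by the product-to-sum formulas. *)
Inductive trig : ('cV[R]_n -> R) -> Prop :=
| trig_cos c u b : trig (fun x => c * cos (dot u x + b))
| trig_add f g : trig f -> trig g -> trig (fun x => f x + g x).

Lemma trig_eq f g : f =1 g -> trig f -> trig g.
Proof. by move=> /funext ->. Qed.

Lemma trig_cst c : trig (fun=> c).
Proof.
by apply: trig_eq (trig_cos c 0 0) => x; rewrite dot0l addr0 cos0 mulr1.
Qed.

Lemma trig_mul f g : trig f -> trig g -> trig (fun x => f x * g x).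
Proof.
move=> + tg; elim=> [c u b|f1 f2 _ IH1 _ IH2]; last first.
  by apply: trig_eq (trig_add IH1 IH2) => x; rewrite mulrDl.
elim: tg => [c' u' b'|f1 f2 _ IH1 _ IH2]; last first.
  by apply: trig_eq (trig_add IH1 IH2) => x; rewrite mulrDr.
apply: trig_eq (trig_add (trig_cos (c * c' / 2) (u + u') (b + b'))
  (trig_cos (c * c' / 2) (u - u') (b - b'))) => x.
rewrite dotDl dotBl.
rewrite (_ : dot u x + dot u' x + (b + b') = (dot u x + b) + (dot u' x + b')); last by ring.
rewrite (_ : dot u x - dot u' x + (b - b') = (dot u x + b) - (dot u' x + b')); last by ring.
by rewrite cosD cosB; field.
Qed.

Lemma trig_exp f k : trig f -> trig (fun x => f x ^+ k).
Proof.
move=> tf; elim: k => [|k IH]; first by apply: trig_eq (trig_cst 1) => x.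
by apply: trig_eq (trig_mul tf IH) => x; rewrite exprS.
Qed.

Lemma measurable_trig f : trig f -> measurable_fun setT f.
Proof.
elim=> [c u b|f1 f2 _ m1 _ m2]; last exact: measurable_funD.
apply: measurable_funM => //; apply: measurableT_comp.
  by apply: continuous_measurable_fun; exact: continuous_cos.
by apply: measurable_funD => //; exact: measurable_dot.
Qed.

Lemma trig_bounded f : trig f -> exists K, forall x, `|f x| <= K.
Proof.
elim=> [c u b|f1 f2 _ [K1 h1] _ [K2 h2]].
  exists `|c| => x; rewrite normrM ler_piMr// ler_norml cos_le1 cos_geN1//.
by exists (K1 + K2) => x; rewrite (le_trans (ler_normD _ _))// lerD.
Qed.

End trig_polynomial.

Section step.
Variable R : realType.

(** With x = (1 - t) / 2, this is (1 - x^k)^(k 2^k): if t > 0 then 2 x < 1 and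
    k 2^k x^k tends to 0, so it tends to 1; if t <= 0 then 2 x >= 1 and it tends
    to 0. *)
Definition step_poly (k : nat) (t : R) : R :=
  (1 - ((1 - t) / 2) ^+ k) ^+ (k * 2 ^ k).

Lemma step_poly_itv k t : -1 <= t <= 1 -> 0 <= step_poly k t <= 1.
Proof.
move=> /andP[t1 t2].
have x01 : 0 <= ((1 - t) / 2) ^+ k <= 1.
  rewrite exprn_ge0 ?exprn_ile1//; lra.
by rewrite /step_poly exprn_ge0 ?exprn_ile1//; lra.
Qed.

Lemma bernoulli (y : R) k : 0 <= 1 + y -> 1 + k%:R * y <= (1 + y) ^+ k.
Proof.
move=> y0; elim: k => [|k IH]; first by rewrite expr0; lra.
rewrite exprS; apply: le_trans (ler_wpM2l y0 IH).
rewrite mulrDl mul1r mulrDr mulr1 -natr1 mulrDl mul1r.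
have : 0 <= k%:R * (y * y) by rewrite mulr_ge0// -expr2 sqr_ge0.
lra.
Qed.

Lemma cvg_natmul_expr (r : R) : 0 <= r < 1 -> k%:R * r ^+ k @[k --> \oo] --> 0.
Proof.
move=> /andP[r0 r1].
have [->|rn0] := eqVneq r 0.
  rewrite (_ : (fun k => _) = fun=> 0); first exact: cvg_cst.
  by apply/funext => -[|k]; rewrite ?mul0r// expr0n mulr0.
pose s := Num.sqrt r.
have s0 : 0 < s by rewrite sqrtr_gt0 lt_neqAle eq_sym rn0.
have s1 : s < 1 by rewrite -sqrtr1 ltr_sqrt.
have rE : r = s * s by rewrite -expr2 sqr_sqrtr.
pose h := s^-1 - 1.
have h0 : 0 < h by rewrite subr_gt0 invf_gt1.
have bnd k : k%:R * s ^+ k <= h^-1.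
  have : 1 + k%:R * h <= (1 + h) ^+ k by apply: bernoulli; lra.
  have -> : 1 + h = s^-1 by rewrite /h addrC subrK.
  have sk : 0 < s ^+ k by exact: exprn_gt0.
  rewrite exprVn -[in leRHS](mulr1 (s ^+ k)^-1) ler_pdivlMl// => le1.
  by rewrite -[leRHS]mul1r ler_pdivlMr//; lra.
apply: (@squeeze_cvgr _ _ _ _ (fun=> 0) (fun k => h^-1 * s ^+ k)).
- apply: nearW => k; apply/andP; split.
    by rewrite mulr_ge0// exprn_ge0.
  by rewrite rE exprMn mulrA ler_wpM2r ?bnd// exprn_ge0// ltW.
- exact: cvg_cst.
- rewrite -[X in _ --> X](mulr0 h^-1); apply: cvgM; first exact: cvg_cst.
  by apply: cvg_expr; rewrite ger0_norm ?ltW.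
Qed.

Lemma step_poly_cvg (t : R) : -1 <= t <= 1 ->
  step_poly k t @[k --> \oo] --> ((0 < t)%R%:R : R).
Proof.
move=> t12; have /andP[t1 t2] := t12; set x := (1 - t) / 2.
have x0 : 0 <= x by rewrite /x; lra.
have x1 : x <= 1 by rewrite /x; lra.
have xk k : 0 <= x ^+ k <= 1 by rewrite exprn_ge0 ?exprn_ile1.
have N2 k : (k * 2 ^ k)%:R = k%:R * 2 ^+ k :> R by rewrite natrM natrX.
case: ltP => t0 /=.
  apply: (@squeeze_cvgr _ _ _ _ (fun k => 1 - k%:R * (2 * x) ^+ k) (fun=> 1)).
  - apply: nearW => k; apply/andP; split; last first.
      by have /andP[] := step_poly_itv k t12.
    have := @bernoulli (- x ^+ k) (k * 2 ^ k); rewrite N2 (exprMn_comm _ (mulrC 2 x)) mulrN mulrA.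
    by rewrite /step_poly -/x; apply; have := xk k; lra.
  - rewrite -[X in _ --> X]subr0; apply: cvgB; first exact: cvg_cst.
    by apply: cvg_natmul_expr; rewrite /x; lra.
  - exact: cvg_cst.
apply: (@squeeze_cvgr _ _ _ _ (fun=> 0) (fun k => (k.+1%:R)^-1)).
- apply: nearW => k; apply/andP; split.
    by have /andP[] := step_poly_itv k t12.
  have := @bernoulli (x ^+ k) (k * 2 ^ k); have /andP[xk0 xk1] := xk k.
  rewrite N2 => /(_ (addr_ge0 ler01 xk0)) h.
  have kle : k.+1%:R <= (1 + x ^+ k) ^+ (k * 2 ^ k).
    apply: le_trans h; rewrite -natr1 addrC lerD2l -mulrA ler_peMr// -exprMn.
    by apply: exprn_ege1; rewrite /x; lra.
  rewrite -[leRHS]mul1r ler_pdivlMr// /step_poly -/x.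
  apply: le_trans (ler_wpM2l _ kle) _.
    by rewrite exprn_ge0//; lra.
  by rewrite -exprMn exprn_ile1//; nra.
- exact: cvg_cst.
- exact: cvg_harmonic.
Qed.

End step.

Section cramer_wold.
Variables (R : realType) (n : nat).
Variables (P1 P2 : probability 'cV[R]_n R).
Hypothesis dot_law : forall u (E : set R), measurable E ->
  P1 (dot u @^-1` E) = P2 (dot u @^-1` E).

Let integrable_bounded (P : probability 'cV[R]_n R) (f : 'cV[R]_n -> R) :
  measurable_fun setT f ->
  (exists K, forall x, `|f x| <= K) -> P.-integrable setT (EFin \o f).
Proof.
move=> mf [K fK]; apply: measurable_bounded_integrable => //.
  by rewrite [ltLHS](probability_setT P) ltry.
exists K; split; first exact: num_real.
by move=> M KM x _ /=; rewrite (le_trans (fK x))// ltW.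
Qed.

Let cos_agree (u : 'cV[R]_n) b : (\int[P1]_x (cos (dot u x + b))%:E =
  \int[P2]_x (cos (dot u x + b))%:E)%E.
Proof.
pose f y : \bar R := (1 + cos (y + b))%:E.
have mcos : measurable_fun setT (fun y : R => cos (y + b)).
  apply: measurableT_comp.
    by apply: continuous_measurable_fun; exact: continuous_cos.
  exact: measurable_funD.
have mf : measurable_fun setT f by apply/measurable_EFinP; exact: measurable_funD.
have f0 y : (0 <= f y)%E by rewrite lee_fin; have := cos_geN1 (y + b); lra.
have md := @measurable_dot R n u.
have E12 : (\int[P1]_x f (dot u x) = \int[P2]_x f (dot u x))%E.
  rewrite -!(integral_law _ md)//; apply: eq_measure_integral => A mA _.
  exact: dot_law.
have intf (P : probability 'cV[R]_n R) :
    (\int[P]_x f (dot u x) = 1 + \int[P]_x (cos (dot u x + b))%:E)%E.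
  have -> : (1 = \int[P]_x 1)%E by rewrite integral_cst//= [X in (_ * X)%E](probability_setT P) mule1.
  rewrite -integralD//.
    by apply: integrable_bounded => //; exists 1 => x; rewrite normr1.
  apply: integrable_bounded; first exact: measurableT_comp mcos md.
  by exists 1 => x; rewrite ler_norml cos_le1 cos_geN1.
move: E12; rewrite !intf => /(congr1 (fun z => z - 1)%E).
by rewrite !(addeC 1%E) !addeK.
Qed.

Let trig_agree f : trig f -> (\int[P1]_x (f x)%:E = \int[P2]_x (f x)%:E)%E.
Proof.
elim=> [c u b|f1 f2 t1 e1 t2 e2].
  have i (P : probability 'cV[R]_n R) :
      P.-integrable setT (fun x => (cos (dot u x + b))%:E).
    have tc : trig (fun x => cos (dot u x + b)).
      by apply: trig_eq (trig_cos 1 u b) => x; rewrite mul1r.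
    by apply: integrable_bounded; [exact: measurable_trig|exact: trig_bounded].
  under eq_integral do rewrite EFinM.
  under [RHS]eq_integral do rewrite EFinM.
  by rewrite (integralZl _ (i P1))// (integralZl _ (i P2))// cos_agree.
under eq_integral do rewrite EFinD.
under [RHS]eq_integral do rewrite EFinD.
rewrite !integralD ?e1 ?e2//; apply: integrable_bounded;
  by [exact: measurable_trig|exact: trig_bounded].
Qed.

(* The sets where finitely many functions cos (u . x + b) are positive. *)
Let cellb (s : seq ('cV[R]_n * R)) (x : 'cV[R]_n) : bool :=
  all (fun ub => 0 < cos (dot ub.1 x + ub.2)) s.

Let cell s : set 'cV[R]_n := [set x | cellb s x].

Let cell_cat s r : cell s `&` cell r = cell (s ++ r).
Proof.
by apply/seteqP; split => x; rewrite /cell/cellb/= all_cat => /andP.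
Qed.

(* Composing [step_poly] with the cosines of a cell keeps a trigonometric
   polynomial and converges boundedly to the indicator of the cell. *)
Let approx (s : seq ('cV[R]_n * R)) k (x : 'cV[R]_n) : R :=
  \prod_(ub <- s) step_poly k (cos (dot ub.1 x + ub.2)).

Let cos_itv (x : R) : -1 <= cos x <= 1. Proof. by rewrite cos_le1 cos_geN1. Qed.

Let approx_trig s k : trig (approx s k).
Proof.
elim: s => [|[u b] s IH].
  by apply: trig_eq (trig_cst n 1) => x; rewrite /approx big_nil.
have tc : trig (fun x => step_poly k (cos (dot u x + b))).
  apply: trig_exp.
  apply: trig_eq (trig_add (trig_cst n 1) (trig_mul (trig_cst n (-1)) (trig_exp k
    (trig_add (trig_cst n (2^-1)) (trig_cos (- 2^-1) u b))))) => x /=.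
  by rewrite mulN1r mulrBl mul1r mulNr [cos _ / 2]mulrC.
by apply: trig_eq (trig_mul tc IH) => x; rewrite /approx big_cons.
Qed.

Let approx_itv s k x : 0 <= approx s k x <= 1.
Proof.
rewrite /approx; elim/big_ind: _ => [|a b /andP[a0 a1] /andP[b0 b1]|[u b] _].
- by rewrite ler01 lexx.
- by rewrite mulr_ge0//= mulr_ile1.
- exact/step_poly_itv/cos_itv.
Qed.

Let approx_cvg s x : approx s k x @[k --> \oo] --> ((cellb s x)%:R : R).
Proof.
elim: s => [|[u b] s IH].
  rewrite (_ : (fun k => _) = fun=> 1); first exact: cvg_cst.
  by apply/funext => k; rewrite /approx big_nil.
rewrite (_ : (fun k => _) = (fun k => step_poly k (cos (dot u x + b)) * approx s k x)).
  rewrite /cellb/= -mulnb natrM.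
  by apply: cvgM => //; exact/step_poly_cvg/cos_itv.
by apply/funext => k; rewrite /approx big_cons.
Qed.

Let measurable_cell s : measurable (cell s).
Proof.
rewrite -[cell s]setTI.
have mb : measurable_fun setT (cellb s).
  elim: s => [|[u b] s IH]; first by exact: measurable_cst.
  apply: measurable_and => //; apply: measurable_fun_ltr => //.
  apply: (@measurable_trig R n); apply: trig_eq (trig_cos 1 u b) => x.
  by rewrite mul1r.
exact: (mb measurableT [set true]).
Qed.

Let cell_lim (P : probability 'cV[R]_n R) s :
  (\int[P]_x (approx s k x)%:E)%E @[k --> \oo] --> P (cell s).
Proof.
rewrite -[cell s]setIT -integral_indic//.
have mapp k : measurable_fun setT (approx s k) by exact: measurable_trig (approx_trig s k).
have [] := @dominated_convergence _ _ R P setT measurableT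
  (fun k x => (approx s k x)%:E) (fun x => (\1_(cell s) x)%:E) (cst 1%E).
- by move=> k; apply/measurable_EFinP.
- by apply/measurable_EFinP; exact: measurable_indic.
- apply: aeW => x _; apply: cvg_EFin; first exact: nearW.
  have -> : \1_(cell s) x = (cellb s x)%:R :> R; last exact: approx_cvg.
  by rewrite indicE; congr (nat_of_bool _)%:R; apply/idP/idP; rewrite inE.
- apply: integrable_bounded; first exact: measurable_cst.
  by exists 1 => x; rewrite normr1.
- apply: aeW => x k _; rewrite lee_fin /=; have /andP[a0 a1] := approx_itv s k x.
  by rewrite ger0_norm.
- by [].
Qed.

Let cell_agree s : P1 (cell s) = P2 (cell s).
Proof.
have h1 := @cell_lim P1 s; have h2 := @cell_lim P2 s.
have e : (fun k => \int[P1]_x (approx s k x)%:E)%E =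
         (fun k => \int[P2]_x (approx s k x)%:E)%E.
  by apply/funext => k; exact: trig_agree.
by rewrite e in h1; exact: (cvg_unique _ h1 h2).
Qed.

(* For L large, |x i - c| / L < pi, and then sin ((x i - c) / L) has the sign of
   x i - c. The phase - pi / 2 turns the cosine of a cell into this sine. *)
Let half_space i (c : R) : [set x : 'cV[R]_n | c < x i 0] =
  \bigcup_k \bigcap_(L >= k) cell [:: (L.+1%:R^-1 *: delta_mx i 0,
                                      - (c / L.+1%:R) - pi / 2)].
Proof.
have sinE (x : 'cV[R]_n) (L : nat) : cell [:: (L.+1%:R^-1 *: delta_mx i 0,
    - (c / L.+1%:R) - pi / 2)] x <-> 0 < sin ((x i 0 - c) / L.+1%:R).
  rewrite /cell /cellb /= andbT dotZl dot_delta addrA cosBpihalf mulrBl.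
  by rewrite [_^-1 * _]mulrC.
have small (y : R) : exists k : nat, forall L : nat, (k <= L)%N -> `|y / L.+1%:R| < pi.
  exists (Num.truncn (`|y| / pi)) => L kL.
  rewrite normrM normfV normr_nat ltr_pdivrMr// mulrC -ltr_pdivrMr ?pi_gt0//.
  apply: lt_le_trans (truncnS_gt _) _; rewrite ler_nat//.
apply/seteqP; split => x /=.
  move=> cx; have [k hk] := small (x i 0 - c); exists k => // L /= kL.
  apply/sinE/sin_gt0_pi; have := hk L kL.
  have y0 : 0 < (x i 0 - c) / L.+1%:R by rewrite divr_gt0// subr_gt0.
  by rewrite gtr0_norm// => ->; rewrite y0.
move=> [k _ h]; rewrite ltNge; apply/negP => xc.
have [k' hk'] := small (x i 0 - c); pose L := maxn k k'.
have /sinE := h L (leq_maxl _ _); have := hk' L (leq_maxr _ _).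
have y0 : (x i 0 - c) / L.+1%:R <= 0.
  by rewrite pmulr_lle0 ?invr_gt0// subr_le0.
rewrite ler0_norm// => ypi; rewrite ltNge -oppr_ge0 -sinN sin_ge0_pi//.
by rewrite oppr_ge0 y0 ltW.
Qed.

(** The two probabilities agree on trigonometric polynomials, hence on cells by
    dominated convergence, hence on the sigma-algebra that this pi-system
    generates; it contains every half space x_i > c by [half_space]. *)
Lemma cramer_wold (A : set 'cV[R]_n) : measurable A -> P1 A = P2 A.
Proof.
pose G := [set cell s | s in setT].
have Gm : G `<=` measurable by move=> _ [s _ <-]; exact: measurable_cell.
have mG : @measurable _ 'cV[R]_n `<=` <<s G >>.
  apply: smallest_sub; first exact: smallest_sigma_algebra.
  pose GT : measurableType _ := g_sigma_algebraType G.
  move=> _ [[i j] _ [B mB <-]].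
  suff mi : measurable_fun (setT : set GT) (fun x : GT => (x : 'cV[R]_n) i 0).
    by have := mi measurableT _ mB; rewrite ord1.
  apply: (measurability _ (RGenOInfty.measurableE R)) => _ [_ [c ->] <-].
  rewrite setTI -[X in measurable X]/[set x : 'cV[R]_n | x i 0 \in `]c, +oo[] .
  under eq_set do rewrite in_itv/= andbT.
  rewrite half_space; apply: (@bigcupT_measurable _ GT) => k.
  apply: (@bigcap_measurable _ GT); first by exists k => /=.
  by move=> L _; apply: sub_sigma_algebra; eexists.
move=> /mG; apply: (@measure_agree _ _ _ P1 P2 G) => //.
- by move=> _ _ [s _ <-] [r _ <-]; rewrite cell_cat; exists (s ++ r).
- by exists [::] => //; apply/seteqP; split.
- by rewrite [ltLHS](probability_setT P1) ltry.
- by move=> _ [s _ <-]; exact: cell_agree.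
Qed.

End cramer_wold.

(** * Normal laws *)

Section density.
Context d (T : measurableType d) (R : realType).
Variables (mu nu : {measure set T -> \bar R}) (g : T -> R).
Hypothesis mg : measurable_fun setT g.
Hypothesis g0 : forall x, 0 <= g x.
Hypothesis nuE : forall A, measurable A -> nu A = (\int[mu]_(x in A) (g x)%:E)%E.

Import HBNNSimple.

Lemma integral_density (f : T -> \bar R) : measurable_fun setT f ->
  (forall x, 0 <= f x)%E -> (\int[nu]_x f x = \int[mu]_x (f x * (g x)%:E))%E.
Proof.
move=> mf f0; pose h := nnsfun_approx measurableT mf.
have mgE : measurable_fun setT (fun x => (g x)%:E) by exact/measurable_EFinP.
have h_cvg x : (h n x)%:E @[n --> \oo] --> f x.
  by apply: cvg_nnsfun_approx => // y _; exact: f0.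
have h_nd x : {homo (fun n => (h n x)%:E) : a b / (a <= b)%N >-> (a <= b)%E}.
  by move=> a b ab; rewrite lee_fin; exact/lefP/nd_nnsfun_approx.
transitivity (limn (fun n => \int[nu]_x (h n x)%:E)%E).
  rewrite -monotone_convergence//.
  - by apply: eq_integral => x _; apply/esym/cvg_lim => //; exact: h_cvg.
  - by move=> n; exact/measurable_EFinP.
  - by move=> n x _; rewrite lee_fin.
transitivity (limn (fun n => \int[mu]_x ((h n x)%:E * (g x)%:E))%E); last first.
  rewrite -monotone_convergence//.
  - apply: eq_integral => x _; apply/cvg_lim => //.
    by apply: cvgeZr => //; exact: h_cvg.
  - by move=> n; apply: emeasurable_funM => //; exact/measurable_EFinP.
  - by move=> n x _; rewrite mule_ge0 ?lee_fin.
  - by move=> x _ a b ab; rewrite lee_wpmul2r ?lee_fin//; have := h_nd x _ _ ab; rewrite lee_fin.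
congr (limn _); apply/funext => n.
have fin : finite_set (range (h n)) by exact: fimfunP.
transitivity (\int[nu]_x (\sum_(y \in range (h n))
    (y * \1_(h n @^-1` [set y]) x)%:E))%E.
  by apply: eq_integral => t _; rewrite /= fimfunE -fsumEFin.
have mi r : measurable (h n @^-1` [set r]) by [].
rewrite ge0_integral_fsum//; last 2 first.
- by move=> r; apply/measurable_EFinP; exact: measurable_funM.
- by move=> r x _; exact: nnfun_muleindic_ge0.
transitivity (\int[mu]_x (\sum_(y \in range (h n))
    (y * \1_(h n @^-1` [set y]) x)%:E * (g x)%:E))%E; last first.
  apply: eq_integral => x _.
  rewrite -ge0_mule_fsuml => [|y]; last exact: nnfun_muleindic_ge0.
  by rewrite fsumEFin // -(fimfunE _ x).
rewrite ge0_integral_fsum//; last 2 first.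
- move=> r; apply: emeasurable_funM => //; apply/measurable_EFinP.
  exact: measurable_funM.
- by move=> r x _; rewrite mule_ge0 ?lee_fin// -lee_fin nnfun_muleindic_ge0.
apply: eq_fsbigr => r; rewrite inE => -[x0 _ x0r].
have r0 : 0 <= r by rewrite -x0r.
under eq_integral do rewrite EFinM.
under [RHS]eq_integral do rewrite EFinM -muleA.
have mind : measurable_fun setT (fun x => (\1_(h n @^-1` [set r]) x : R)%:E).
  by apply/measurable_EFinP; exact: measurable_indic.
have mindg := emeasurable_funM mind mgE.
rewrite (ge0_integralZl nu measurableT mind)//.
rewrite (ge0_integralZl mu measurableT mindg)//; last first.
  by move=> x _; rewrite mule_ge0 ?lee_fin.
congr (_ * _)%E; rewrite integral_indic// setIT nuE// integral_mkcond.
apply: eq_integral => x _; rewrite restrict_EFin /patch/= indicE.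
by case: (x \in _); rewrite ?mul1e ?mul0e.
Qed.

End density.

Section lebesgue_affine.
Variables (R : realType) (c b : R).
Hypothesis c0 : c != 0.
Notation leb := (@lebesgue_measure R).

Let aff (x : measurableTypeR R) : measurableTypeR R := c * x + b.

Let maff : measurable_fun setT aff.
Proof. by apply: measurable_funD => //; exact: measurable_funM. Qed.

Let c' : {nonneg R} := NngNum (normr_ge0 c).

Let leb_aff : {measure set (measurableTypeR R) -> \bar R} := mscale c'
  (measure_function_pushforward__canonical__measure_function_Measure leb maff).

Let leb_affE (A : set (measurableTypeR R)) : measurable A -> leb A = leb_aff A.
Proof.
apply: lebesgue_measure_unique => _ [[x y] _ <-] /=.
rewrite -[RHS]/(`|c|%:E * leb (aff @^-1` `]x, y]))%E [aff @^-1` _](_ : _ =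
  if 0 < c then `](x - b) / c, (y - b) / c]%classic else `[(y - b) / c, (x - b) / c[%classic).
  rewrite lebesgue_measure_itv/= lte_fin.
  have [c1|c1] := ltP 0 c.
    rewrite lebesgue_measure_itv/= lte_fin ltr_pM2r ?invr_gt0// ltrD2r.
    case: ifP => _; last by rewrite mule0.
    by rewrite -!EFinD -EFinM gtr0_norm//; congr EFin; field; rewrite gt_eqF.
  have {}c1 : c < 0 by rewrite lt_neqAle c0.
  rewrite lebesgue_measure_itv/= lte_fin ltr_nM2r ?invr_lt0// ltrD2r.
  case: ifP => _; last by rewrite mule0.
  by rewrite -!EFinD -EFinM ltr0_norm//; congr EFin; field; rewrite lt_eqF.
apply/seteqP; split => z; rewrite /aff /=; case: ltP => c1; rewrite /= !in_itv/=.
- by rewrite ltr_pdivrMr// ler_pdivlMr// ltrBlDr lerBrDr [z * c]mulrC.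
- have {}c1 : c < 0 by rewrite lt_neqAle c0.
  by rewrite ler_ndivrMr// ltr_ndivlMr// ltrBlDr lerBrDr [z * c]mulrC andbC.
- by rewrite ltr_pdivrMr// ler_pdivlMr// ltrBlDr lerBrDr [z * c]mulrC.
- have {}c1 : c < 0 by rewrite lt_neqAle c0.
  by rewrite ler_ndivrMr// ltr_ndivlMr// ltrBlDr lerBrDr [z * c]mulrC andbC.
Qed.

Lemma lebesgue_integral_affine (f : R -> \bar R) : measurable_fun setT f ->
  (forall x, 0 <= f x)%E ->
  (\int[leb]_x f x = `|c|%:E * \int[leb]_x f (c * x + b)%R)%E.
Proof.
move=> mf f0; transitivity (\int[leb_aff]_x f x)%E.
  by apply: eq_measure_integral => A mA _; exact: leb_affE.
rewrite /leb_aff ge0_integral_mscale//; congr (_ * _)%E.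
by rewrite ge0_integral_pushforward.
Qed.

End lebesgue_affine.

Section gaussian.
Variable R : realType.
Notation leb := (@lebesgue_measure R).
Implicit Types (m s t c b x y : R) (E : set R).

Lemma integral_normal_prob m s (f : R -> \bar R) : measurable_fun setT f ->
  (forall x, 0 <= f x)%E ->
  (\int[normal_prob m s]_x f x = \int[leb]_x (f x * (normal_pdf m s x)%:E))%E.
Proof.
move=> mf f0; apply: integral_density => //.
- exact: measurable_normal_pdf.
- exact: normal_pdf_ge0.
Qed.

Lemma normal_probE m s E : measurable E ->
  normal_prob m s E = (\int[leb]_x ((\1_E x)%:E * (normal_pdf m s x)%:E))%E.
Proof.
move=> mE; rewrite -integral_normal_prob//; last first.
  by apply/measurable_EFinP; exact: measurable_indic.
by rewrite integral_indic// setIT.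
Qed.

Lemma normal_peakM s c : normal_peak (c * s) = `|c|^-1 * normal_peak s.
Proof.
rewrite /normal_peak -invfM; congr (_^-1).
by rewrite exprMn -mulrA -mulrnAr sqrtrM ?sqr_ge0// sqrtr_sqr.
Qed.

Lemma normal_pdf_affine m s c b x : c != 0 -> s != 0 ->
  `|c| * normal_pdf (c * m + b) (c * s) (c * x + b) = normal_pdf m s x.
Proof.
move=> c0 s0; rewrite !normal_pdfE ?mulf_neq0//= normal_peakM !mulrA divff ?normr_eq0// mul1r.
congr (_ * _); rewrite /normal_fun; congr expR; field.
by rewrite c0 s0.
Qed.

Lemma normal_prob_affine m s c b E : c != 0 -> s != 0 -> measurable E ->
  normal_prob m s [set x | E (c * x + b)] = normal_prob (c * m + b) (c * s) E.
Proof.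
move=> c0 s0 mE.
have maff : measurable_fun setT (fun x => c * x + b).
  by apply: measurable_funD => //; exact: measurable_funM.
have mE' : measurable [set x | E (c * x + b)].
  by rewrite -[X in measurable X]setTI; exact: maff.
pose G (y : measurableTypeR R) : \bar R :=
  ((\1_E y)%:E * (normal_pdf (c * m + b) (c * s) y)%:E)%E.
have mG : measurable_fun setT G.
  apply: emeasurable_funM; apply/measurable_EFinP; first exact: measurable_indic.
  exact: measurable_normal_pdf.
have G0 y : (0 <= G y)%E by rewrite mule_ge0 ?lee_fin ?normal_pdf_ge0.
have GE : (\int[leb]_y G y = `|c|%:E * \int[leb]_x G (c * x + b)%R)%E.
  exact: lebesgue_integral_affine.
rewrite (normal_probE _ _ mE') (normal_probE _ _ mE) [RHS]GE.
have mGa : measurable_fun setT (fun x : measurableTypeR R => G (c * x + b)).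
  exact: measurableT_comp mG maff.
rewrite -(ge0_integralZl leb measurableT mGa)//.
apply: eq_integral => x _.
by rewrite -(@normal_pdf_affine m s c b x c0 s0) EFinM muleCA.
Qed.

(** Completing the square: given the sum of two centered normal variables, each
    of them is again normal. *)
Lemma normal_pdf_mul s t x y : 0 < s -> 0 < t -> let r := Num.sqrt (s ^+ 2 + t ^+ 2) in
  normal_pdf y s x * normal_pdf 0 t y =
  normal_pdf 0 r x * normal_pdf (t ^+ 2 / r ^+ 2 * x) (s * t / r) y.
Proof.
move=> s0 t0 r.
have r2 : r ^+ 2 = s ^+ 2 + t ^+ 2 by rewrite sqr_sqrtr// addr_ge0// sqr_ge0.
have r0 : 0 < r by rewrite sqrtr_gt0 addr_gt0// exprn_gt0.
have st0 : 0 < s * t / r by rewrite divr_gt0// mulr_gt0.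
rewrite !normal_pdfE ?gt_eqF// mulrACA [RHS]mulrACA.
have -> : normal_peak s * normal_peak t = normal_peak r * normal_peak (s * t / r).
  have peakE (z : R) : 0 < z -> normal_peak z = z^-1 * normal_peak 1.
    by move=> z0; rewrite -[in LHS](mulr1 z) normal_peakM gtr0_norm.
  rewrite (peakE s)// (peakE t)// (peakE r)// (peakE (s * t / r))//.
  by field; rewrite !gt_eqF.
congr (_ * _); rewrite /normal_fun -!expRD; congr expR.
have -> : (s * t / r) ^+ 2 = s ^+ 2 * t ^+ 2 / r ^+ 2 by rewrite !exprMn exprVn.
rewrite r2; field.
by rewrite !gt_eqF//= addr_gt0// exprn_gt0.
Qed.

(** The factor |x| is absorbed by doubling the standard deviation, so that a
    first moment is bounded by the mass of another normal law. *)
Lemma normal_pdf_abs_le s x : 0 < s ->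
  `|x| * normal_pdf 0 s x <= (1 + 8 * s ^+ 2 / 3) * 2 * normal_pdf 0 (2 * s) x.
Proof.
move=> s0; set K := 1 + 8 * s ^+ 2 / 3.
have K0 : 0 <= K by rewrite addr_ge0// divr_ge0// mulr_ge0// exprn_ge0// ltW.
rewrite !normal_pdfE ?mulf_neq0 ?gt_eqF// normal_peakM.
pose u := 3 * x ^+ 2 / (8 * s ^+ 2).
have s20 : 0 < s ^+ 2 by rewrite exprn_gt0.
have u0 : 0 <= u.
  apply: divr_ge0; first by rewrite mulr_ge0// sqr_ge0.
  by rewrite mulr_ge0// ltW.
have xK : `|x| <= K * expR u.
  apply: (@le_trans _ _ (K * (1 + u))); last by rewrite ler_wpM2l// expR_ge1Dx.
  have -> : K * (1 + u) = K + u + x ^+ 2.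
    by rewrite /K /u; field; rewrite gt_eqF.
  have : `|x| <= 1 + x ^+ 2.
    by rewrite -(real_normK (num_real x)); have := sqr_ge0 (`|x| - 1); nra.
  have : 1 <= K by rewrite /K lerDl divr_ge0// mulr_ge0// ltW.
  lra.
have -> : normal_fun 0 s x = normal_fun 0 (2 * s) x * expR (- u).
  rewrite /normal_fun -expRD; congr expR; rewrite /u subr0; field.
  by rewrite gt_eqF.
rewrite (gtr0_norm (ltr0n _ 2)) !mulrA.
have -> : K * 2 * 2^-1 * normal_peak s * normal_fun 0 (2 * s) x =
   K * (normal_peak s * normal_fun 0 (2 * s) x) by field.
set p := normal_peak s * normal_fun 0 (2 * s) x.
have p0 : 0 <= p by rewrite mulr_ge0 ?normal_peak_ge0 ?normal_fun_ge0.
rewrite (_ : _ * expR (- u) = `|x| * expR (- u) * p); last by rewrite /p; ring.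
by apply: ler_wpM2r => //; rewrite expRN ler_pdivrMr ?expR_gt0.
Qed.

(** By [normal_pdf_mul], exchanging the integrals leaves the integral of a normal
    density over the inner variable. *)
Lemma normal_prob_conv s t E : 0 < s -> 0 < t -> measurable E ->
  (\int[normal_prob 0 t]_y normal_prob y s E =
   normal_prob 0 (Num.sqrt (s ^+ 2 + t ^+ 2)) E)%E.
Proof.
move=> s0 t0 mE; set r := Num.sqrt _.
have r0 : 0 < r by rewrite sqrtr_gt0 addr_gt0// exprn_gt0.
pose F (z : measurableTypeR R * measurableTypeR R) : \bar R :=
  ((\1_E z.2 * (normal_pdf z.1 s z.2 * normal_pdf 0 t z.1))%R)%:E.
have mpdf : measurable_fun setT (fun z : measurableTypeR R * measurableTypeR R =>
    normal_pdf z.1 s z.2).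
  under eq_fun do rewrite normal_pdfE ?gt_eqF//.
  apply: measurable_funM => //; apply: measurableT_comp => //=.
  apply: measurable_funM => //; apply: measurableT_comp => //.
  by apply: measurable_funX; exact: measurable_funB.
have mF : measurable_fun setT F.
  apply/measurable_EFinP; apply: measurable_funM.
    by apply: measurableT_comp => //; exact: measurable_indic.
  apply: measurable_funM => //; apply: measurableT_comp => //.
  exact: measurable_normal_pdf.
have F0 z : (0 <= F z)%E.
  by rewrite lee_fin !mulr_ge0// normal_pdf_ge0.
have FE y : (normal_prob y s E * (normal_pdf 0 t y)%:E = \int[leb]_x F (y, x))%E.
  rewrite (normal_probE _ _ mE) -ge0_integralZr//; last 3 first.
  - apply: emeasurable_funM; apply/measurable_EFinP; first exact: measurable_indic.
    exact: measurable_normal_pdf.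
  - by move=> x _; rewrite mule_ge0 ?lee_fin ?normal_pdf_ge0.
  - by rewrite lee_fin normal_pdf_ge0.
  by apply: eq_integral => x _; rewrite /F/= -!EFinM mulrA.
have mN : measurable_fun setT (fun y => normal_prob y s E).
  under eq_fun do rewrite (normal_probE _ _ mE).
  pose F1 (z : measurableTypeR R * measurableTypeR R) : \bar R :=
    ((\1_E z.2 * normal_pdf z.1 s z.2)%R)%:E.
  apply: (@measurable_fun_fubini_tonelli_F _ _ _ _ R leb F1).
  - apply/measurable_EFinP; apply: measurable_funM => //.
    by apply: measurableT_comp => //; exact: measurable_indic.
  - by move=> z; rewrite lee_fin mulr_ge0// normal_pdf_ge0.
rewrite integral_normal_prob//.
transitivity (\int[leb]_y \int[leb]_x F (y, x))%E.
  by apply: eq_integral => y _; exact: FE.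
rewrite (@fubini_tonelli _ _ _ _ _ leb leb F mF F0) (normal_probE _ _ mE).
apply: eq_integral => x _; rewrite /F /=.
under eq_integral do rewrite (@normal_pdf_mul s t x _ s0 t0) mulrA EFinM.
rewrite ge0_integralZl//.
- by rewrite integral_normal_pdf mule1 EFinM.
- by apply/measurable_EFinP; exact: measurable_normal_pdf.
- by move=> y _; rewrite lee_fin normal_pdf_ge0.
- by rewrite lee_fin mulr_ge0// normal_pdf_ge0.
Qed.

End gaussian.

Section normal_variables.
Context d (Omega : measurableType d) (R : realType) (P : probability Omega R).
Implicit Types (X Y : Omega -> R) (v w : R).

Lemma normal_lawE v : 0 < v -> normal_law 0 v = normal_prob 0 (Num.sqrt v).
Proof. by move=> v0; rewrite /normal_law gt_eqF. Qed.

Lemma has_normal_law_scale X c : has_normal_law P 0 1 X ->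
  has_normal_law P 0 (c ^+ 2) (fun z => c * X z).
Proof.
move=> [mX lX]; split; first exact: measurable_funM.
move=> E mE; have [->|c0] := eqVneq c 0.
  rewrite expr0n /normal_law eqxx /=.
  under eq_fun do rewrite mul0r.
  rewrite diracE; case: (boolP (0 \in E)); rewrite ?inE ?notin_setE => h.
    rewrite (_ : _ @^-1` _ = setT) ?probability_setT//.
    by apply/seteqP; split.
  rewrite (_ : _ @^-1` _ = set0) ?measure0//.
  by apply/seteqP; split => // z; rewrite /= => /h.
rewrite /normal_law expf_eq0/= (negbTE c0) sqrtr_sqr.
have mc : measurable_fun setT (fun x : R => c * x) by exact: measurable_funM.
have mE' : measurable [set x | E (c * x + 0)].
  by under eq_set do rewrite addr0; rewrite -[X in measurable X]setTI; exact: mc.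
have := lX _ mE'; rewrite /normal_law oner_eq0 sqrtr1 normal_prob_affine ?oner_eq0// => h.
transitivity (normal_prob (c * 0 + 0) (c * 1) E).
  by rewrite -h; congr (P _); apply/seteqP; split => x /=; rewrite addr0.
rewrite mulr0 addr0 mulr1.
(* the density only depends on the square of the standard deviation *)
have -> : normal_prob 0 c = normal_prob 0 `|c| :> (set R -> \bar R); last by [].
rewrite /normal_prob; apply/funext => V; apply: eq_integral => x _.
rewrite !normal_pdfE ?normr_eq0// /normal_peak /normal_fun.
by rewrite -normrX (ger0_norm (sqr_ge0 _)).
Qed.

Lemma has_normal_law_add X Y v w : 0 <= v -> 0 <= w ->
  has_normal_law P 0 v X -> has_normal_law P 0 w Y ->
  independent P (g_sigma_algebra_preimage X) (g_sigma_algebra_preimage Y) ->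
  has_normal_law P 0 (v + w) (fun z => X z + Y z).
Proof.
move=> v0 w0 [mX lX] [mY lY] iXY; split; first exact: measurable_funD.
(* the copy of R that carries the Lebesgue measure *)
pose RL := measurableTypeR R.
have mX' : @measurable_fun _ _ Omega RL setT X by exact: mX.
have mY' : @measurable_fun _ _ Omega RL setT Y by exact: mY.
move=> E mE.
have madd : measurable_fun setT (fun z : RL * RL => z.1 + z.2) by exact: measurable_funD.
have mEadd : measurable [set z : RL * RL | E (z.1 + z.2)].
  by rewrite -[X in measurable X]setTI; exact: madd.
have mEx (x : RL) : measurable [set y : RL | E (x + y)].
  have := measurable_xsection x mEadd; congr measurable.
  by apply/seteqP; split => y /=; rewrite /xsection/= inE.
have -> : P ((fun z => X z + Y z) @^-1` E) =
    (\int[law P mX']_x normal_law 0 w [set y : RL | E (x + y)%R])%E.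
  rewrite -[LHS]/(P [set z | [set z : RL * RL | E (z.1 + z.2)] (X z, Y z)]).
  rewrite (independent_joint_law mX' mY' iXY mEadd)/= /product_measure1.
  apply: eq_integral => x _ /=; rewrite -(lY _ (mEx x)); congr (P _).
  by apply/seteqP; split => z /=; rewrite /xsection/= inE.
have mL : measurable_fun setT
    (fun x : RL => normal_law 0 w [set y : RL | E (x + y)%R] : \bar R).
  have := measurable_fun_xsection (law P mY') mEadd.
  apply: eq_measurable_fun => x _ /=; rewrite -(lY _ (mEx x)); congr (P _).
  by apply/seteqP; split => z /=; rewrite /xsection/= inE.
have lawX : forall A, measurable A -> law P mX' A = normal_law 0 v A by exact: lX.
(* point masses are normal laws of variance 0 and have no density *)
have [w00|wn0] := eqVneq w 0.
  rewrite w00 addr0 -lX// -[RHS]/(law P mX' E) -[in RHS](setIT E) -integral_indic//.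
  apply: eq_integral => x _; rewrite /normal_law eqxx diracE indicE.
  congr (nat_of_bool _)%:R%:E; apply/idP/idP; by rewrite !inE/= addr0.
have wgt : 0 < w by rewrite lt_neqAle eq_sym wn0.
have [v00|vn0] := eqVneq v 0.
  have {}lawX A : measurable A -> law P mX' A = \d_(0 : RL) A.
    by move=> /lawX ->; rewrite v00 /normal_law eqxx.
  rewrite v00 add0r.
  rewrite (eq_measure_integral (dirac (0 : RL))); last by move=> A mA _; exact: lawX.
  rewrite integral_dirac// diracE in_setT mul1e.
  by congr (normal_law _ _ _); apply/seteqP; split => y /=; rewrite add0r.
have vgt : 0 < v by rewrite lt_neqAle eq_sym vn0.
rewrite (eq_measure_integral (normal_prob 0 (Num.sqrt v))); last first.
  by move=> A mA _; rewrite [LHS]lawX// normal_lawE.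
rewrite (normal_lawE wgt) normal_lawE ?addr_gt0//.
have -> : v + w = Num.sqrt w ^+ 2 + Num.sqrt v ^+ 2.
  by rewrite !sqr_sqrtr// addrC.
have sw : 0 < Num.sqrt w by rewrite sqrtr_gt0.
have sv : 0 < Num.sqrt v by rewrite sqrtr_gt0.
rewrite -[RHS](normal_prob_conv sw sv mE); apply: eq_integral => x _.
have := @normal_prob_affine R 0 (Num.sqrt w) 1 x E (oner_neq0 _) (lt0r_neq0 sw) mE.
rewrite mulr0 add0r mul1r => <-; congr (normal_prob _ _ _).
by apply/seteqP; split => y /=; rewrite mul1r addrC.
Qed.

Lemma normal_abs_moment X v : 0 <= v -> has_normal_law P 0 v X ->
  (\int[P]_z `|X z|%:E < +oo)%E.
Proof.
move=> v0 [mX lX].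
pose RL := measurableTypeR R.
have mX' : @measurable_fun _ _ Omega RL setT X by exact: mX.
have mabs : measurable_fun setT (fun x : RL => `|x|%:E).
  suff : measurable_fun setT (fun x : R => `|x|%:E) by [].
  by apply/measurable_EFinP; exact: normr_measurable.
have abs0 (x : RL) : (0 <= `|x|%:E)%E by rewrite lee_fin.
rewrite -(integral_law P mX' mabs abs0).
have [v00|vn0] := eqVneq v 0.
  rewrite (eq_measure_integral (dirac (0 : RL))); last first.
    by move=> A mA _; rewrite /= -[LHS]/(P (X @^-1` A)) lX// v00 /normal_law eqxx.
  by rewrite integral_dirac// diracE in_setT mul1e normr0 ltry.
have vgt : 0 < v by rewrite lt_neqAle eq_sym vn0.
set s := Num.sqrt v; have s0 : 0 < s by rewrite sqrtr_gt0.
rewrite (eq_measure_integral (normal_prob 0 s)); last first.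
  by move=> A mA _; rewrite /= -[LHS]/(P (X @^-1` A)) lX// normal_lawE.
rewrite integral_normal_prob//.
pose K := 1 + 8 * s ^+ 2 / 3.
have K0 : 0 < K by rewrite addr_gt0// divr_gt0// mulr_gt0// exprn_gt0.
apply: (@le_lt_trans _ _ (\int[@lebesgue_measure R]_x
    ((K * 2)%:E * (normal_pdf 0 (2 * s) x)%:E)))%E; last first.
  rewrite ge0_integralZl ?integral_normal_pdf ?mule1 ?ltry//.
  - by apply/measurable_EFinP; exact: measurable_normal_pdf.
  - by move=> x _; rewrite lee_fin normal_pdf_ge0.
  - by rewrite lee_fin mulr_ge0// ltW.
apply: ge0_le_integral => //.
- by move=> x _; rewrite mule_ge0 ?lee_fin ?normal_pdf_ge0.
- apply: emeasurable_funM => //; apply/measurable_EFinP.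
  exact: measurable_normal_pdf.
- by apply: emeasurable_funM => //; apply/measurable_EFinP; exact: measurable_normal_pdf.
by move=> x _; rewrite -!EFinM lee_fin; exact: normal_pdf_abs_le.
Qed.

End normal_variables.

Section iid_paths.
Context (I : choiceType) d (Omega : measurableType d) d' (T : measurableType d')
  (R : realType) (P : probability Omega R).
Variables (Y : I -> Omega -> T) (nu : set T -> \bar R).
Hypothesis iidY : iid_law P Y nu.

Lemma iid_independent_maps (K1 K2 : Type) (s1 : K1 -> I) (s2 : K2 -> I)
    d1 d2 (S1 : measurableType d1) (S2 : measurableType d2)
    (f : path_space K1 T -> S1) (g : path_space K2 T -> S2) :
  (forall a b, s1 a <> s2 b) -> measurable_fun setT f -> measurable_fun setT g ->
  independent P (g_sigma_algebra_preimage (fun w => f (fun a => Y (s1 a) w)))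
    (g_sigma_algebra_preimage (fun w => g (fun b => Y (s2 b) w))).
Proof.
move=> s12 mf mg; pose J : set I := range s1; pose K : set I := range s2.
have JK : J `&` K = set0.
  by apply/seteqP; split => // i [[a _ <-] [b _ /esym/s12]].
apply: independent_sub (iid_independent iidY JK).
- apply: subset_trans (path_preimage_sub (Y := fun a => Y (s1 a)) mf) _.
  apply: g_sigma_family_sub => a.
  have Ja : J (s1 a) by exists a.
  by exists (exist _ (s1 a) Ja).
- apply: subset_trans (path_preimage_sub (Y := fun b => Y (s2 b)) mg) _.
  apply: g_sigma_family_sub => b.
  have Kb : K (s2 b) by exists b.
  by exists (exist _ (s2 b) Kb).
Qed.

End iid_paths.

Lemma iid_path_integral (I : choiceType) d1 d2 (Omega1 : measurableType d1)
    (Omega2 : measurableType d2) d' (T : measurableType d') (R : realType)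
    (P1 : probability Omega1 R) (P2 : probability Omega2 R)
    (Y1 : I -> Omega1 -> T) (Y2 : I -> Omega2 -> T) (nu : set T -> \bar R)
    (F : path_space I T -> \bar R) :
  iid_law P1 Y1 nu -> iid_law P2 Y2 nu ->
  measurable_fun setT F -> (forall x, 0 <= F x)%E ->
  (\int[P1]_w F (fun i => Y1 i w) = \int[P2]_w F (fun i => Y2 i w))%E.
Proof.
move=> i1 i2 mF F0.
have m1 : measurable_fun setT (fun w => (fun i => Y1 i w) : path_space I T).
  by apply: measurable_path => i; exact: i1.1.
have m2 : measurable_fun setT (fun w => (fun i => Y2 i w) : path_space I T).
  by apply: measurable_path => i; exact: i2.1.
rewrite -(integral_law P1 m1 mF F0) -(integral_law P2 m2 mF F0).
by apply: eq_measure_integral => A mA _; exact: (iid_path_law i1 i2 mA).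
Qed.

(** * Moments of small order *)

Section fractional_moment.
Context d (Omega : measurableType d) (R : realType) (P : probability Omega R).

Lemma expR_sub1_cvg (L : R) :
  k.+1%:R * (1 - expR (L / k.+1%:R)) @[k --> \oo] --> - L.
Proof.
have c0 : L / k.+1%:R @[k --> \oo] --> (0 : R).
  rewrite -[X in _ --> X](mulr0 L); apply: cvgM; first exact: cvg_cst.
  exact: cvg_harmonic.
have c1 : expR (L / k.+1%:R) @[k --> \oo] --> (1 : R).
  rewrite -[X in _ --> X]expR0.
  by apply: (cvg_comp (fun k => L / k.+1%:R) expR c0); exact: continuous_expR.
have cL : - (L * expR (L / k.+1%:R)) @[k --> \oo] --> - L.
  rewrite -[X in _ --> - X]mulr1; apply: cvgN; apply: cvgM => //.
  exact: cvg_cst.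
apply: (squeeze_cvgr _ cL (cvg_cst (- L))).
apply: nearW => k; have k0 : (0 : R) < k.+1%:R by [].
set y := L / k.+1%:R; have -> : L = k.+1%:R * y by rewrite /y mulrC divfK// gt_eqF.
have h1 := expR_ge1Dx y; have h2 := expR_ge1Dx (- y).
have h3 : expR y * expR (- y) = 1 by rewrite -expRD subrr expR0.
have h4 := expR_gt0 y.
apply/andP; split; last by nra.
by rewrite -mulrA -mulrN ler_wpM2l// ; nra.
Qed.

Lemma powR_bernoulli (x : R) k : 0 <= x ->
  0 <= k.+1%:R * (1 - x `^ k.+1%:R^-1) + (x - 1).
Proof.
move=> x0; set y := x `^ _.
have y0 : 0 <= y by exact: powR_ge0.
have xE : x = y ^+ k.+1.
  by rewrite -powR_mulrn// /y -powRrM mulVf ?powRr1.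
have := @bernoulli R (y - 1) k.+1.
rewrite [1 + (y - 1)]addrC subrK => /(_ y0).
by rewrite -xE; lra.
Qed.

Lemma powR_le1D (x s : R) : 0 <= x -> 0 <= s <= 1 -> x `^ s <= 1 + x.
Proof.
move=> x0 /andP[s0 s1]; have [x1|/ltW x1] := leP x 1.
  rewrite (@le_trans _ _ 1) ?lerDl//.
  have <- : 1 `^ s = 1 by rewrite powR1.
  by rewrite ge0_ler_powR// nnegrE.
rewrite (@le_trans _ _ x) ?lerDr//.
by rewrite -[leRHS]powRr1// ler_powR.
Qed.

(** As s decreases to 0, (x^s - 1) / s decreases to log x. Suppose E f^s >= 1 for
    all s. The functions g k = k (1 - f^(1/k)) + f - 1 are nonnegative, have
    integral at most E (f - 1), and converge to f - 1 - log f; by Fatou's lemma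
    E (f - 1 - log f) <= E (f - 1), that is E log f >= 0. *)
Lemma lne_moment_lt1 (f : Omega -> R) : measurable_fun setT f ->
  (forall w, 0 <= f w) -> (\int[P]_w (f w)%:E < +oo)%E ->
  (\int[P]_w lne (f w)%:E < 0)%E ->
  exists2 s : R, 0 < s <= 1 & (\int[P]_w (f w `^ s)%:E < 1)%E.
Proof.
move=> mf f0 intf lf; apply: contrapT => hn.
have mp (s : R) : measurable_fun setT (fun w => f w `^ s).
  exact: (measurableT_comp (measurable_powR s) mf).
have intP (h : Omega -> R) : measurable_fun setT h -> (forall w, `|h w| <= 1 + f w) ->
    P.-integrable setT (EFin \o h).
  move=> mh hf; apply/integrableP; split; first exact/measurable_EFinP.
  apply: (@le_lt_trans _ _ (\int[P]_w (1 + (f w)%:E))%E).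
    apply: ge0_le_integral => //.
    - by apply: measurableT_comp => //; exact/measurable_EFinP.
    - by apply: emeasurable_funD => //; exact/measurable_EFinP.
    - by move=> w _; rewrite /= -EFinD lee_fin.
  rewrite ge0_integralD//; last 2 first.
  - by move=> w _; rewrite lee_fin.
  - exact/measurable_EFinP.
  by rewrite integral_cst//= mul1e probability_setT lte_add_pinfty ?ltry.
pose g k w : R := k.+1%:R * (1 - f w `^ k.+1%:R^-1) + (f w - 1).
have g0 k w : 0 <= g k w by exact: powR_bernoulli.
have mg k : measurable_fun setT (g k).
  apply: measurable_funD; last exact: measurable_funB.
  by apply: measurable_funM => //; exact: measurable_funB.
pose G w : \bar R := ((f w - 1)%:E - lne (f w)%:E)%E.
have gG w : (g k w)%:E @[k --> \oo] --> G w.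
  rewrite /G /g; have [fw0|fwn0] := eqVneq (f w) 0.
    rewrite fw0 le0_lneNy// sub0r /=.
    have -> : ((-1)%:E - -oo = +oo :> \bar R)%E by [].
    apply/cvgeyPge => A; near=> k.
    rewrite lee_fin powR0 ?invr_eq0 ?pnatr_eq0// subr0 mulr1 -natr1 addrK.
    by near: k; exact: nbhs_infty_ger.
  have fgt : 0 < f w by rewrite lt_neqAle eq_sym fwn0 f0.
  rewrite lne_EFin// -EFinB [X in X%:E]addrC.
  apply: cvg_EFin; first exact: nearW.
  apply: (@cvg_trans _ (k.+1%:R * (1 - expR (ln (f w) / k.+1%:R)) + (f w - 1) @[k --> \oo])).
    apply: near_eq_cvg; apply: nearW => k /=.
    by rewrite /powR (negbTE fwn0) [_^-1 * _]mulrC//.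
  by apply: cvgD; [exact: expR_sub1_cvg|exact: cvg_cst].
have mG : measurable_fun setT G.
  apply: (emeasurable_fun_cvg (fun k w => (g k w)%:E)) => [k|w _].
    exact/measurable_EFinP.
  exact: gG.
have G0 w : (0 <= G w)%E.
  rewrite -(cvg_lim _ (gG w))//; apply: lime_ge; first by apply/cvg_ex; exists (G w); exact: gG.
  by apply: nearW => k; rewrite lee_fin.
have intf1 : P.-integrable setT (fun w => (f w - 1)%:E).
  apply: intP => [|w]; first exact: measurable_funB.
  by rewrite (le_trans (ler_normB _ _))// normr1 ger0_norm// addrC.
have intgk k : (\int[P]_w (g k w)%:E <= \int[P]_w (f w - 1)%:E)%E.
  pose s : R := k.+1%:R^-1.
  have s01 : 0 < s <= 1 by rewrite invr_gt0 ltr0n/= invf_le1// ler1n.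
  have ints : P.-integrable setT (fun w => (1 - f w `^ s)%:E).
    apply: intP => [|w]; first exact: measurable_funB.
    have s01' : 0 <= s <= 1 by case/andP: s01 => /ltW -> ->.
    have h1 := powR_le1D (f0 w) s01'; have h2 := powR_ge0 (f w) s.
    by rewrite ler_norml; have := f0 w; lra.
  have gE w : (g k w)%:E = (k.+1%:R%:E * (1 - f w `^ s)%:E + (f w - 1)%:E)%E.
    by rewrite -EFinM -EFinD.
  under eq_integral do rewrite gE.
  rewrite integralD//; last exact: integrableZl.
  rewrite integralZl// -[leRHS]add0e leeD2r//.
  apply: mule_ge0_le0; first by rewrite lee_fin.
  have -> : (\int[P]_w (1 - f w `^ s)%:E = 1 - \int[P]_w (f w `^ s)%:E)%E.
    have intfs : P.-integrable setT (fun w => (f w `^ s)%:E).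
      apply: intP => // w; rewrite ger0_norm ?powR_ge0// powR_le1D//.
      by case/andP: s01 => /ltW -> ->.
    under eq_integral do rewrite EFinB.
    rewrite integralB//; last first.
      apply: intP => // w; rewrite normr1 lerDl//.
    by rewrite integral_cst//= mul1e probability_setT.
  rewrite sube_le0 leNgt; apply/negP => lt1.
  by apply: hn; exists s.
have intG : (\int[P]_w G w <= \int[P]_w (f w - 1)%:E)%E.
  have limE w : limn_einf (fun k => (g k w)%:E) = G w.
    by have [-> _] := cvg_limn_einf_sup (gG w).
  under eq_integral do rewrite -limE.
  apply: le_trans.
    apply: (@fatou _ _ _ P setT measurableT (fun k w => (g k w)%:E)).
      by move=> k; exact/measurable_EFinP.
    by move=> k w _; rewrite lee_fin.
  rewrite limn_einf_lim; apply: lime_le; first exact: is_cvg_einfs.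
  apply: nearW => k; apply: le_trans (intgk k).
  by apply: ereal_inf_lbound; exists k => /=.
have iG : P.-integrable setT G.
  apply/integrableP; split => //.
  under eq_integral do rewrite gee0_abs//.
  apply: le_lt_trans intG _.
  have /integrableP[_] := intf1; apply: le_lt_trans.
  apply: le_trans (le_abse_integral _ _ _) => //; last exact/measurable_EFinP/measurable_funB.
  exact: lee_abs.
have lE w : (lne (f w)%:E = (f w - 1)%:E - G w)%E.
  rewrite /G; case: (lne _) => [r| |] //.
  by rewrite -!EFinB opprB addrC subrK.
move: lf; under eq_integral do rewrite lE.
rewrite integralB// ltNge.
rewrite sube_ge0 ?intG//.
by rewrite integrable_fin_num.
Unshelve. all: by end_near. Qed.
End fractional_moment.

(** Splitting off the first p terms, the sum S up to p j satisfies
    S <= K + r p S, so S <= K / (1 - r p). *)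
Lemma submultiplicative_summable (R : realType) (r : nat -> R) p :
  (forall k, 0 <= r k) -> (forall k m, r (k + m)%N <= r k * r m) ->
  (0 < p)%N -> r p < 1 -> cvgn (series r).
Proof.
move=> r0 rD p0 rp; pose K := \sum_(0 <= i < p) r i.
have K0 : 0 <= K by exact: sumr_ge0.
have rp1 : 0 < 1 - r p by rewrite subr_gt0.
have bd j : \sum_(0 <= i < p * j) r i <= K / (1 - r p).
  elim: j => [|j IH]; first by rewrite muln0 big_nil divr_ge0// ltW.
  rewrite mulnS (big_cat_nat (n := p))//= ?leq_addr//.
  rewrite [X in _ + X](_ : _ = \sum_(0 <= i < p * j) r (i + p)%N); last first.
    by rewrite -{1}[p]add0n big_addn addKn.
  apply: (@le_trans _ _ (K + r p * (K / (1 - r p)))); last first.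
    have e : K + r p * (K / (1 - r p)) = K / (1 - r p) by field; rewrite gt_eqF.
    by rewrite e.
  rewrite lerD2l; apply: le_trans (ler_wpM2l (r0 p) IH).
  rewrite mulr_sumr; apply: ler_sum => i _.
  by rewrite addnC rD.
apply: nondecreasing_is_cvgn; first by apply: nondecreasing_series => i _ _.
exists (K / (1 - r p)) => _ [k _ <-]; apply: le_trans (bd k).
rewrite /series /= [leRHS](big_cat_nat (n := k))//= ?leq_pmull//.
by rewrite lerDl sumr_ge0.
Qed.

Lemma ae_forall_int d (Omega : measurableType d) (R : realType)
    (P : probability Omega R) (Pr : int -> Omega -> Prop) :
  (forall t, {ae P, forall w, Pr t w}) -> {ae P, forall w, forall t, Pr t w}.
Proof.
move=> h.
have : {ae P, forall w, forall k : nat, if unpickle k is Some t then Pr t w else True}.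
  apply: ae_foralln => k; case: (unpickle k) => [t|]; first exact: h.
  by apply: aeW.
by apply: filterS => w hw t; have := hw (pickle t); rewrite pickleK.
Qed.

(** * Stationary recurrences with independent coefficients *)

Section factors.
Context d (Omega : measurableType d) d' (T : measurableType d') (R : realType)
  (P : probability Omega R).
Variables (Y : int -> Omega -> T) (nu : set T -> \bar R).
Hypothesis iidY : iid_law P Y nu.
Context d'' (S : measurableType d'').
Variable F : path_space int T -> S.
Hypothesis mF : measurable_fun setT F.

Lemma measurable_pathY : measurable_fun setT (fun w => Y^~ w : path_space int T).
Proof. by apply: measurable_path => i; exact: iidY.1. Qed.

Lemma factor_stationary : strictly_stationary P (fun t w => F (path_shift t (Y^~ w))).
Proof.
move=> k ts h E mE.
pose G (y : path_space int T) := [tuple F (path_shift (tnth ts i) y) | i < k].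
have mG : measurable_fun setT G.
  apply/measurable_fun_tnthP => i.
  have -> : (@tnth k S)^~ i \o G = F \o path_shift (tnth ts i).
    by apply/funext => y /=; rewrite tnth_mktuple.
  by apply: measurableT_comp => //; exact: measurable_path_shift.
have mA : measurable (G @^-1` E) by rewrite -[_ @^-1` _]setTI; exact: mG.
have iidh : iid_law P (fun t => Y (t + h)) nu.
  by apply: (iid_reindex (f := fun t => t + h)) iidY => a b /addIr.
rewrite -[RHS](iid_path_law iidh iidY mA).
congr (P _); apply/funext => w /=; congr (E _).
apply: eq_from_tnth => i; rewrite !tnth_mktuple; congr (F _).
by apply/funext => u; rewrite /path_shift addrA.
Qed.

(** An invariant event of the factor pulls back to an invariant event of the
    i.i.d. path. *)
Lemma factor_ergodic : ergodic P (fun t w => F (path_shift t (Y^~ w))).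
Proof.
move=> E mE Einv.
pose G (y : path_space int T) : path_space int S := fun t => F (path_shift t y).
have mG : measurable_fun setT G.
  apply: measurable_path => t; apply: measurableT_comp => //; exact: measurable_path_shift.
have mA : measurable (G @^-1` E) by rewrite -[_ @^-1` _]setTI; exact: mG.
have iidmu : iid_law (law P measurable_pathY) (fun t (y : path_space int T) => y t) nu.
  split=> [i|U s mU us]; first exact: measurable_coord.
  exact: iidY.2.
apply: (path_shift_invariant01 iidmu mA) => y /=.
rewrite -(Einv (G y)) /G.
suff -> : (fun t => F (path_shift t (path_shift 1 y))) = (fun t => F (path_shift (t + 1) y)) by [].
apply/funext => t; congr F; apply/funext => u; rewrite /path_shift.
by rewrite -addrA.
Qed.

End factors.

Lemma stationary_marginal d (Omega : measurableType d) (R : realType)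
    (P : probability Omega R) d' (T : measurableType d') (X : int -> Omega -> T)
    (s t : int) E :
  strictly_stationary P X -> measurable E -> P (X s @^-1` E) = P (X t @^-1` E).
Proof.
move=> sX mE; pose F : set (1.-tuple T) := (fun x => tnth x ord0) @^-1` E.
have mF : measurable F by rewrite -[F]setTI; exact: measurable_tnth.
have := sX 1%N [tuple t] (s - t) F mF.
have -> : [set w | F [tuple X (tnth [tuple t] i + (s - t)) w | i < 1]] = X s @^-1` E.
  by apply/funext => w; rewrite /F /= tnth_mktuple /= addrC subrK.
move=> ->.
by congr (P _); apply/funext => w; rewrite /F /= tnth_mktuple.
Qed.

Lemma subz1n (t : int) (i : nat) : t - 1 - i%:Z = t - i.+1%:Z.
Proof. by rewrite -addrA -opprD -PoszD add1n. Qed.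

Section recursion.
Context (R : realType) (n : nat).
Implicit Types y : nat -> 'M[R]_n * 'cV[R]_n.

Definition sre_prod y k : 'M[R]_n := \prod_(i < k) (y i).1.
Definition sre_term y k : 'cV[R]_n := sre_prod y k *m (y k).2.
Definition sre_sum y K : 'cV[R]_n := \sum_(k < K) sre_term y k.

(** The superior limit makes the value of the series measurable on all paths. *)
Definition sre_lim y : 'cV[R]_n :=
  \col_i fine (limn_esup (fun K => (sre_sum y K i 0)%:E)).

Lemma sre_prodS y k : sre_prod y k.+1 = (y 0%N).1 *m sre_prod (y \o S) k.
Proof. by rewrite /sre_prod big_ord_recl. Qed.

Lemma sre_sumS y K :
  sre_sum y K.+1 = (y 0%N).1 *m sre_sum (y \o S) K + (y 0%N).2.
Proof.
rewrite /sre_sum big_ord_recl addrC mulmx_sumr; congr (_ + _).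
  apply: eq_bigr => i _.
  by rewrite /sre_term lift0 sre_prodS mulmxA.
by rewrite /sre_term /sre_prod big_ord0 mul1mx.
Qed.

Definition sre_cvg y := forall i, cvgn (fun K => sre_sum y K i 0).

Lemma sre_limP y : sre_cvg y -> forall i, sre_sum y K i 0 @[K --> \oo] --> sre_lim y i 0.
Proof.
move=> cy i; have /cvg_ex[l cl] := cy i; rewrite mxE.
have : (sre_sum y K i 0)%:E @[K --> \oo] --> l%:E by apply: cvg_EFin => //; exact: nearW.
by move=> /cvg_limn_einf_sup[_ ->].
Qed.

Lemma sre_limE y : sre_cvg (y \o S) ->
  sre_lim y = (y 0%N).1 *m sre_lim (y \o S) + (y 0%N).2.
Proof.
move=> cy.
have c i : sre_sum y K i 0 @[K --> \oo] --> ((y 0%N).1 *m sre_lim (y \o S) + (y 0%N).2) i 0.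
  rewrite -cvg_shiftS /=.
  apply: (@cvg_trans _ (\sum_j (y 0%N).1 i j * sre_sum (y \o S) K j 0 +
      (y 0%N).2 i 0 @[K --> \oo])).
    by apply: near_eq_cvg; apply: nearW => K; rewrite sre_sumS !mxE.
  have -> : ((y 0%N).1 *m sre_lim (y \o S) + (y 0%N).2) i 0 =
      \sum_j (y 0%N).1 i j * sre_lim (y \o S) j 0 + (y 0%N).2 i 0.
    by rewrite mxE [X in X + _]mxE.
  apply: cvgD; last exact: cvg_cst.
  apply: cvg_finite_sum => j; apply: cvgM; first exact: cvg_cst.
  exact: sre_limP.
have cy' : sre_cvg y by move=> i; apply/cvg_ex; eexists; exact: c.
apply/matrixP => i j; rewrite ord1.
have := @sre_limP y cy' i; have := c i.
by move=> /cvg_lim <- // /cvg_lim ->.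
Qed.

Context d (Omega : measurableType d).
Variable y : Omega -> nat -> 'M[R]_n * 'cV[R]_n.
Hypothesis my : forall i, measurable_fun setT (fun w => y w i).

Lemma measurable_sre_prod k : measurable_fun setT (fun w => sre_prod (y w) k).
Proof.
elim: k => [|k IH].
  by rewrite /sre_prod; under eq_fun do rewrite big_ord0; exact: measurable_cst.
rewrite /sre_prod; under eq_fun do rewrite big_ord_recr.
by apply: measurable_mulmx => //; apply: (measurableT_comp measurable_fst).
Qed.

Lemma measurable_sre_term k : measurable_fun setT (fun w => sre_term (y w) k).
Proof.
apply: measurable_mulmx; first exact: measurable_sre_prod.
exact: (measurableT_comp measurable_snd).
Qed.

Lemma measurable_sre_lim : measurable_fun setT (fun w => sre_lim (y w)).
Proof.
apply: measurable_mx => i j; rewrite /sre_lim; under eq_fun do rewrite mxE.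
apply: measurableT_comp; first exact: fine_measurable.
apply: measurable_fun_limn_esup => K; apply/measurable_EFinP.
apply: measurable_mxP; apply: measurable_summx => k.
exact: measurable_sre_term.
Qed.

End recursion.

Lemma ae_le_probability d (Omega : measurableType d) (R : realType)
    (P : probability Omega R) (A B : set Omega) : measurable A -> measurable B ->
  {ae P, forall w, A w -> B w} -> (P A <= P B)%E.
Proof.
move=> mA mB [Z [mZ PZ sZ]].
apply: (@le_trans _ _ (P (B `|` Z))).
  apply: le_measure; rewrite ?inE//; first exact: measurableU.
  move=> w Aw; have [Bw|Bw] := pselect (B w); first by left.
  by right; apply: sZ => /= AB; apply: Bw; exact: AB.
by apply: le_trans; [exact: measureU2|rewrite [X in (_ + X)%E]PZ adde0].
Qed.

Lemma ae_eq_probability d (Omega : measurableType d) (R : realType)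
    (P : probability Omega R) (A B : set Omega) : measurable A -> measurable B ->
  {ae P, forall w, A w <-> B w} -> P A = P B.
Proof.
move=> mA mB AB; apply/eqP; rewrite eq_le.
by rewrite !ae_le_probability//; apply: filterS AB => w [].
Qed.

Section tails.
Context d (Omega : measurableType d) (R : realType) (P : probability Omega R).

Lemma probability_tail (f : Omega -> R) (eta : R) : measurable_fun setT f -> 0 < eta ->
  exists2 L, 0 < L & (P [set w | (L <= f w)%R] <= eta%:E)%E.
Proof.
move=> mf eta0; pose F (j : nat) : set Omega := [set w | (j%:R <= f w)%R].
have mF j : measurable (F j).
  rewrite -[F j]setTI; apply: measurable_fun_le => //.
have capF : \bigcap_j F j = set0.
  apply/seteqP; split => // w Fw; have := Fw (Num.bound `|f w|) I.
  rewrite /F /= leNgt; apply: negP; rewrite negbK.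
  by apply: le_lt_trans (ler_norm _) _; exact: archi_boundP.
have cF : P \o F @ \oo --> 0%E.
  rewrite -(measure0 P) -capF; apply: nonincreasing_cvg_mu => //.
  - by rewrite (le_lt_trans (probability_le1 _ _))// ltry.
  - by rewrite capF.
  - apply/nonincreasing_seqP => j; apply/subsetPset => w /= h.
    by apply: le_trans h; rewrite ler_nat.
have [K _ hK] := @cvgr_lt _ _ _ _ _ _ (fine_cvg cF) eta eta0.
exists K.+1%:R => //.
have := hK K.+1 (leqnSn K); rewrite /= => h.
rewrite -[X in (X <= _)%E]fineK ?lee_fin ?ltW//.
by rewrite fin_num_measure//; exact: (mF K.+1).
Qed.

End tails.

Section stochastic_recurrence.
Context d (Omega : measurableType d) (R : realType) (P : probability Omega R).
Variables (n : nat) (N : 'cV[R]_n -> R).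
Hypothesis hN : vector_norm N.
Variables (Y : int -> Omega -> 'M[R]_n * 'cV[R]_n)
  (nu : set ('M[R]_n * 'cV[R]_n) -> \bar R).
Hypothesis iidY : iid_law P Y nu.

Let mY t : measurable_fun setT (Y t). Proof. exact: iidY.1. Qed.
Let op0 := opnorm_ge0 hN.
Let mop := measurable_opnorm hN.
Let N0 := vnorm_ge0 hN.

(** The paths read backwards from time t, so that products of the matrices
    appear in the order of iterated substitution. *)
Definition past (t : int) (w : Omega) (i : nat) := Y (t - i%:Z) w.

Lemma measurable_past t i : measurable_fun setT (fun w => past t w i).
Proof. exact: mY. Qed.

(** It does not depend on which k matrices are multiplied ([prod_momentE]). *)
Definition prod_moment (s : R) k : \bar R :=
  \int[P]_w (opnorm N (sre_prod (past 0 w) k) `^ s)%:E.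

Lemma prod_moment_ge0 s k : (0 <= prod_moment s k)%E.
Proof. by apply: integral_ge0 => w _; rewrite lee_fin powR_ge0. Qed.

Lemma prod_momentE s k (f : nat -> int) : injective f ->
  (\int[P]_w (opnorm N (sre_prod (fun i => Y (f i) w) k) `^ s)%:E)%E = prod_moment s k.
Proof.
move=> fi.
have i1 : iid_law P (fun i : nat => Y (f i)) nu by exact: (iid_reindex fi iidY).
have i2 : iid_law P (fun i : nat => Y (0 - i%:Z)) nu.
  by apply: (iid_reindex (f := fun i : nat => 0 - i%:Z)) iidY => a b; lia.
apply: (iid_path_integral (F := fun y => (opnorm N (sre_prod y k) `^ s)%:E) i1 i2).
  apply/measurable_EFinP; apply: (measurableT_comp (measurable_powR s)).
  apply: (measurableT_comp mop); apply: measurable_sre_prod => i.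
  exact: measurable_coord.
by move=> y; rewrite lee_fin powR_ge0.
Qed.

Lemma sre_prodD (y : nat -> 'M[R]_n * 'cV[R]_n) k m :
  sre_prod y (k + m) = sre_prod y k *m sre_prod (fun i => y (k + i)%N) m.
Proof. by rewrite /sre_prod big_split_ord. Qed.

(** The product only involves the finitely many coefficients with indices f i for
    i < k, so it is a function of a path indexed by 'I_k. *)
Lemma independent_sre_prod k (f : nat -> int) (K : Type) (h : K -> int)
    d' (S : measurableType d') (g : path_space K ('M[R]_n * 'cV[R]_n)%type -> S) :
  (forall i b, (i < k)%N -> f i <> h b) -> measurable_fun setT g ->
  independent P
    (g_sigma_algebra_preimage (fun w => sre_prod (fun i => Y (f i) w) k))
    (g_sigma_algebra_preimage (fun w => g (fun b => Y (h b) w))).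
Proof.
move=> fh mg.
pose F (z : path_space 'I_k ('M[R]_n * 'cV[R]_n)%type) : 'M[R]_n := \prod_(i < k) (z i).1.
have mF : measurable_fun setT F.
  rewrite /F; move: (index_enum _) => r; elim: r => [|i r IH].
    rewrite (_ : (fun _ => _) = cst 1%:M); last by apply/funext => z; rewrite big_nil.
    exact: measurable_cst.
  rewrite (_ : (fun _ => _) = (fun z : path_space 'I_k ('M[R]_n * 'cV[R]_n)%type =>
     (z i).1 *m (\prod_(i <- r) (z i).1))); last by apply/funext => z; rewrite big_cons.
  apply: measurable_mulmx => //.
  by apply: (measurableT_comp measurable_fst); exact: measurable_coord.
apply: (iid_independent_maps iidY (s1 := fun i : 'I_k => f i) (s2 := h)
  (f := F) (g := g) _ mF mg) => a b.
exact: fh.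
Qed.

Lemma measurable_powop s :
  measurable_fun setT (fun A : 'M[R]_n => (opnorm N A `^ s)%:E).
Proof. by apply/measurable_EFinP; exact: (measurableT_comp (measurable_powR s) mop). Qed.

Lemma measurable_powN s :
  measurable_fun setT (fun x : 'cV[R]_n => (N x `^ s)%:E).
Proof.
by apply/measurable_EFinP; exact: (measurableT_comp (measurable_powR s) (measurable_vnorm hN)).
Qed.

(** The norm is submultiplicative and the two partial products are independent. *)
Lemma prod_momentD s k m : 0 <= s ->
  (prod_moment s (k + m) <= prod_moment s k * prod_moment s m)%E.
Proof.
move=> s0.
have fi : injective (fun i : nat => 0 - (k + i)%:Z) by move=> a b; lia.
rewrite -[X in (_ <= _ * X)%E](prod_momentE s m fi).
pose F2 (z : path_space nat ('M[R]_n * 'cV[R]_n)%type) := sre_prod z m.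
have mF2 : measurable_fun setT F2.
  by apply: measurable_sre_prod => i; exact: measurable_coord.
pose X w := sre_prod (past 0 w) k.
pose Z w := F2 (fun i => Y (0 - (k + i)%:Z) w).
have mX : measurable_fun setT X by apply: measurable_sre_prod => i; exact: measurable_past.
have mZ : measurable_fun setT Z by apply: (measurableT_comp mF2); exact: measurable_path.
have iXZ : independent P (g_sigma_algebra_preimage X) (g_sigma_algebra_preimage Z).
  by apply: (independent_sre_prod (f := fun i : nat => 0 - i%:Z) _ mF2) => a b; lia.
have g0 (A : 'M[R]_n) : (0 <= (opnorm N A `^ s)%:E)%E by rewrite lee_fin powR_ge0.
rewrite /prod_moment -(independent_integralM mX mZ iXZ (measurable_powop s) (measurable_powop s) g0 g0).
apply: ge0_le_integral => //.
- by apply: (measurableT_comp (measurable_powop s)); apply: measurable_sre_prod => i; exact: measurable_past.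
- by apply: emeasurable_funM; exact: (measurableT_comp (measurable_powop s)).
move=> w _; rewrite -EFinM lee_fin -powRM// ge0_ler_powR// ?nnegrE//.
- exact: mulr_ge0.
- by rewrite sre_prodD opnormM.
Qed.

Lemma sre_term_moment s k t : 0 <= s ->
  (\int[P]_w (N (sre_term (past t w) k) `^ s)%:E <=
   prod_moment s k * \int[P]_w (N (Y 0 w).2 `^ s)%:E)%E.
Proof.
move=> s0.
have fi : injective (fun i : nat => t - i%:Z) by move=> a b; lia.
rewrite -[X in (_ <= X * _)%E](prod_momentE s k fi).
pose g (z : path_space unit ('M[R]_n * 'cV[R]_n)%type) := (z tt).2.
have mg : measurable_fun setT g.
  by apply: (measurableT_comp measurable_snd); exact: measurable_coord.
pose X w := sre_prod (past t w) k.
pose Z w := (Y (t - k%:Z) w).2.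
have mX : measurable_fun setT X by apply: measurable_sre_prod => i; exact: measurable_past.
have mZ : measurable_fun setT Z by exact: (measurableT_comp measurable_snd).
have iXZ : independent P (g_sigma_algebra_preimage X) (g_sigma_algebra_preimage Z).
  apply: (independent_sre_prod (f := fun i : nat => t - i%:Z) (h := fun _ => t - k%:Z) _ mg).
  by move=> a b; lia.
have -> : (\int[P]_w (N (Y 0 w).2 `^ s)%:E = \int[P]_w (N (Z w) `^ s)%:E)%E.
  have i1 : iid_law P (fun _ : unit => Y 0) nu.
    by apply: (iid_reindex (f := fun _ : unit => 0 : int)) iidY => -[] [].
  have i2 : iid_law P (fun _ : unit => Y (t - k%:Z)) nu.
    by apply: (iid_reindex (f := fun _ : unit => t - k%:Z)) iidY => -[] [].
  apply: (iid_path_integral (F := fun y => (N (g y) `^ s)%:E) i1 i2).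
    exact: (measurableT_comp (measurable_powN s) mg).
  by move=> y; rewrite lee_fin powR_ge0.
have g0 (A : 'M[R]_n) : (0 <= (opnorm N A `^ s)%:E)%E by rewrite lee_fin powR_ge0.
have h0 (x : 'cV[R]_n) : (0 <= (N x `^ s)%:E)%E by rewrite lee_fin powR_ge0.
rewrite -(independent_integralM mX mZ iXZ (measurable_powop s) (measurable_powN s) g0 h0).
apply: ge0_le_integral => //.
- apply: (measurableT_comp (measurable_powN s)); apply: measurable_sre_term => i.
  exact: measurable_past.
- apply: emeasurable_funM; first exact: (measurableT_comp (measurable_powop s)).
  exact: (measurableT_comp (measurable_powN s)).
move=> w _; rewrite -EFinM lee_fin -powRM// ge0_ler_powR// ?nnegrE//.
- exact: mulr_ge0.
- exact: opnorm_ub.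
Qed.

Hypothesis hM : (\int[P]_w (opnorm N (Y 0 w).1)%:E < +oo)%E.
Hypothesis hQ : (\int[P]_w (N (Y 0 w).2)%:E < +oo)%E.
Hypothesis hgamma : (top_lyapunov P (fun t w => (Y t w).1) N < 0)%E.

Lemma powR_integral_lty (f : Omega -> R) s : 0 <= s <= 1 ->
  measurable_fun setT f -> (forall w, 0 <= f w) -> (\int[P]_w (f w)%:E < +oo)%E ->
  (\int[P]_w (f w `^ s)%:E < +oo)%E.
Proof.
move=> s01 mf f0 intf; apply: (@le_lt_trans _ _ (\int[P]_w (1 + (f w)%:E))%E).
  apply: ge0_le_integral => //.
  - by move=> w _; rewrite lee_fin powR_ge0.
  - by apply/measurable_EFinP; exact: (measurableT_comp (measurable_powR s) mf).
  - by apply: emeasurable_funD => //; exact/measurable_EFinP.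
  - by move=> w _; rewrite -EFinD lee_fin powR_le1D.
rewrite ge0_integralD//; last 2 first.
- by move=> w _; rewrite lee_fin.
- exact/measurable_EFinP.
by rewrite integral_cst//= mul1e probability_setT lte_add_pinfty ?ltry.
Qed.

Lemma prod_moment_lty s k : 0 <= s <= 1 -> (prod_moment s k < +oo)%E.
Proof.
move=> s01; have s0 : 0 <= s by case/andP: s01.
elim: k => [|k IH].
  rewrite /prod_moment; under eq_integral do rewrite /sre_prod big_ord0.
  by rewrite integral_cst//= probability_setT mule1 ltry.
apply: le_lt_trans (prod_momentD 1 k s0) _.
have m1 : (prod_moment s 1 < +oo)%E.
  apply: powR_integral_lty => //.
    by apply: (measurableT_comp mop); apply: measurable_sre_prod => i; exact: measurable_past.
  under eq_integral do rewrite /sre_prod big_ord1 /past subr0.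
  exact: hM.
apply: lte_mul_pinfty; [exact: prod_moment_ge0| |exact: IH].
by rewrite ge0_fin_numE// prod_moment_ge0.
Qed.

(** A negative Lyapunov exponent makes the logarithmic moment of some product of
    p matrices negative, hence its s-th moment less than 1 for some s. *)
Lemma summable_moments : exists2 s, 0 < s <= 1 & cvgn (series (fun k => fine (prod_moment s k))).
Proof.
have [_ [p /= p0 <-] lt0] := ereal_inf_lt hgamma.
have fi : injective (fun i : nat => i.+1%:Z) by move=> a b; lia.
pose f w := opnorm N (sre_prod (fun i => Y i.+1%:Z w) p).
have mf : measurable_fun setT f.
  by apply: (measurableT_comp mop); apply: measurable_sre_prod.
have fE w : opnorm N (\prod_(1 <= i < p.+1) (Y i%:Z w).1) = f w.
  by rewrite big_add1 big_mkord.
have f0 w : 0 <= f w by exact: op0.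
have fint : (\int[P]_w (f w)%:E < +oo)%E.
  under eq_integral do rewrite -[f _]powRr1//.
  by rewrite (prod_momentE 1 p fi) prod_moment_lty// ler01 lexx.
have [s s01 sf] : exists2 s : R, 0 < s <= 1 & (\int[P]_w (f w `^ s)%:E < 1)%E.
  apply: lne_moment_lt1 => //.
  move: lt0; under eq_integral do rewrite fE.
  by rewrite pmule_rlt0// lte_fin invr_gt0 ltr0n.
exists s => //.
have s01' : 0 <= s <= 1 by case/andP: s01 => /ltW -> ->.
have fin k : prod_moment s k \is a fin_num.
  by rewrite ge0_fin_numE ?prod_moment_ge0// prod_moment_lty.
apply: (@submultiplicative_summable _ _ p) => // [k|k m|].
- by rewrite fine_ge0// prod_moment_ge0.
- rewrite -fineM// fine_le// ?fin_numM// prod_momentD//.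
  by case/andP: s01'.
- have : (prod_moment s p < 1)%E by rewrite -(prod_momentE s p fi); exact: sf.
  by rewrite -[X in (X < _)%E](fineK (fin p)) lte_fin.
Qed.

Lemma powR_le_split (x D s : R) : 0 <= x <= D -> 0 < s <= 1 -> x <= D `^ (1 - s) * x `^ s.
Proof.
move=> /andP[x0 xD] /andP[s0 s1].
rewrite -{1}[x]powRr1// -[X in x `^ X](subrK s) powRD; last first.
  by rewrite subrK oner_eq0.
by rewrite ler_wpM2r ?powR_ge0// ge0_ler_powR ?nnegrE ?subr_ge0// (le_trans x0).
Qed.

(** The terms are bounded, say by D, and then x <= D^(1 - s) x^s: summability of
    the s-th powers implies absolute convergence. *)
Lemma sre_cvg_summable (y : nat -> 'M[R]_n * 'cV[R]_n) s : 0 < s <= 1 ->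
  (\sum_(k <oo) (N (sre_term y k) `^ s)%:E < +oo)%E -> sre_cvg y.
Proof.
move=> s01 sumy; have /andP[s0 s1] := s01.
pose u k := N (sre_term y k) `^ s.
have u0 k : 0 <= u k by exact: powR_ge0.
have cu : cvgn (series u) by exact: nnseries_is_cvg.
pose S := limn (series u).
have uS k : u k <= S.
  apply: (@le_trans _ _ (series u k.+1)).
    by rewrite seriesSr lerDr; apply: sumr_ge0.
  by apply: nondecreasing_cvgn_le => //; apply: nondecreasing_series => i _ _.
have S0 : 0 <= S by exact: le_trans (uS 0%N).
pose D := S `^ s^-1.
have ND k : N (sre_term y k) <= D.
  rewrite -[leLHS]powRr1// -(mulfV (lt0r_neq0 s0)) powRrM.
  apply: ge0_ler_powR; last exact: uS.
  - by rewrite invr_ge0 ltW.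
  - by rewrite nnegrE powR_ge0.
  - by rewrite nnegrE.
have [c c0 cN] := vnorm_lower hN.
move=> i; rewrite /sre_sum.
have -> : (fun K => (\sum_(k < K) sre_term y k) i 0) = series (fun k => sre_term y k i 0).
  by apply/funext => K; rewrite /series /= big_mkord summxE.
apply: normed_cvg.
have cK : 0 <= c * D `^ (1 - s) by rewrite mulr_ge0 ?powR_ge0// ltW.
apply: (@series_le_cvg _ _ (fun k => c * D `^ (1 - s) * u k)) => [k|k|k|].
- exact: normr_ge0.
- by rewrite mulr_ge0.
- apply: le_trans (mx1norm_entry _ _ _) _; apply: le_trans (cN _) _.
  rewrite -mulrA ler_wpM2l ?(ltW c0)// powR_le_split//.
  by rewrite N0 ND.
- exact: is_cvg_seriesZ.
Qed.

Lemma past_sre_cvg : {ae P, forall w, forall t, sre_cvg (past t w)}.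
Proof.
apply: ae_forall_int => t; have [s s01 cs] := summable_moments.
have /andP[s0 s1] := s01; have s01' : 0 <= s <= 1 by rewrite s1 ltW.
pose g k w := ((N (sre_term (past t w) k) `^ s)%:E)%E.
have mg k : measurable_fun setT (g k).
  apply: (measurableT_comp (measurable_powN s)); apply: measurable_sre_term => i.
  exact: measurable_past.
have g0 k w : (0 <= g k w)%E by rewrite lee_fin powR_ge0.
have mG : measurable_fun setT (fun w => \sum_(k <oo) g k w)%E.
  by apply: ge0_emeasurable_sum.
pose c := (\int[P]_w (N (Y 0 w).2 `^ s)%:E)%E.
have c0 : (0 <= c)%E by apply: integral_ge0 => w _; rewrite lee_fin powR_ge0.
have cfin : c \is a fin_num.
  rewrite ge0_fin_numE//; apply: powR_integral_lty => //.
  by apply: (measurableT_comp (measurable_vnorm hN)); apply: (measurableT_comp measurable_snd).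
have fin k : prod_moment s k \is a fin_num.
  by rewrite ge0_fin_numE ?prod_moment_ge0// prod_moment_lty.
have intG : (\int[P]_w (\sum_(k <oo) g k w) < +oo)%E.
  rewrite integral_nneseries//.
  apply: (@le_lt_trans _ _ (\sum_(k <oo) (fine c)%:E * prod_moment s k)%E).
    apply: lee_nneseries => [k _ _|k _]; first by apply: integral_ge0 => w _.
    by rewrite fineK// muleC; apply: sre_term_moment; case/andP: s01'.
  rewrite nneseriesZl; last by move=> k _; exact: prod_moment_ge0.
  apply: lte_mul_pinfty; [by rewrite lee_fin fine_ge0|by []|].
  apply: (@le_lt_trans _ _ (limn (series (fun k => fine (prod_moment s k))))%:E); last exact: ltry.
  apply: lime_le; first by apply: is_cvg_nneseries => k _ _; exact: prod_moment_ge0.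
  apply: nearW => K.
  rewrite (eq_bigr (fun k => (fine (prod_moment s k))%:E)); last by move=> k _; rewrite (fineK (fin k)).
  rewrite sumEFin lee_fin; apply: (@nondecreasing_cvgn_le _ (series _)) => //.
  by apply: nondecreasing_series => k _ _; exact: fine_ge0 (prod_moment_ge0 s k).
have iG : P.-integrable setT (fun w => \sum_(k <oo) g k w)%E.
  apply/integrableP; split => //.
  by under eq_integral do rewrite gee0_abs ?nneseries_ge0//.
have := integrable_ae measurableT iG; apply: filterS => w /(_ I) fw.
apply: (sre_cvg_summable s01).
rewrite -ge0_fin_numE; first exact: fw.
by apply: nneseries_ge0 => k _ _; exact: g0.
Qed.

(** The iterated equation without its remainder. *)
Definition sre_series t w := sre_lim (past t w).

Lemma sre_series_solution :
  sre_solution P (fun t w => (Y t w).1) (fun t w => (Y t w).2) sre_series.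
Proof.
have := past_sre_cvg; apply: filterS => w cw t; rewrite /sre_series.
have pS : past t w \o S = past (t - 1) w.
  by apply/funext => i; rewrite /past /= subz1n.
by rewrite sre_limE pS// /past subr0.
Qed.

Lemma sre_series_factor t w :
  sre_series t w = sre_lim (fun i : nat => path_shift t (Y^~ w) (- i%:Z)).
Proof.
rewrite /sre_series; congr sre_lim; apply/funext => i.
by rewrite /past /path_shift addrC.
Qed.

Let mF : measurable_fun setT
  (fun y : path_space int ('M[R]_n * 'cV[R]_n)%type => sre_lim (fun i : nat => y (- i%:Z))).
Proof. by apply: measurable_sre_lim => i; exact: measurable_coord. Qed.

Lemma sre_series_stationary : strictly_stationary P sre_series.
Proof.
have := factor_stationary iidY mF.
by congr strictly_stationary; apply/funext => t; apply/funext => w; rewrite sre_series_factor.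
Qed.

Lemma sre_series_ergodic : ergodic P sre_series.
Proof.
have := factor_ergodic iidY mF.
by congr ergodic; apply/funext => t; apply/funext => w; rewrite sre_series_factor.
Qed.

Lemma past_le t (i : nat) : (t - i%:Z <= t)%R. Proof. by rewrite gerBl. Qed.

Lemma sre_series_causal : causal Y sre_series.
Proof.
move=> t; exists (fun y => sre_lim (fun i => y (exist _ (t - i%:Z) (past_le t i)))).
split=> //.
by apply: measurable_sre_lim => i; exact: measurable_coord.
Qed.

Lemma iterate_sre (D : int -> 'cV[R]_n) w t k :
  (forall u, D u = (Y u w).1 *m D (u - 1)) -> D t = sre_prod (past t w) k *m D (t - k%:Z).
Proof.
move=> hD; elim: k => [|k IH]; first by rewrite /sre_prod big_ord0 mul1mx subr0.
rewrite IH hD /sre_prod big_ord_recr /= -mulmxA; congr (_ *m (_ *m D _)); lia.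
Qed.

(** Markov's inequality for the s-th moment. *)
Lemma prod_tail (delta eta : R) t : 0 < delta -> 0 < eta ->
  exists k, (P [set w | (delta <= opnorm N (sre_prod (past t w) k))%R] <= eta%:E)%E.
Proof.
have fi : injective (fun i : nat => t - i%:Z) by move=> a b /addrI /oppr_inj [].
move=> d0 e0; have [s s01 cs] := summable_moments; have /andP[s0 s1] := s01.
have ds0 : 0 < delta `^ s by rewrite powR_gt0.
have eds0 : 0 < eta * delta `^ s by rewrite mulr_gt0.
have [K _ /(_ K (leqnn K)) /= hK] :=
  @cvgr_lt _ _ _ _ _ _ (cvg_series_cvg_0 cs) _ eds0.
exists K.
pose f w := opnorm N (sre_prod (past t w) K).
have mf : measurable_fun setT f.
  by apply: (measurableT_comp mop); apply: measurable_sre_prod => i; exact: measurable_past.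
have mfs : measurable_fun setT (fun w => (f w `^ s)%:E).
  by apply/measurable_EFinP; exact: (measurableT_comp (measurable_powR s) mf).
have := le_integral_abse P measurableT mfs ds0.
under eq_integral do rewrite gee0_abs ?lee_fin ?powR_ge0//.
rewrite (prod_momentE s K fi) setTI => h.
have fin : prod_moment s K \is a fin_num.
  by rewrite ge0_fin_numE ?prod_moment_ge0// prod_moment_lty// (ltW s0) s1.
rewrite -(@lee_pmul2l _ (delta `^ s)%:E)//.
apply: le_trans (_ : _ <= prod_moment s K)%E _.
  apply: le_trans h; rewrite lee_pmul2l//.
  apply: le_measure; rewrite ?inE.
  - by rewrite -[X in measurable X]setTI; apply: measurable_fun_le.
  - rewrite -[X in measurable X]setTI; apply: emeasurable_fun_c_infty => //.
    exact: measurableT_comp.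
  move=> w /= dw; rewrite ger0_norm ?powR_ge0// lee_fin.
  by apply: ge0_ler_powR; rewrite ?nnegrE ?(ltW s0) ?(ltW d0) ?op0.
rewrite -(fineK fin) -EFinM lee_fin mulrC; exact: ltW.
Qed.

(** The difference D of two stationary solutions satisfies D_t = Pi_k D_(t-k),
    where Pi_k is the product of k coefficients. The norm of Pi_k tends to 0 in
    probability, while D_(t-k) is bounded in probability uniformly in k by
    stationarity; so D_t = 0 almost surely. *)
Lemma sre_series_unique V : sre_solution P (fun t w => (Y t w).1) (fun t w => (Y t w).2) V ->
  strictly_stationary P V -> (forall t, measurable_fun setT (V t)) ->
  {ae P, forall w, forall t, V t w = sre_series t w}.
Proof.
move=> solV stV mV; apply: ae_forall_int => t.
have mS u : measurable_fun setT (sre_series u).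
  by apply: measurable_sre_lim => i; exact: measurable_past.
pose D u w := V u w - sre_series u w.
have mD u : measurable_fun setT (D u).
  rewrite /D; under eq_fun do rewrite -scaleN1r.
  by apply: measurable_addmx => //; apply: measurable_scalemx.
have recD : {ae P, forall w, forall u, D u w = (Y u w).1 *m D (u - 1) w}.
  have := sre_series_solution; apply: filterS2 solV => w h1 h2 u.
  by rewrite /D h1 h2 mulmxBr opprD addrACA subrr addr0.
have mN := measurable_vnorm hN.
have mle f (a : R) : measurable_fun setT f -> measurable [set w : Omega | (a <= f w)%R].
  by move=> mf; rewrite -[X in measurable X]setTI; apply: measurable_fun_le.
have bad (e : R) : 0 < e -> P [set w | (e <= N (D t w))%R] = 0%E.
  move=> e0; apply/eqP; rewrite eq_le measure_ge0 andbT; apply/lee_addgt0Pr => eta eta0.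
  have eta3 : 0 < eta / 3 by rewrite divr_gt0.
  have [L1 L10 hL1] := probability_tail P (measurableT_comp mN (mV 0)) eta3.
  have [L2 L20 hL2] := probability_tail P (measurableT_comp mN (mS 0)) eta3.
  have L0 : 0 < L1 + L2 by rewrite addr_gt0.
  (* |D_t| >= e requires |Pi_k| >= e / (L1 + L2) or |D_(t-k)| >= L1 + L2 *)
  have [k hk] := prod_tail t (divr_gt0 e0 L0) eta3.
  set E1 := [set w | _] in hk.
  pose E2 := [set w | (L1 <= N (V (t - k%:Z) w))%R].
  pose E3 := [set w | (L2 <= N (sre_series (t - k%:Z) w))%R].
  have mE1 : measurable E1.
    apply: mle; apply: (measurableT_comp mop); apply: measurable_sre_prod => i.
    exact: measurable_past.
  have mE2 : measurable E2 by apply: mle; exact: (measurableT_comp mN).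
  have mE3 : measurable E3 by apply: mle; exact: (measurableT_comp mN).
  have mA L : measurable [set x : 'cV[R]_n | (L <= N x)%R].
    by rewrite -[X in measurable X]setTI; apply: measurable_fun_le.
  have PE2 : (P E2 <= (eta / 3)%:E)%E.
    by rewrite -[X in P X]/(V (t - k%:Z) @^-1` [set x | (L1 <= N x)%R])
      (stationary_marginal (t - k%:Z) 0 stV (mA L1)).
  have PE3 : (P E3 <= (eta / 3)%:E)%E.
    by rewrite -[X in P X]/(sre_series (t - k%:Z) @^-1` [set x | (L2 <= N x)%R])
      (stationary_marginal (t - k%:Z) 0 sre_series_stationary (mA L2)).
  apply: (@le_trans _ _ (P (E1 `|` E2 `|` E3))).
    apply: ae_le_probability.
    - by apply: mle; exact: (measurableT_comp mN).
    - by apply: measurableU => //; exact: measurableU.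
    apply: filterS recD => w rec /= eN; apply: contrapT.
    move=> /not_orP[/not_orP[n1 n2] n3].
    move: eN; apply/negP; rewrite -ltNge.
    rewrite (iterate_sre t k rec).
    apply: le_lt_trans (opnorm_ub hN _ _) _.
    rewrite -[e](divfK (lt0r_neq0 L0)).
    move: n1 n2 n3 => /negP; rewrite -ltNge => n1 /negP; rewrite -ltNge => n2.
    move=> /negP; rewrite -ltNge => n3.
    apply: ltr_pM => //; apply: le_lt_trans (vnormD hN _ _) _.
    by rewrite vnormN// ltrD.
  apply: le_trans (measureU2 _ _ mE3) _; first exact: measurableU.
  apply: (@le_trans _ _ (P E1 + P E2 + P E3)%E).
    by rewrite leeD2r//; exact: measureU2.
  apply: (@le_trans _ _ ((eta / 3)%:E + (eta / 3)%:E + (eta / 3)%:E)%E).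
    by rewrite !leeD.
  by rewrite add0e -!EFinD lee_fin; lra.
have : {ae P, forall w, forall j : nat, (N (D t w) < j.+1%:R^-1)%R}.
  apply: ae_foralln => j; exists [set w | (j.+1%:R^-1 <= N (D t w))%R].
  split; first by apply: mle; exact: (measurableT_comp mN).
    by apply: bad; rewrite invr_gt0.
  by move=> w /= /negP; rewrite -leNgt.
apply: filterS => w small; apply/eqP; rewrite -subr_eq0; apply/eqP.
case: hN => _ _; apply; apply/eqP; rewrite eq_le N0 andbT.
rewrite leNgt; apply/negP => pos.
have := small (Num.bound (N (D t w))^-1).
apply/negP; rewrite -leNgt -[leRHS]invrK lef_pV2 ?posrE ?invr_gt0//.
have := archi_boundP (ltW (_ : 0 < (N (D t w))^-1)); rewrite invr_gt0 => /(_ pos).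
by move=> /ltW h; apply: le_trans h _; rewrite ler_nat.
Qed.

End stochastic_recurrence.

(** * The noise of the BEKK process *)

Section bekk_process.
Context d0 (Omega : measurableType d0) (R : realType) (P : probability Omega R).
Variables (d q l : nat) (C : 'M[R]_d).
Variables (m : 'I_q -> 'I_l -> int -> Omega -> R) (B : int -> Omega -> 'cV[R]_d).
Hypothesis hC : positive_definite C.
Hypothesis hmB : bekk_noise P C m B.

Let mm i j t : measurable_fun setT (m i j t).
Proof. by case: (m_law hmB i j t). Qed.

Let mB t : measurable_fun setT (B t).
Proof. by case: (B_law hmB t). Qed.

Definition noise t w : 'M[R]_(q, l) * 'cV[R]_d := (\matrix_(i, j) m i j t w, B t w).

Lemma measurable_noise t : measurable_fun setT (noise t).
Proof.
apply: measurable_fun_pair => //; apply: measurable_mx => i j.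
by under eq_fun do rewrite mxE; exact: mm.
Qed.

Lemma B_same_law t E : measurable E -> P (B t @^-1` E) = P (B 0 @^-1` E).
Proof.
move=> mE; apply: (@cramer_wold _ _ (law P (mB t)) (law P (mB 0))) => // u F mF.
have [_ /(_ u)[_ /(_ F mF) h1]] := B_law hmB t.
have [_ /(_ u)[_ /(_ F mF) h2]] := B_law hmB 0.
by rewrite -[LHS]/(P ((fun w => dot u (B t w)) @^-1` F)) [LHS]h1 -h2.
Qed.

Lemma noise_rect (E : int -> 'I_q -> 'I_l -> set R) (F : int -> set 'cV[R]_d)
    (s : seq int) :
  (forall t i j, measurable (E t i j)) -> (forall t, measurable (F t)) -> uniq s ->
  P (\bigcap_(t in [set` s])
      [set w | (forall i j, E t i j (m i j t w)) /\ F t (B t w)]) =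
  (\prod_(t <- s) (P (B 0 @^-1` F t) *
     \prod_(ij : 'I_q * 'I_l) normal_law 0 1 (E t ij.1 ij.2)))%E.
Proof.
move=> mE mF us.
pose BF := \bigcap_(t in [set` s]) (B t @^-1` F t).
pose mEs (ij : 'I_q * 'I_l) := \bigcap_(t in [set` s]) (m ij.1 ij.2 t @^-1` E t ij.1 ij.2).
pose ME := \bigcap_(ij in [set` enum {: 'I_q * 'I_l}]) mEs ij.
have -> : \bigcap_(t in [set` s])
    [set w | (forall i j, E t i j (m i j t w)) /\ F t (B t w)] = BF `&` ME.
  apply/seteqP; split => w.
    move=> h; split; first by move=> t ts; case: (h t ts).
    by move=> [i j] _ t ts; case: (h t ts) => h1 _; exact: h1.
  move=> [h1 h2] t ts; split; last exact: h1.
  by move=> i j; apply: (h2 (i, j)) => //=; rewrite mem_enum.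
have GmEs ij : g_sigma_family (m ij.1 ij.2) (mEs ij).
  apply: g_sigma_bigcap_seq => t _; apply: sub_sigma_algebra; exists t => //.
  by exists (E t ij.1 ij.2) => //; rewrite setTI.
rewrite (B_indep_m hmB); last 2 first.
- apply: g_sigma_bigcap_seq => t _; apply: sub_sigma_algebra; exists t => //.
  by exists (F t) => //; rewrite setTI.
- apply: g_sigma_bigcap_seq => ij _.
  have sub : g_sigma_family (m ij.1 ij.2) `<=` g_sigma_family
      (fun ijt : 'I_q * 'I_l * int => m ijt.1.1 ijt.1.2 ijt.2).
    by apply: g_sigma_family_sub => t; exists (ij, t).
  exact: sub.
rewrite (B_indep hmB) => [|//|t _]; last by exists (F t) => //; rewrite setTI.
rewrite (m_indep_pairs hmB); last 2 first.
- exact: enum_uniq.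
- by move=> ij _; exact: GmEs.
rewrite big_split /=; congr (_ * _)%E.
  by apply: eq_bigr => t _; rewrite B_same_law.
rewrite big_enum exchange_big /=; apply: eq_bigr => ij _.
have mi : mutually_independent P (fun t => g_sigma_algebra_preimage (m ij.1 ij.2 t)).
  by case: hmB.
rewrite mi => [|//|t _]; last by exists (E t ij.1 ij.2) => //; rewrite setTI.
by apply: eq_bigr => t _; case: (m_law hmB ij.1 ij.2 t) => _ ->.
Qed.

(** The product rule is verified on products of measurable sets of entries, by
    [noise_rect], and these form a pi-system that generates. *)
Lemma noise_iid : iid_law P noise (law P (measurable_noise 0)).
Proof.
pose G : set (set ('M[R]_(q, l) * 'cV[R]_d)) :=
  [set U | exists (E : 'I_q -> 'I_l -> set R) (F : set 'cV[R]_d),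
     [/\ forall i j, measurable (E i j), measurable F
       & U = [set z : 'M[R]_(q, l) * 'cV[R]_d | (forall i j, E i j (z.1 i j)) /\ F z.2]]].
have Gm : G `<=` measurable.
  move=> _ [E [F [mE mF ->]]].
  have -> : [set z : 'M[R]_(q, l) * 'cV[R]_d | (forall i j, E i j (z.1 i j)) /\ F z.2] =
      (\bigcap_(ij in [set` enum {: 'I_q * 'I_l}])
         ((fun z : 'M[R]_(q, l) * 'cV[R]_d => z.1 ij.1 ij.2) @^-1` E ij.1 ij.2)) `&`
      (snd @^-1` F).
    apply/seteqP; split => z [h1 h2]; split => //; first by move=> [i j] _; exact: h1.
    by move=> i j; apply: (h1 (i, j)); rewrite /= mem_enum.
  apply: measurableI; last by rewrite -[X in measurable X]setTI; exact: measurable_snd.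
  rewrite bigcap_seq; apply: bigsetI_measurable => ij _.
  rewrite -[X in measurable X]setTI; apply: measurable_mxP => //.
apply: (@iid_law_generator _ _ _ _ _ _ _ _ _ G).
- apply/seteqP; split; last by apply: smallest_sub => //; exact: sigma_algebra_measurable.
  pose GT : measurableType _ := g_sigma_algebraType G.
  have mid : @measurable_fun _ _ GT ('M[R]_(q, l) * 'cV[R]_d)%type setT (fun z => (z.1, z.2)).
    apply: measurable_fun_pair.
      apply: measurable_mx => i j _ E mE; rewrite setTI; apply: sub_sigma_algebra.
      exists (fun i' j' => if (i' == i) && (j' == j) then E else setT), setT.
      split => //; first by move=> i' j'; case: ifP.
      apply/seteqP; split => z /=; last by move=> [/(_ i j)]; rewrite !eqxx.
      by move=> Ez; split => // i' j'; case: ifP => // /andP[/eqP -> /eqP ->].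
    move=> _ F mF; rewrite setTI; apply: sub_sigma_algebra.
    exists (fun _ _ => setT), F; split => //.
    by apply/seteqP; split => z /=; [|case].
  move=> U mU; have := mid measurableT U mU; rewrite setTI.
  by rewrite (_ : _ @^-1` U = U)//; apply/seteqP; split => -[].
- move=> _ _ [E [F [mE mF ->]]] [E' [F' [mE' mF' ->]]].
  exists (fun i j => E i j `&` E' i j), (F `&` F'); split.
  + by move=> i j; exact: measurableI.
  + exact: measurableI.
  apply/seteqP; split => z /=; first by move=> [[h1 h2] [h3 h4]].
  by move=> [h1 [h2 h3]]; split; split => // i j; case: (h1 i j).
- exists (fun _ _ => setT), setT; split => //.
  by apply/seteqP; split => z.
- exact: measurable_noise.
- move=> U s GU us.
  have /choice[E /choice[F EF]] := GU.
  have mE t i j : measurable (E t i j) by case: (EF t).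
  have mF t : measurable (F t) by case: (EF t).
  have preU t u : noise u @^-1` U t =
      [set w | (forall i j, E t i j (m i j u w)) /\ F t (B u w)].
    have [_ _ ->] := EF t; apply/seteqP; split => w /= [h1 h2]; split => // i j.
      by have := h1 i j; rewrite mxE.
    by rewrite mxE.
  transitivity (P (\bigcap_(t in [set` s])
      [set w | (forall i j, E t i j (m i j t w)) /\ F t (B t w)])).
    by congr (P _); apply: eq_bigcapr => t _; rewrite preU.
  rewrite noise_rect//; apply: eq_bigr => t _.
  rewrite lawE preU.
  have := @noise_rect (fun _ => E t) (fun _ => F t) [:: 0] _ _ _.
  rewrite big_seq1 => <- //.
  by congr (P _); rewrite set_cons1 bigcap_set1.
Qed.

Lemma pairs_iid t : iid_law P (fun ij : 'I_q * 'I_l => m ij.1 ij.2 t) (normal_law 0 1).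
Proof.
split=> [ij|E s mE us]; first exact: mm.
rewrite (m_indep_pairs hmB) => [|//|ij _]; last first.
  apply: sub_sigma_algebra; exists t => //.
  by exists (E ij) => //; rewrite setTI.
by apply: eq_bigr => ij _; case: (m_law hmB ij.1 ij.2 t) => _ ->.
Qed.

Lemma normal_combination_m t (c : 'I_q * 'I_l -> R) (r : seq ('I_q * 'I_l)) : uniq r ->
  has_normal_law P 0 (\sum_(ij <- r) c ij ^+ 2)
    (fun w => \sum_(ij <- r) c ij * m ij.1 ij.2 t w).
Proof.
elim: r => [|ij r IH] /=.
  move=> _; rewrite big_nil; under eq_fun do rewrite big_nil.
  split=> [|E mE]; first exact: measurable_cst.
  rewrite /normal_law eqxx diracE preimage_cst.
  by case: ifP; rewrite ?probability_setT ?measure0.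
move=> /andP[ijr ur]; rewrite big_cons.
have -> : (fun w => \sum_(k <- ij :: r) c k * m k.1 k.2 t w) =
    (fun w => c ij * m ij.1 ij.2 t w + \sum_(k <- r) c k * m k.1 k.2 t w).
  by apply/funext => w; rewrite big_cons.
apply: has_normal_law_add.
- exact: sqr_ge0.
- by apply: sumr_ge0 => ? _; exact: sqr_ge0.
- exact/has_normal_law_scale/(m_law hmB).
- exact: IH.
pose K2 := {k | k \in r}.
pose f1 (z : path_space unit R) := c ij * z tt.
pose f2 (z : path_space K2 R) := \sum_(k <- r)
  c k * (if pselect (k \in r) is left h then z (exist _ k h) else 0).
have mf1 : measurable_fun setT f1.
  by apply: measurable_funM => //; exact: measurable_coord.
have mf2 : measurable_fun setT f2.
  apply: measurable_sum => k; apply: measurable_funM => //.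
  by case: pselect => [h|_]; [exact: measurable_coord|exact: measurable_cst].
have -> : (fun z => \sum_(k <- r) c k * m k.1 k.2 t z) =
    (fun z => f2 (fun k => m (sval k).1 (sval k).2 t z)).
  apply/funext => z; rewrite /f2 [LHS]big_seq [RHS]big_seq.
  by apply: eq_bigr => k kr; case: pselect.
apply: (iid_independent_maps (pairs_iid t) (s1 := fun _ : unit => ij)
  (s2 := fun k : K2 => sval k) (f := f1) (g := f2)) => // _ [k kr] /= ijk.
by move: ijr; rewrite ijk kr.
Qed.

Lemma dot_normal_law t u (c : 'I_q * 'I_l -> R) :
  has_normal_law P 0 (\sum_ij c ij ^+ 2 + quad_form C u)
    (fun w => \sum_ij c ij * m ij.1 ij.2 t w + dot u (B t w)).
Proof.
apply: has_normal_law_add.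
- by apply: sumr_ge0 => ? _; exact: sqr_ge0.
- exact: (posdef_semidef hC).2.
- by apply: normal_combination_m; exact: index_enum_uniq.
- by case: (B_law hmB t) => _; apply.
apply: independent_sym; apply: independent_sub (B_indep_m hmB).
- pose f (z : path_space unit 'cV[R]_d) := dot u (z tt).
  have mf : measurable_fun setT f.
    by apply: (measurableT_comp (measurable_dot u)); exact: measurable_coord.
  apply: subset_trans (path_preimage_sub (Y := fun _ : unit => B t) mf) _.
  by apply: g_sigma_family_sub => _; exists t.
pose f (z : path_space ('I_q * 'I_l) R) := \sum_ij c ij * z ij.
have mf : measurable_fun setT f.
  by apply: measurable_sum => k; apply: measurable_funM => //; exact: measurable_coord.
apply: subset_trans (path_preimage_sub (Y := fun ij : 'I_q * 'I_l => m ij.1 ij.2 t) mf) _.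
by apply: g_sigma_family_sub => ij; exists (ij, t).
Qed.

Variable A : 'I_q -> 'I_l -> 'M[R]_d.

(** The conditional covariance matrix given the q previous values. *)
Definition arch_cov (x : 'I_q -> 'cV[R]_d) : 'M[R]_d :=
  C + \sum_(i < q) \sum_(j < l) (A i j *m x i *m (x i)^T *m (A i j)^T).

(** The new value as a function of the previous values x and of the noise. *)
Definition arch_step (x : 'I_q -> 'cV[R]_d) (z : 'M[R]_(q, l) * 'cV[R]_d) : 'cV[R]_d :=
  \sum_(i < q) \sum_(j < l) z.1 i j *: (A i j *m x i) + z.2.

(** The new value, standardized by its conditional covariance matrix. *)
Definition innovation x z := invmx (sqrtmx (arch_cov x)) *m arch_step x z.

Lemma arch_cov_quad_form x u : quad_form (arch_cov x) u =
  quad_form C u + \sum_(i < q) \sum_(j < l) dot u (A i j *m x i) ^+ 2.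
Proof.
rewrite /quad_form /arch_cov mulmxDr mulmxDl mxE; congr (_ + _).
rewrite mulmx_sumr mulmx_suml summxE; apply: eq_bigr => i _.
rewrite mulmx_sumr mulmx_suml summxE; apply: eq_bigr => j _.
rewrite expr2 {2}dotC /dot trmx_mul.
rewrite !mulmxA -[in LHS](mulmxA _ (x i)^T) -[in LHS](mulmxA (u^T *m A i j *m x i)).
by rewrite [in LHS]mxE big_ord1 -!mulmxA.
Qed.

Lemma arch_cov_posdef x : positive_definite (arch_cov x).
Proof.
split.
  rewrite /arch_cov linearD /= hC.1; congr (_ + _).
  rewrite linear_sum; apply: eq_bigr => i _.
  rewrite linear_sum; apply: eq_bigr => j _.
  by rewrite /= !trmx_mul !trmxK !mulmxA.
move=> u u0; rewrite arch_cov_quad_form; apply: ltr_wpDr; last exact: hC.2.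
by do 2 (apply: sumr_ge0 => ? _); exact: sqr_ge0.
Qed.

(** For fixed x a linear form u of the new value is a sum of independent centered
    normal variables, of variance sum (u' A_ij x_i)^2 + u' C u, which is the
    quadratic form of the conditional covariance matrix. *)
Lemma innovation_law x t : has_centered_normal_law P 1%:M (fun w => innovation x (noise t w)).
Proof.
have pS := sqrtmx_posdef (arch_cov_posdef x); set S := sqrtmx _ in pS.
have uS := posdef_unit pS.
have mY : measurable_fun setT (fun w => innovation x (noise t w)).
  apply: measurable_mulmx; first exact: measurable_cst.
  apply: measurable_addmx; last exact: mB.
  do 2 apply: measurable_summx => ?.
  apply: measurable_scalemx; last exact: measurable_cst.
  by under eq_fun do rewrite mxE; exact: mm.
split=> // u.
pose u' := (invmx S)^T *m u.
have E w : (u^T *m innovation x (noise t w)) 0 0 =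
    \sum_ij dot u' (A ij.1 ij.2 *m x ij.1) * m ij.1 ij.2 t w + dot u' (B t w).
  rewrite -[LHS]/(dot u _) /innovation -/S dot_trmx -/u' /arch_step dotDr; congr (_ + _).
  rewrite -(pair_bigA _ (fun i j => dot u' (A i j *m x i) * m i j t w)) /=.
  rewrite /dot mulmx_sumr summxE; apply: eq_bigr => i _.
  rewrite mulmx_sumr summxE; apply: eq_bigr => j _.
  by rewrite mxE -scalemxAr mxE mulrC.
under eq_fun do rewrite E.
have -> : quad_form 1%:M u = \sum_ij dot u' (A ij.1 ij.2 *m x ij.1) ^+ 2 + quad_form C u'.
  rewrite addrC -(pair_bigA _ (fun i j => dot u' (A i j *m x i) ^+ 2)) -arch_cov_quad_form.
  rewrite -(sqrtmx_sqr (arch_cov_posdef x)) -/S /u' /quad_form trmx_mul trmxK mulmx1.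
  rewrite !mulmxA mulmxKV// -(mulmxA u^T).
  have -> : S *m (invmx S)^T = 1%:M.
    by rewrite -{1}pS.1 -trmx_mul mulVmx// trmx1.
  by rewrite mulmx1.
exact: dot_normal_law.
Qed.

(** * The companion recurrence *)

Definition bekk_map (z : 'M[R]_(q, l) * 'cV[R]_d) :
    'M[R]_(\sum_(i < q) d) * 'cV[R]_(\sum_(i < q) d) :=
  (companion (fun i => \sum_(j < l) z.1 i j *: A i j),
   \mxcol_(i < q) (if i == 0%N :> nat then z.2 else 0)).

Lemma bekk_map_noise t w : bekk_map (noise t w) = (bekk_M A m t w, @bekk_Q _ _ R d q B t w).
Proof.
rewrite /bekk_map /bekk_M /bekk_Q /=; congr (companion _, _).
by apply/funext => i; apply: eq_bigr => j _; rewrite mxE.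
Qed.

Lemma measurable_bekk_map : measurable_fun setT bekk_map.
Proof.
apply: measurable_fun_pair; apply: measurable_mx => i k.
  rewrite /companion; under eq_fun do rewrite mxE.
  case: (_ == 0%N); last by case: (_ == _.+1); exact: measurable_cst.
  apply: measurable_mxP; apply: measurable_summx => j.
  apply: measurable_scalemx; last exact: measurable_cst.
  by apply: measurable_mxP; exact: measurable_fst.
under eq_fun do rewrite mxE.
case: (_ == 0%N); last exact: measurable_cst.
by apply: measurable_mxP; exact: measurable_snd.
Qed.

Definition bekk_nu E := law P (measurable_noise 0) (bekk_map @^-1` E).

Lemma bekk_iid : iid_law P (fun t w => (bekk_M A m t w, @bekk_Q _ _ R d q B t w)) bekk_nu.
Proof.
have := iid_map measurable_bekk_map noise_iid.
by congr iid_law; apply/funext => t; apply/funext => w; rewrite bekk_map_noise.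
Qed.

Let L1 (f : Omega -> R) := P.-integrable setT (EFin \o f).

Let L1_cst a : L1 (fun=> a).
Proof. exact: finite_measure_integrable_cst. Qed.

Let L1_sum (I : Type) (s : seq I) (f : I -> Omega -> R) :
  (forall i, L1 (f i)) -> L1 (fun w => \sum_(i <- s) f i w).
Proof.
move=> Lf; rewrite /L1 (_ : _ \o _ = fun w => (\sum_(i <- s) (f i w)%:E)%E).
  by apply: integrable_sum => // i _; exact: Lf.
by apply/funext => w /=; rewrite sumEFin.
Qed.

Let L1_mx1norm a b (f : Omega -> 'M[R]_(a, b)) :
  (forall i j, L1 (fun w => f w i j)) -> L1 (fun w => mx1norm (f w)).
Proof.
move=> Lf; rewrite /mx1norm; apply: L1_sum => i; apply: L1_sum => j.
by have := integrable_norm (Lf i j).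
Qed.

Let L1_bound (f g : Omega -> R) K : measurable_fun setT f -> L1 g -> (forall w, 0 <= f w <= K * g w) ->
  (\int[P]_w (f w)%:E < +oo)%E.
Proof.
move=> mf Lg fg.
have /integrableP[mKg] := integrableZl measurableT K Lg; apply: le_lt_trans.
apply: ge0_le_integral => //.
- by move=> w _; rewrite lee_fin; case/andP: (fg w).
- exact/measurable_EFinP.
- exact: measurableT_comp.
move=> w _; rewrite /= lee_fin; have /andP[_ fK] := fg w.
by rewrite (le_trans fK)// ler_norm.
Qed.

Let L1_normal X v : 0 <= v -> has_normal_law P 0 v X -> L1 X.
Proof.
move=> v0 hX; apply/integrableP; split; first by apply/measurable_EFinP; case: hX.
exact: normal_abs_moment hX.
Qed.

Lemma measurable_bekk_M t : measurable_fun setT (bekk_M A m t).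
Proof. exact: (measurableT_comp measurable_fst (bekk_iid.1 t)). Qed.

Lemma measurable_bekk_Q t : measurable_fun setT (@bekk_Q _ _ R d q B t).
Proof. exact: (measurableT_comp measurable_snd (bekk_iid.1 t)). Qed.

Variable N : 'cV[R]_(\sum_(i < q) d) -> R.
Hypothesis hN : vector_norm N.

Lemma bekk_M_moment t : (\int[P]_w (opnorm N (bekk_M A m t w))%:E < +oo)%E.
Proof.
have [K K0 hK] := opnorm_mx1norm hN.
apply: (@L1_bound _ (fun w => mx1norm (bekk_M A m t w)) K).
- exact: (measurableT_comp (measurable_opnorm hN) (measurable_bekk_M t)).
- apply: L1_mx1norm => i k; rewrite /bekk_M /companion.
  under eq_fun do rewrite mxE.
  case: (_ == 0%N); last by case: (_ == _.+1); exact: L1_cst.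
  under eq_fun do rewrite summxE.
  apply: L1_sum => j; under eq_fun do rewrite mxE mulrC.
  exact: L1_normal (sqr_ge0 _) (has_normal_law_scale _ (m_law hmB _ _ _)).
- by move=> w; rewrite hK opnorm_ge0.
Qed.

Lemma bekk_Q_moment t : (\int[P]_w (N (@bekk_Q _ _ R d q B t w))%:E < +oo)%E.
Proof.
apply: (@L1_bound _ (fun w => mx1norm (@bekk_Q _ _ R d q B t w)) (vnorm_max N)).
- exact: (measurableT_comp (measurable_vnorm hN) (measurable_bekk_Q t)).
- apply: L1_mx1norm => i k; rewrite /bekk_Q.
  rewrite (ord1 k); under eq_fun do rewrite mxE.
  case: (_ == 0%N); last by under eq_fun do rewrite mxE; exact: L1_cst.
  set r := tagnat.sig2 i.
  have [_ /(_ (delta_mx r 0))] := B_law hmB t.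
  under eq_fun do rewrite -[(_ *m _) 0 0]/(dot _ _) dot_delta.
  exact: L1_normal ((posdef_semidef hC).2 _).
- by move=> w; rewrite vnorm_le// vnorm_ge0.
Qed.

Definition block (i : 'I_q) (v : 'cV[R]_(\sum_(i < q) d)) : 'cV[R]_d := submxcol v i.

Lemma measurable_block d' (Omega' : measurableType d') i (f : Omega' -> 'cV[R]_(\sum_(i < q) d)) :
  measurable_fun setT f -> measurable_fun setT (fun w => block i (f w)).
Proof.
move=> mf; apply: measurable_mx => a b; under eq_fun do rewrite mxE.
exact: measurable_mxP.
Qed.

Lemma block_companion i (M : 'I_q -> 'M[R]_d) v :
  block i (companion M *m v) = \sum_(j < q)
    (if i == 0%N :> nat then M j else if i == j.+1 :> nat then 1%:M else 0) *m block j v.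
Proof.
rewrite /block /companion mxblockEv mxcol_mul mxcolK -{1}(submxcolK v).
by rewrite mul_mxrow_mxcol.
Qed.

Lemma block_head (i : 'I_q) v t w : i = 0%N :> nat ->
  block i (bekk_M A m t w *m v + @bekk_Q _ _ R d q B t w) = arch_step (block^~ v) (noise t w).
Proof.
move=> i0; rewrite /block submxcolD mxcolK -/(block _ _) /bekk_M block_companion i0 eqxx.
congr (_ + _); apply: eq_bigr => j _; rewrite mulmx_suml.
by apply: eq_bigr => k _; rewrite mxE scalemxAl.
Qed.

Lemma block_tail (i k : 'I_q) v t w : i = k.+1 :> nat ->
  block i (bekk_M A m t w *m v + @bekk_Q _ _ R d q B t w) = block k v.
Proof.
move=> ik; rewrite [LHS]/block submxcolD mxcolK -/(block i (_ *m _)) /bekk_M block_companion ik /= addr0.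
rewrite (bigD1 k)//= eqxx mul1mx big1 ?addr0// => j jk.
by rewrite eqSS eq_sym (inj_eq val_inj) (negbTE jk) mul0mx.
Qed.

Hypothesis hgamma : (top_lyapunov P (bekk_M A m) N < 0)%E.

Let Y t w := (bekk_M A m t w, @bekk_Q _ _ R d q B t w).

Definition bekk_V : int -> Omega -> 'cV[R]_(\sum_(i < q) d) := sre_series Y.

Lemma bekk_V_solution :
  stationary_causal_sre_solution P (bekk_M A m) (@bekk_Q _ _ R d q B) bekk_V.
Proof.
have h1 := bekk_M_moment 0; have h2 := bekk_Q_moment 0.
split.
- exact: (sre_series_solution hN bekk_iid h1 h2 hgamma).
- exact: sre_series_stationary bekk_iid.
- exact: sre_series_ergodic bekk_iid.
- exact: (sre_series_causal Y).
Qed.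

Lemma bekk_V_unique V :
  stationary_causal_sre_solution P (bekk_M A m) (@bekk_Q _ _ R d q B) V ->
  {ae P, forall w, forall t, V t w = bekk_V t w}.
Proof.
move=> [solV stV _ cV].
apply: (sre_series_unique hN bekk_iid (bekk_M_moment 0) (bekk_Q_moment 0) hgamma solV stV).
move=> t; have [f [mf fE]] := cV t.
rewrite (_ : V t = f \o (fun w s => (bekk_M A m (sval s) w, @bekk_Q _ _ R d q B (sval s) w))); last first.
  by apply/funext => w; rewrite fE.
by apply: (measurableT_comp mf); apply: measurable_path => s; exact: bekk_iid.1.
Qed.

Hypothesis hq : (0 < q)%N.
Let i0 : 'I_q := Ordinal hq.

(** * The BEKK-ARCH solution *)

Definition bekk_X t w : 'cV[R]_d := block i0 (bekk_V t w).
Definition bekk_Z t w : 'cV[R]_d :=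
  invmx (sqrtmx (bekk_H C A (bekk_X^~ w) t)) *m bekk_X t w.

Lemma bekk_HE (x : int -> 'cV[R]_d) t :
  bekk_H C A x t = arch_cov (fun i => x (t - i.+1%:Z)).
Proof. by []. Qed.

Lemma bekk_V_block : {ae P, forall w, forall t (i : 'I_q),
  block i (bekk_V t w) = bekk_X (t - i%:Z) w}.
Proof.
have [sol _ _ _] := bekk_V_solution; apply: filterS sol => w sol t [i iq].
elim: i iq t => [|i IH] iq t.
  by rewrite /bekk_X subr0; congr block; exact: val_inj.
rewrite sol (@block_tail _ (Ordinal (ltnW iq)))// IH /=.
by rewrite subz1n.
Qed.

Lemma bekk_X_step : {ae P, forall w, forall t,
  bekk_X t w = arch_step (fun i => bekk_X (t - i.+1%:Z) w) (noise t w)}.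
Proof.
have [sol _ _ _] := bekk_V_solution; apply: filterS2 sol bekk_V_block => w sol bl t.
have -> : (fun i : 'I_q => bekk_X (t - i.+1%:Z) w) = block^~ (bekk_V (t - 1) w).
  by apply/funext => i; rewrite bl subz1n.
have i00 : i0 = 0%N :> nat by [].
rewrite -(block_head (bekk_V (t - 1) w) t w i00).
by rewrite -sol.
Qed.

(** The current value of X as a function of the noise path read backwards. It is
    defined on all paths, so X and H are functions of the noise everywhere and
    not only almost surely. *)
Definition state_head (z : nat -> 'M[R]_(q, l) * 'cV[R]_d) : 'cV[R]_d :=
  block i0 (sre_lim (fun i => bekk_map (z i))).

Lemma bekk_XE t w : bekk_X t w = state_head (fun i => noise (t - i%:Z) w).
Proof.
rewrite /bekk_X /bekk_V /sre_series /state_head; congr (block _ (sre_lim _)).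
by apply/funext => i; rewrite bekk_map_noise.
Qed.

Lemma measurable_state_head d' (Omega' : measurableType d')
    (z : Omega' -> nat -> 'M[R]_(q, l) * 'cV[R]_d) :
  (forall i, measurable_fun setT (fun w => z w i)) ->
  measurable_fun setT (fun w => state_head (z w)).
Proof.
move=> mz; apply: measurable_block; apply: measurable_sre_lim => i.
exact: (measurableT_comp measurable_bekk_map).
Qed.

Lemma measurable_arch_cov_invsqrt d' (Omega' : measurableType d') (x : Omega' -> 'I_q -> 'cV[R]_d) :
  (forall i, measurable_fun setT (fun w => x w i)) ->
  measurable_fun setT (fun w => invmx (sqrtmx (arch_cov (x w)))).
Proof.
move=> mx; apply: measurable_invmx; last first.
  by move=> w; apply: posdef_unit; apply: sqrtmx_posdef; exact: arch_cov_posdef.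
apply: measurable_sqrtmx; last by move=> w; exact: arch_cov_posdef.
apply: measurable_addmx; first exact: measurable_cst.
apply: measurable_summx => i; apply: measurable_summx => j.
have mAx : measurable_fun setT (fun w => A i j *m x w i).
  by apply: measurable_mulmx => //; exact: measurable_cst.
apply: measurable_mulmx; last exact: measurable_cst.
by apply: measurable_mulmx => //; exact: measurable_trmx.
Qed.

Lemma measurable_arch_step d' (Omega' : measurableType d') (x : Omega' -> 'I_q -> 'cV[R]_d)
    (z : Omega' -> 'M[R]_(q, l) * 'cV[R]_d) :
  (forall i, measurable_fun setT (fun w => x w i)) -> measurable_fun setT z ->
  measurable_fun setT (fun w => arch_step (x w) (z w)).
Proof.
move=> mx mz; apply: measurable_addmx; last exact: (measurableT_comp measurable_snd mz).
apply: measurable_summx => i; apply: measurable_summx => j.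
apply: measurable_scalemx.
  by apply: measurable_mxP; exact: (measurableT_comp measurable_fst mz).
by apply: measurable_mulmx => //; exact: measurable_cst.
Qed.

Lemma measurable_bekk_X t : measurable_fun setT (bekk_X t).
Proof.
rewrite (_ : bekk_X t = fun w => state_head (fun i => noise (t - i%:Z) w)); last first.
  by apply/funext => w; rewrite bekk_XE.
by apply: measurable_state_head => i; exact: measurable_noise.
Qed.

Lemma measurable_bekk_Z t : measurable_fun setT (bekk_Z t).
Proof.
apply: measurable_mulmx; last exact: measurable_bekk_X.
apply: (measurable_arch_cov_invsqrt (x := fun w i => bekk_X (t - i.+1%:Z) w)) => i.
exact: measurable_bekk_X.
Qed.

Let Tz := ('M[R]_(q, l) * 'cV[R]_d)%type.
Let before t := {s : int | (s < t)%R}.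
Let sigma_before t := g_sigma_family (fun s : before t => noise (sval s)).

Lemma before_lt s t (st : s < t) (i : nat) : s - i%:Z < t.
Proof. by apply: le_lt_trans st; rewrite gerBl. Qed.

Lemma lag_lt (t : int) (i : nat) : t - i.+1%:Z < t.
Proof. by rewrite gtrBl. Qed.

Let X_of s t (st : s < t) (y : path_space (before t) Tz) : 'cV[R]_d :=
  state_head (fun i => y (exist _ (s - i%:Z) (before_lt st i))).

Let measurable_X_of s t (st : s < t) : measurable_fun setT (X_of st).
Proof. by apply: measurable_state_head => i; exact: measurable_coord. Qed.

Let X_ofE s t (st : s < t) w : bekk_X s w = X_of st (fun u => noise (sval u) w).
Proof. by rewrite bekk_XE. Qed.

Lemma sigma_before_X s t : s < t ->
  g_sigma_algebra_preimage (bekk_X s) `<=` sigma_before t.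
Proof.
move=> st; rewrite (_ : bekk_X s = fun w => X_of st (fun u => noise (sval u) w)).
  exact: path_preimage_sub.
by apply/funext => w; exact: X_ofE.
Qed.

Lemma sigma_before_Z s t : s < t ->
  g_sigma_algebra_preimage (bekk_Z s) `<=` sigma_before t.
Proof.
move=> st.
have st' (i : nat) : s - i.+1%:Z < t by exact: lt_trans (lag_lt s i) st.
pose f (y : path_space (before t) Tz) : 'cV[R]_d :=
  invmx (sqrtmx (arch_cov (fun i => X_of (st' i) y))) *m X_of st y.
have mf : measurable_fun setT f.
  apply: measurable_mulmx; last exact: measurable_X_of.
  by apply: measurable_arch_cov_invsqrt => i; exact: measurable_X_of.
rewrite (_ : bekk_Z s = fun w => f (fun u => noise (sval u) w)).
  exact: path_preimage_sub.
apply/funext => w; rewrite /bekk_Z /f bekk_HE -(X_ofE st).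
have e : (fun i : 'I_q => bekk_X (s - i.+1%:Z) w) =
    (fun i : 'I_q => X_of (st' i) (fun u => noise (sval u) w)).
  by apply/funext => i; rewrite (X_ofE (st' i)).
exact: (congr1 (fun x => invmx (sqrtmx (arch_cov x)) *m bekk_X s w) e).
Qed.

Let mu E := P [set w | E (innovation (fun=> 0) (noise 0 w))].

(** Normal linear forms determine the law, so this law depends neither on x nor
    on t. *)
Lemma innovation_same_law x t E : measurable E ->
  P [set w | E (innovation x (noise t w))] = mu E.
Proof.
move=> mE; have [m1 h1] := innovation_law x t; have [m2 h2] := innovation_law (fun=> 0) 0.
apply: (@cramer_wold _ _ (law P m1) (law P m2)) => // u F mF.
have [_ /(_ F mF) e1] := h1 u; have [_ /(_ F mF) e2] := h2 u.
rewrite -[LHS]/(P ((fun w => dot u (innovation x (noise t w))) @^-1` F)) [LHS]e1.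
by rewrite -[RHS]/(P ((fun w => dot u (innovation (fun=> 0) (noise 0 w))) @^-1` F)) [RHS]e2.
Qed.

(** Almost surely Z_t is the innovation computed from the past values of X, a
    function of the earlier noise, and from the independent noise at t; its law
    given the past does not depend on the past by [innovation_same_law]. *)
Lemma bekk_Z_conditional_law t E F : measurable E -> sigma_before t F ->
  P (bekk_Z t @^-1` E `&` F) = (mu E * P F)%E.
Proof.
move=> mE sF; have [F' mF' FE] := g_sigma_family_path sF.
pose W w : path_space (before t) Tz := fun u => noise (sval u) w.
have mW : measurable_fun setT W by apply: measurable_path => u; exact: measurable_noise.
pose h (yz : path_space (before t) Tz * Tz) :=
  innovation (fun i => X_of (lag_lt t i) yz.1) yz.2.
have mh : measurable_fun setT h.
  have mx i : measurable_fun setT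
      (fun yz : path_space (before t) Tz * Tz => X_of (lag_lt t i) yz.1).
    by apply: (measurableT_comp (measurable_X_of _)); exact: measurable_fst.
  apply: measurable_mulmx; first exact: measurable_arch_cov_invsqrt.
  by apply: measurable_arch_step => //; exact: measurable_snd.
have iW : independent P (g_sigma_algebra_preimage W) (g_sigma_algebra_preimage (noise t)).
  apply: (iid_independent_maps noise_iid (s1 := fun u : before t => sval u)
    (s2 := fun _ : unit => t) (f := fun y => y : path_space (before t) Tz)
    (g := fun y : path_space unit Tz => y tt)) => //.
  - by move=> [u ut] _ /= e; rewrite e ltxx in ut.
  - exact: measurable_coord.
have := independent_conditional_law mW (measurable_noise t) mh iW (mu := mu) _ mE mF'.
rewrite -[W @^-1` F']/[set w | F' (fun u => noise (sval u) w)] -FE => <-; last first.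
  by move=> y E' mE'; exact: (innovation_same_law (fun i => X_of (lag_lt t i) y) t mE').
have mF : measurable F.
  rewrite FE -[X in measurable X]setTI; exact: mW.
apply: ae_eq_probability.
- apply: measurableI => //; rewrite -[X in measurable X]setTI.
  exact: measurable_bekk_Z.
- rewrite -[X in measurable X]/(((fun w => h (W w, noise t w)) @^-1` E) `&` (W @^-1` F')).
  apply: measurableI; last by rewrite -[X in measurable X]setTI; exact: mW.
  have mhW : measurable_fun setT (fun w => h (W w, noise t w)).
    by apply: (measurableT_comp mh); apply: measurable_fun_pair => //; exact: measurable_noise.
  by rewrite -[X in measurable X]setTI; exact: mhW.
apply: filterS bekk_X_step => w step.
have hE : bekk_Z t w = h (W w, noise t w).
  rewrite /bekk_Z bekk_HE step /h /innovation /=.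
  have e : (fun i : 'I_q => bekk_X (t - i.+1%:Z) w) =
      (fun i => X_of (lag_lt t i) (W w)).
    by apply/funext => i; rewrite (X_ofE (lag_lt t i)).
  exact: (congr1 (fun x => invmx (sqrtmx (arch_cov x)) *m arch_step x (noise t w)) e).
split=> -[Ew Fw]; split.
- by rewrite -hE; exact: Ew.
- by move: Fw; rewrite {1}FE.
- by rewrite /preimage /= hE; exact: Ew.
- by rewrite FE; exact: Fw.
Qed.

Lemma bekk_Z_law_mu t E : measurable E -> P (bekk_Z t @^-1` E) = mu E.
Proof.
move=> mE; have sT : sigma_before t setT.
  exact: (@measurableT _ (g_sigma_algebraType
    (\bigcup_s preimage_set_system setT (fun w => noise (sval (s : before t)) w) measurable))).
have := bekk_Z_conditional_law mE sT.
by rewrite setIT [P setT]probability_setT mule1.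
Qed.

Lemma bekk_Z_law t : has_centered_normal_law P 1%:M (bekk_Z t).
Proof.
split=> [|u]; first exact: measurable_bekk_Z.
split=> [|F mF].
  exact: (measurableT_comp (measurable_dot u) (measurable_bekk_Z t)).
have [_ /(_ u)[_ /(_ F mF) <-]] := innovation_law (fun=> 0) 0.
have mE : measurable (dot u @^-1` F).
  by rewrite -[X in measurable X]setTI; exact: measurable_dot.
exact: bekk_Z_law_mu mE.
Qed.

Lemma bekk_Z_indep_before t F : sigma_before t F -> forall E,
  g_sigma_algebra_preimage (bekk_Z t) E -> P (E `&` F) = (P E * P F)%E.
Proof.
move=> sF _ [E mE <-]; rewrite setTI.
by rewrite bekk_Z_conditional_law// bekk_Z_law_mu.
Qed.

Lemma bekk_Z_indep_past t : independent P (g_sigma_algebra_preimage (bekk_Z t))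
  (g_sigma_family (fun s : {s : int | (s < t)%R} => bekk_X (sval s))).
Proof.
move=> E F hE hF; apply: bekk_Z_indep_before hE.
have sub : g_sigma_family (fun s : {s : int | (s < t)%R} => bekk_X (sval s)) `<=` sigma_before t.
  apply: smallest_sub; first exact: smallest_sigma_algebra.
  move=> _ [[s st] _ [U mU <-]]; apply: (sigma_before_X st).
  by exists U.
exact: sub.
Qed.

(** Indices are removed from the latest to the earliest: Z at the latest index is
    independent of the earlier noise, of which the others are functions. *)
Lemma bekk_Z_indep :
  mutually_independent P (fun t => g_sigma_algebra_preimage (bekk_Z t)).
Proof.
pose ge_int (a b : int) := (b <= a)%R.
have ge_tr : transitive ge_int by move=> b a c; rewrite /ge_int => /[swap]; exact: le_trans.
have dec : forall (s : seq int) (E : int -> set Omega), sorted ge_int s -> uniq s ->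
    (forall t, t \in s -> g_sigma_algebra_preimage (bekk_Z t) (E t)) ->
    P (\bigcap_(t in [set` s]) E t) = (\prod_(t <- s) P (E t))%E.
  elim=> [|t s IH] E ss us hE.
    by rewrite big_nil set_nil bigcap_set0 [LHS]probability_setT.
  rewrite bigcap_seq !big_cons -bigcap_seq.
  have /andP[ts us'] : (t \notin s) && uniq s := us.
  have sF : sigma_before t (\bigcap_(u in [set` s]) E u).
    apply: g_sigma_bigcap_seq => u us_.
    have ut : u < t.
      rewrite lt_neqAle (memPn ts)//; exact: (allP (order_path_min ge_tr ss)).
    apply: (sigma_before_Z ut); apply: hE.
    by rewrite inE us_ orbT.
  have Et : g_sigma_algebra_preimage (bekk_Z t) (E t) by apply: hE; rewrite mem_head.
  rewrite (bekk_Z_indep_before sF Et).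
  congr (_ * _)%E; apply: IH => //; first exact: path_sorted ss.
  by move=> u us_; apply: hE; rewrite inE us_ orbT.
move=> s E us hE; pose s' := sort ge_int s.
have pe : perm_eq s' s by rewrite perm_sort.
rewrite -(perm_big _ pe) -dec.
- by congr (P _); rewrite (_ : [set` s] = [set` s'])//; apply/seteqP; split => t /=; rewrite (perm_mem pe).
- by apply: sort_sorted => a b; rewrite /ge_int le_total.
- by rewrite (perm_uniq pe).
- by move=> t; rewrite (perm_mem pe); exact: hE.
Qed.

Lemma bekk_X_factor t w : bekk_X t w =
  state_head (fun i => path_shift t (noise^~ w) (- i%:Z)).
Proof.
by rewrite bekk_XE; congr state_head; apply/funext => i; rewrite /path_shift addrC.
Qed.

Let mF : measurable_fun setT (fun y : path_space int Tz => state_head (fun i => y (- i%:Z))).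
Proof. by apply: measurable_state_head => i; exact: measurable_coord. Qed.

Lemma bekk_X_stationary : strictly_stationary P bekk_X.
Proof.
have := factor_stationary noise_iid mF.
by congr strictly_stationary; apply/funext => t; apply/funext => w; rewrite bekk_X_factor.
Qed.

Lemma bekk_X_ergodic : ergodic P bekk_X.
Proof.
have := factor_ergodic noise_iid mF.
by congr ergodic; apply/funext => t; apply/funext => w; rewrite bekk_X_factor.
Qed.

Lemma bekk_arch_XZ : bekk_arch P C A bekk_X bekk_Z.
Proof.
split.
- exact: measurable_bekk_X.
- exact: bekk_Z_law.
- exact: bekk_Z_indep.
- exact: bekk_Z_indep_past.
apply: aeW => w t; rewrite /bekk_Z mulmxA mulmxV ?mul1mx//.
by apply: posdef_unit; apply: sqrtmx_posdef; rewrite bekk_HE; exact: arch_cov_posdef.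
Qed.

End bekk_process.

(** * Stationary solutions of the recurrence and of the BEKK-ARCH process *)

Theorem theorem2p2 (R : realType) (disp : measure_display)
    (Omega : measurableType disp) (P : probability Omega R)
    (d q l : nat) (hd : (0 < d)%N) (hq : (0 < q)%N) (hl : (0 < l)%N)
    (C : 'M[R]_d) (hC : positive_definite C)
    (A : 'I_q -> 'I_l -> 'M[R]_d)
    (m : 'I_q -> 'I_l -> int -> Omega -> R) (B : int -> Omega -> 'cV[R]_d)
    (hmB : bekk_noise P C m B)
    (N : 'cV[R]_(\sum_(i < q) d) -> R) (hN : vector_norm N)
    (hgamma : (top_lyapunov P (bekk_M A m) N < 0)%E) :
  (exists V : int -> Omega -> 'cV[R]_(\sum_(i < q) d),
     stationary_causal_sre_solution P (bekk_M A m) (@bekk_Q _ _ R d q B) V /\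
     forall V' : int -> Omega -> 'cV[R]_(\sum_(i < q) d),
       stationary_causal_sre_solution P (bekk_M A m) (@bekk_Q _ _ R d q B) V' ->
       {ae P, forall w, forall t, V' t w = V t w}) /\
  (exists X Z : int -> Omega -> 'cV[R]_d,
     [/\ bekk_arch P C A X Z, strictly_stationary P X & ergodic P X]).
Proof.
split.
  exists (bekk_V m B A); split; first exact: (bekk_V_solution hC hmB hN hgamma).
  by move=> V'; exact: (bekk_V_unique hC hmB hN hgamma).
exists (bekk_X m B A hq), (bekk_Z C m B A hq); split.
- exact: (bekk_arch_XZ hC hmB hN hgamma).
- exact: (bekk_X_stationary hmB).
- exact: (bekk_X_ergodic hmB).
Qed.
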